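(* Consider the situation $\Omega:=\{(x,y)\in\mathbb{R}^2\mid f_l^2<x^2+y^2<f_r^2\}\subset\bar D:=\mathbb{R}^2$ with $0<f_l<f_r$. Then the following hold. (1) For each $a>0$, the equation $$a\int_{\bar D}\nabla\boldsymbol{s}:\nabla\boldsymbol{u}+\int_{\bar D\setminus\Omega}\boldsymbol{s}\cdot\boldsymbol{u}=\int_\Omega\operatorname{div}\boldsymbol{u}\qquad\forall\,\boldsymbol{u}\in H^1(\bar D)^2$$ admits a unique solution $\boldsymbol{s}\in H^1(\bar D)^2$. (2) The solution is of the form $\boldsymbol{s}=(S(r)\cos\theta,S(r)\sin\theta)$, where $S(r)$ is expressed in terms of the modified Bessel functions $I_n$ and $K_n$. (3) The divergence $\operatorname{div}\boldsymbol{s}$ is constant in the shape domain $\Omega$. (4) The PDE-based thickness $T^a_{\bar D,\Omega}:=\frac{2}{\sqrt a\,\operatorname{div}\boldsymbol{s}}$ converges to the thickness $\bar T_\Omega=f_r-f_l$ on $\Omega$ as $a\to0$. (5) Moreover, the estimate $$0<\frac{3f_r+f_l}{2f_r}\sqrt a\le T^a_{\bar D,\Omega}-\bar T_\Omega\le 2\frac{f_r}{f_l}\sqrt a$$ holds for all $a>0$.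
   Context: For a domain $\Omega\subset\mathbb{R}^N$, the (local) thickness is $\bar T_\Omega(\boldsymbol{x}):=\sup\{\text{diameter of the closed ball } B\mid \boldsymbol{x}\in B\subset\Omega\}$ for $\boldsymbol{x}\in\Omega$; for the annulus it is the constant $f_r-f_l$. $H^1(\mathbb{R}^2)^2$ is the space of vector fields on $\mathbb{R}^2$ whose two components, together with their first partial derivatives, are in $L^2$. $\nabla\boldsymbol{s}:\nabla\boldsymbol{u}=\sum_{i,j}s^i_{x_j}u^i_{x_j}$ is the Frobenius inner product. $(r,\theta)$ are polar coordinates, $(x,y)=(r\cos\theta,r\sin\theta)$. $I_n$ and $K_n$ are the modified Bessel functions of the first and second kind. *)

(* Defs.v *)
From HB Require Import structures.
From mathcomp Require Import all_boot all_order all_algebra.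
From mathcomp Require Import all_classical all_reals all_analysis.

Set Implicit Arguments.
Unset Strict Implicit.
Unset Printing Implicit Defensive.

Import Order.TTheory GRing.Theory Num.Theory.
Import numFieldNormedType.Exports.

Local Open Scope classical_set_scope.
Local Open Scope ring_scope.

(* The plane is [R * R].  Its library norm is the sup norm, which only serves
   for the topology; Euclidean balls are written out explicitly. *)

Definition leb2 (R : realType) :=
  ((@lebesgue_measure R) \x (@lebesgue_measure R))%E.

Arguments leb2 R : clear implicits.

Definition basis2 (R : realType) (j : 'I_2) : R * R :=
  ((j == 0)%:R, (j == 1)%:R).

Definition partial (R : realType) (j : 'I_2) (f : R * R -> R) : R * R -> R :=
  fun p => 'D_(basis2 R j) f p.

Definition iter_partial (R : realType) (js : seq 'I_2) (f : R * R -> R) :=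
  foldr (@partial R) f js.

Definition smooth (R : realType) (f : R * R -> R) : Prop :=
  forall js : seq 'I_2, continuous (iter_partial js f) /\
    (forall (j : 'I_2) (p : R * R),
        derivable (iter_partial js f) p (basis2 R j)).

(* C_c^infty(R^2) *)
Definition test_function (R : realType) (phi : R * R -> R) : Prop :=
  smooth phi /\ compact (closure [set p | phi p != 0]).

Definition L2 (R : realType) : set (R * R -> R) :=
  [set f | f \in Lfun (leb2 R) 2%:E].

(* [g] is a weak (distributional) j-th partial derivative of [f], lying in
   L^2. *)
Definition is_weak_partial (R : realType) (j : 'I_2) (f g : R * R -> R) : Prop :=
  L2 g /\ forall phi : R * R -> R, test_function phi ->
    \int[leb2 R]_p (f p * partial j phi p) = - \int[leb2 R]_p (g p * phi p).

(* Elements are functions rather than classes: equality in H^1 is equality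
   almost everywhere. *)
Definition H1 (R : realType) : set (R * R -> R) :=
  [set f | L2 f /\ forall j : 'I_2, exists g, is_weak_partial j f g].

(* A chosen representative of the weak partial derivative (which is unique up
   to a null set); it is meaningful for [f] in [H1]. *)
Definition weak_partial (R : realType) (j : 'I_2) (f : R * R -> R) : R * R -> R :=
  xget (cst 0) [set g | is_weak_partial j f g].

Notation vfield R := ('I_2 -> R * R -> R).

Definition H1v (R : realType) : set (vfield R) :=
  [set u | forall i, H1 (u i)].

Definition frob_grad (R : realType) (s u : vfield R) (p : R * R) : R :=
  \sum_(i < 2) \sum_(j < 2) weak_partial j (s i) p * weak_partial j (u i) p.

Definition dotv (R : realType) (s u : vfield R) (p : R * R) : R :=
  \sum_(i < 2) s i p * u i p.

Definition wdiv (R : realType) (u : vfield R) (p : R * R) : R :=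
  \sum_(i < 2) weak_partial i (u i) p.

Definition ae_eq_vfield (R : realType) (s t : vfield R) : Prop :=
  {ae leb2 R, forall p, forall i, s i p = t i p}.

Definition weak_solution (R : realType) (D Omega : set (R * R)) (a : R)
    (s : vfield R) : Prop :=
  H1v s /\ forall u : vfield R, H1v u ->
    a * \int[leb2 R]_(p in D) frob_grad s u p
      + \int[leb2 R]_(p in D `\` Omega) dotv s u p
    = \int[leb2 R]_(p in Omega) wdiv u p.

Definition pde_thickness (R : realType) (a : R) (s : vfield R) (p : R * R) : R :=
  2 / (Num.sqrt a * wdiv s p).

Definition euclid_closed_ball (R : realType) (c : R * R) (rho : R) : set (R * R) :=
  [set p | (p.1 - c.1) ^+ 2 + (p.2 - c.2) ^+ 2 <= rho ^+ 2].

Definition thickness (R : realType) (Omega : set (R * R)) (x : R * R) : R :=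
  sup [set d | exists c rho, [/\ 0 < rho, euclid_closed_ball c rho x,
    euclid_closed_ball c rho `<=` Omega & d = 2 * rho]].

Definition annulus (R : realType) (fl fr : R) : set (R * R) :=
  [set p | fl ^+ 2 < p.1 ^+ 2 + p.2 ^+ 2 < fr ^+ 2].

(* I_n(x) = sum_k (x/2)^(2k+n) / (k! (k+n)!) *)
Definition besselI (R : realType) (n : nat) (x : R) : R :=
  limn (series (fun k : nat =>
    (x / 2) ^+ (k.*2 + n) / ((k`!)%:R * ((k + n)`!)%:R))).

Definition cosh (R : realType) (t : R) : R := (expR t + expR (- t)) / 2.

(* K_n(x) = int_0^oo exp(- x cosh t) cosh(n t) dt, for x > 0 *)
Definition besselK (R : realType) (n : nat) (x : R) : R :=
  \int[@lebesgue_measure R]_(t in `[0, +oo[)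
    (expR (- (x * cosh t)) * cosh (n%:R * t)).

(* The radial profile S of the solution.  In each of the three regions the
   equation for S(r) e_r is an ODE: a multiple of I_1(r / sqrt a) is the
   solution that is regular at 0, a multiple of K_1(r / sqrt a) the one that is
   integrable at infinity, and A r + B / r the general solution in the annulus.
   The four coefficients are those for which S and the flux a S' - 1_Omega are
   continuous at fl and fr, i.e. (as I_1' = I_0 - I_1 / x and
   K_1' = - K_0 - K_1 / x), with k = sqrt a,
     1 - 2 k^2 A = - k c_I I_0 (fl / k) = k c_K K_0 (fr / k). *)
Definition annulus_profile (R : realType) (fl fr a r : R) : R :=
  let k := Num.sqrt a in
  let qI := besselI 1 (fl / k) / besselI 0 (fl / k) in
  let qK := besselK 1 (fr / k) / besselK 0 (fr / k) in
  let q := fr * qK + fl * qI in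
  let delta := k * (fr ^+ 2 - fl ^+ 2 + 2 * k * q) in
  if r <= fl then
    - ((fr ^+ 2 - fl ^+ 2) / delta * (besselI 1 (r / k) / besselI 0 (fl / k)))
  else if r < fr then
    q / delta * r - fl * fr * (fl * qK + fr * qI) / delta / r
  else
    (fr ^+ 2 - fl ^+ 2) / delta * (besselK 1 (r / k) / besselK 0 (fr / k)).

(* Main.v *)
(* Write k = sqrt a.  The radial field s = S(r) e_r has components x_i h(r^2).  Its
   Jacobian F is symmetric, and S solves the radial ODE in each of the three
   regions exactly when a tr F = G + 1_Omega for a function G whose gradient is
   the restriction of s to the complement of Omega.  As s is a gradient,
   integrating F_01 against d_1 u_0 gives the same as integrating F_11 against
   d_0 u_0, so that
     a int F : grad u = int (G + 1_Omega) div u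
                      = int_Omega div u - int_(R^2 \ Omega) s . u,
   which is the weak equation.  Conversely, testing the equation for the
   difference of two solutions with that difference shows that it has zero
   gradient and vanishes off Omega, hence vanishes.

   In Omega one gets div s = 2 A with 1 / (k A) = 2 k + (fr^2 - fl^2) / q, where
   q = fr K_1/K_0(fr/k) + fl I_1/I_0(fl/k), so that
     T - (fr - fl) = 2 k + (fr - fl) (fr + fl - q) / q.
   The lower bound follows from I_1 <= I_0 and x K_1 <= (x + 1/2) K_0, the upper
   bound from K_0 <= K_1 and x (I_0 - I_1) <= I_0. *)

Require Import Defs.
From HB Require Import structures.
From mathcomp Require Import all_boot all_order all_algebra.
From mathcomp Require Import all_classical all_reals all_analysis measurable_realfun.
From mathcomp Require Import ring lra.
Import Order.TTheory GRing.Theory Num.Theory.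
Import numFieldNormedType.Exports.
Local Open Scope classical_set_scope.
Local Open Scope ring_scope.

Set Implicit Arguments.
Unset Strict Implicit.
Unset Printing Implicit Defensive.

(** * Smooth functions of one variable *)

(** The obstacle is that an element of H^1 is known only through its integrals against test
    functions, while the solution is merely Lipschitz across the two circles and its support is not
    compact, so that neither factor of an integration by parts is a test function. The field s and
    the function G are therefore obtained as pointwise limits of smooth compactly supported
    functions which, together with their partial derivatives, are dominated by one fixed integrable
    weight; each identity is proved for the approximants and survives the limit. Everything radial
    is written in the variable t = r^2: x_i h(r^2) is smooth at the origin as soon as h is, and
    I_1(r/k)/r is an entire function of t. In this variable the radial equation reads 2 a (h + t h')
    = G + 1_Omega, where 2 G' = h off Omega and G' = 0 in Omega. At the end of the uniqueness
    argument, a function with bounded support and zero x-derivative is shown to vanish by testing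
    with primitives in x of smoothed indicators of rectangles. *)

Lemma near_ltr {R : realType} (x a : R) : x < a -> \forall y \near x, y < a.
Proof. exact: lt_nbhsl. Qed.

Lemma near_gtr {R : realType} (x a : R) : a < x -> \forall y \near x, a < y.
Proof. by move=> ax; apply: open_nbhs_nbhs; split=> //; exact: open_gt. Qed.

Lemma is_derive_conv {R : numFieldType} {V W : normedModType R} (f g : V -> W) x v df dg :
  is_derive x v f df -> (forall y, f y = g y) -> df = dg -> is_derive x v g dg.
Proof. by move=> + /funext <- <-. Qed.

(** [U] is meant to be open, so that each [derive1] at a point of [U] sees only nearby values of
    [f]. Counting derivatives lets all closure properties, quotients and compositions included, be
    proved by induction on [n]. *)
Fixpoint nderivable {R : realType} (U : set R) (n : nat) (f : R -> R) : Prop :=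
  if n is m.+1 then (forall x, U x -> derivable f x 1) /\ nderivable U m (derive1 f)
  else True.

Definition smooth_on {R : realType} (U : set R) (f : R -> R) : Prop :=
  forall n, nderivable U n f.

Section nderivable.
Context {R : realType} (U : set R) (oU : open U).
Implicit Types (f g : R -> R).

Lemma nderivable_ext n f g : (forall x, U x -> f x = g x) ->
  nderivable U n f -> nderivable U n g.
Proof.
elim: n f g => [//|n IH] f g fg [df sf].
have nfg x : U x -> \forall y \near x, f y = g y.
  move=> Ux; have := open_nbhs_nbhs (conj oU Ux).
  by apply: filterS => y; exact: fg.
split=> [x Ux|].
  by apply: near_eq_derivable (df _ Ux); exact: nfg.
apply: IH sf => x Ux; rewrite !derive1E; apply: near_eq_derive; exact: nfg.
Qed.

Lemma nderivableS n f g : (forall x, U x -> is_derive x 1 f (g x)) ->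
  nderivable U n g -> nderivable U n.+1 f.
Proof.
move=> dfg sg; split=> [x Ux|]; first by case: (dfg x Ux).
apply: nderivable_ext sg => x Ux; rewrite derive1E.
by case: (dfg x Ux).
Qed.

Lemma nderivable_le n f : nderivable U n.+1 f -> nderivable U n f.
Proof. by elim: n f => [//|n IH] f [df sf]; split=> //; exact: IH. Qed.

Lemma nderivable_is_derive n f x : nderivable U n.+1 f -> U x ->
  is_derive x 1 f ((derive1 f) x).
Proof. by move=> [df _] Ux; split; [exact: df|rewrite derive1E]. Qed.

Lemma nderivable_cst n (c : R) : nderivable U n (fun=> c).
Proof.
elim: n c => [//|n IH] c; apply: (nderivableS (g := fun=> 0)) => // x Ux.
Qed.

Lemma nderivable_id n : nderivable U n id.
Proof.
case: n => [//|n]; apply: (nderivableS (g := fun=> 1)) => //.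
exact: nderivable_cst.
Qed.

Lemma nderivableD n f g : nderivable U n f -> nderivable U n g ->
  nderivable U n (fun x => f x + g x).
Proof.
elim: n f g => [//|n IH] f g sf sg.
apply: (nderivableS (g := fun x => (derive1 f) x + (derive1 g) x)) => [x Ux|].
  exact: is_deriveD (nderivable_is_derive sf Ux) (nderivable_is_derive sg Ux).
by apply: IH; [case: sf|case: sg].
Qed.

Lemma nderivableM n f g : nderivable U n f -> nderivable U n g ->
  nderivable U n (fun x => f x * g x).
Proof.
elim: n f g => [//|n IH] f g sf sg.
apply: (nderivableS (g := fun x => f x * (derive1 g) x + g x * (derive1 f) x)) => [x Ux|].
  exact: is_deriveM (nderivable_is_derive sf Ux) (nderivable_is_derive sg Ux).
apply: nderivableD; apply: IH.
- exact: nderivable_le sf.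
- by case: sg.
- exact: nderivable_le sg.
- by case: sf.
Qed.

Lemma nderivableV n f : (forall x, U x -> f x != 0) -> nderivable U n f ->
  nderivable U n (fun x => (f x)^-1).
Proof.
move=> f0; elim: n f f0 => [//|n IH] f f0 sf.
apply: (nderivableS (g := fun x => - 1 * ((f x)^-1 * ((f x)^-1 * (derive1 f) x)))) => [x Ux|].
  have := @is_deriveV _ f x _ 1 (f0 _ Ux) (nderivable_is_derive sf Ux).
  by move/is_derive_conv; apply=> //; rewrite /GRing.scale/= -exprVn expr2; ring.
apply: nderivableM; first exact: nderivable_cst.
have sV : nderivable U n (fun x => (f x)^-1) by apply: IH => //; exact: nderivable_le.
by apply: nderivableM => //; apply: nderivableM => //; case: sf.
Qed.

End nderivable.

Lemma nderivable_comp {R : realType} (U V : set R) (oU : open U) (oV : open V) n (f g : R -> R) :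
  (forall x, U x -> V (g x)) -> nderivable V n f -> nderivable U n g ->
  nderivable U n (fun x => f (g x)).
Proof.
move=> UV; elim: n f => [//|n IH] f sf sg.
apply: (@nderivableS _ _ oU _ (fun x => f (g x)) (fun x => (derive1 g) x * (derive1 f) (g x))) => [x Ux|].
  have := @is_derive1_comp _ f g x _ _ (nderivable_is_derive sf (UV _ Ux))
    (nderivable_is_derive sg Ux).
  by move/is_derive_conv; apply=> //; rewrite mulrC.
apply: nderivableM => //; first by case: sg.
by apply: IH; [case: sf|exact: nderivable_le].
Qed.

Lemma nderivable_setU {R : realType} (U V : set R) n (f : R -> R) :
  nderivable U n f -> nderivable V n f -> nderivable (U `|` V) n f.
Proof.
elim: n f => [//|n IH] f [dU sU] [dV sV]; split=> [x [/dU|/dV]//|].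
exact: IH.
Qed.

Lemma nderivable_subset {R : realType} (U V : set R) n (f : R -> R) : U `<=` V ->
  nderivable V n f -> nderivable U n f.
Proof.
move=> UV; elim: n f => [//|n IH] f [dV sV]; split=> [x /UV/dV//|].
exact: IH.
Qed.

Section smooth_on.
Context {R : realType} (U : set R) (oU : open U).
Implicit Types (f g : R -> R).

Lemma smooth_on_ext f g : (forall x, U x -> f x = g x) ->
  smooth_on U f -> smooth_on U g.
Proof. by move=> fg sf n; exact: nderivable_ext (sf n). Qed.

Lemma smooth_on_derive f : smooth_on U f -> smooth_on U (derive1 f).
Proof. by move=> sf n; case: (sf n.+1). Qed.

Lemma smooth_on_is_derive f x : smooth_on U f -> U x -> is_derive x 1 f ((derive1 f) x).
Proof. by move=> /(_ 1); exact: nderivable_is_derive. Qed.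

Lemma smooth_on_cst (c : R) : smooth_on U (fun=> c).
Proof. by move=> n; exact: nderivable_cst. Qed.

Lemma smooth_on_id : smooth_on U id.
Proof. by move=> n; exact: nderivable_id. Qed.

Lemma smooth_onD f g : smooth_on U f -> smooth_on U g ->
  smooth_on U (fun x => f x + g x).
Proof. by move=> sf sg n; exact: nderivableD. Qed.

Lemma smooth_onM f g : smooth_on U f -> smooth_on U g ->
  smooth_on U (fun x => f x * g x).
Proof. by move=> sf sg n; exact: nderivableM. Qed.

Lemma smooth_onZ c f : smooth_on U f -> smooth_on U (fun x => c * f x).
Proof. by move=> sf; apply: smooth_onM => //; exact: smooth_on_cst. Qed.

Lemma smooth_onB f g : smooth_on U f -> smooth_on U g ->
  smooth_on U (fun x => f x - g x).
Proof.
move=> sf sg; apply: (smooth_on_ext (f := fun x => f x + (-1) * g x)).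
  by move=> x _; rewrite mulN1r.
by apply: smooth_onD => //; exact: smooth_onZ.
Qed.

Lemma smooth_onV f : (forall x, U x -> f x != 0) -> smooth_on U f ->
  smooth_on U (fun x => (f x)^-1).
Proof. by move=> f0 sf n; exact: nderivableV. Qed.

Lemma smooth_on_comp (V : set R) (oV : open V) f g : (forall x, U x -> V (g x)) ->
  smooth_on V f -> smooth_on U g -> smooth_on U (fun x => f (g x)).
Proof. by move=> UV sf sg n; exact: (nderivable_comp oU oV UV). Qed.

End smooth_on.

Notation smooth1 := (smooth_on setT).

Lemma smooth1_continuous {R : realType} (f : R -> R) : smooth1 f -> continuous f.
Proof.
move=> sf x; apply: differentiable_continuous; apply/derivable1_diffP.
by case: (smooth_on_is_derive sf (x := x) I).
Qed.

(** * A smooth step function *)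

Section smooth_step.
Context {R : realType}.
Implicit Types (x y c : R) (p : {poly R}).

(** The difference quotient at 0 is at most [c * |h|]. This covers the point 0 in the
    differentiation of [flat], where two formulas meet. *)
Lemma quadratic_is_derive0 (f : R -> R) c : (forall x, `|f x| <= c * x ^+ 2) ->
  is_derive (0 : R) 1 f 0.
Proof.
move=> fc; have f0 : f 0 = 0.
  by apply/eqP; rewrite -normr_le0 (le_trans (fc 0))// expr0n/= mulr0.
have cv : h^-1 *: (f (h *: (1 : R) + 0) - f 0) @[h --> (0 : R)^'] --> (0 : R).
  apply: norm_cvg0; apply: (@squeeze_cvgr _ _ _ _ (cst 0) (fun h => c * `|h|)).
  - near=> h; rewrite normr_ge0/= f0 subr0 addr0 /GRing.scale/= mulr1 normrM normfV.
    have h0 : h != 0 by near: h; exact: nbhs_dnbhs_neq.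
    rewrite mulrC ler_pdivrMr ?normr_gt0// -mulrA -expr2 real_normK ?num_real//.
  - exact: cvg_cst.
  - rewrite -[X in _ --> X](mulr0 c).
    apply: cvgM; first exact: cvg_cst.
    apply: cvg_within_filter.
    have nc : continuous (fun h : R => `|h|) by move=> h; exact: norm_continuous.
    by have := nc 0; rewrite /continuous_at normr0.
split; first by apply/cvg_ex; exists 0.
by apply/cvg_lim.
Unshelve. all: by end_near. Qed.

(** A single term of the exponential series bounds y^n / n! by exp y. *)
Lemma powMexpRN_le n y : 0 <= y -> y ^+ n * expR (- y) <= n`!%:R.
Proof.
move=> y0; rewrite expRN ler_pdivrMr ?expR_gt0//.
case: n => [|n].
  by rewrite expr0 fact0 mul1r -expR0 ler_expR.
rewrite -ler_pdivrMl ?ltr0n ?fact_gt0// mulrC.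
by apply: le_trans (expR_ge1Dxn n y0); rewrite lerDr.
Qed.

Lemma polyMexpRN_bounded p : exists c, forall y, 0 <= y -> `|p.[y] * expR (- y)| <= c.
Proof.
exists (\sum_(i < size p) `|p`_i| * i`!%:R) => y y0.
rewrite horner_coef mulr_suml (le_trans (ler_norm_sum _ _ _))//.
apply: ler_sum => i _; rewrite -mulrA normrM ler_wpM2l//.
by rewrite ger0_norm ?powMexpRN_le// mulr_ge0 ?exprn_ge0 ?expR_ge0.
Qed.

(** The functions p(1/x) exp(-1/x) form a family stable under differentiation, with p replaced by
    X^2 (p - p'), so smoothness of all of them is one induction. [flat 1] is the classical flat
    function. *)
Definition flat p x := if 0 < x then p.[x^-1] * expR (- x^-1) else 0.

Lemma is_derive_flat p x : is_derive x 1 (flat p) (flat ('X^2 * (p - p^`())) x).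
Proof.
have [x0|x0|->] := ltgtP x 0.
- rewrite {2}/flat ltNge (ltW x0)/=.
  apply: (@near_eq_is_derive _ _ _ (fun _ : R => 0 : R)).
  by near=> y; rewrite /flat ltNge ltW//=; near: y; exact: near_ltr.
- rewrite {2}/flat x0 hornerM hornerXn hornerD hornerN.
  apply: (@near_eq_is_derive _ _ _ (fun y => p.[y^-1] * expR (- y^-1))).
    by near=> y; rewrite /flat ifT//; near: y; exact: near_gtr.
  have dV : is_derive x 1 (fun y : R => y^-1) (- x ^- 2).
    have := @is_deriveV _ id x _ 1 (lt0r_neq0 x0) (is_derive_id x 1).
    by move/is_derive_conv; apply=> //; rewrite /GRing.scale/= mulr1.
  have d1 := @is_derive1_comp _ (horner p) (fun y : R => y^-1) x _ _ (is_derive_poly p _) dV.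
  have d2 := @is_derive1_comp _ expR (fun y : R => - y^-1) x _ _ (is_derive_expR _) (is_deriveN dV).
  apply: is_derive_conv (is_deriveM d1 d2) _ _ => //.
  rewrite /GRing.scale/= exprVn; ring.
- rewrite {2}/flat ltxx.
  (* With y = 1/x, boundedness of y^2 p(y) exp(-y) says that [flat p x] is at most c x^2 in absolute
     value. *)
  have [c cP] := polyMexpRN_bounded ('X^2 * p).
  have c0 : 0 <= c by apply: le_trans (cP 0 _); rewrite ?normr_ge0.
  apply: (@quadratic_is_derive0 _ c) => {}x; rewrite /flat.
  case: ifPn => [x0|_]; last by rewrite normr0 mulr_ge0// sqr_ge0.
  have V0 : 0 <= x^-1 by rewrite invr_ge0 ltW.
  have := cP _ V0; rewrite hornerM hornerXn -mulrA normrM ger0_norm ?exprn_ge0//.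
  by rewrite exprVn ler_pdivrMl ?exprn_gt0// (mulrC c).
Unshelve. all: by end_near. Qed.

Lemma flat_smooth p : smooth1 (flat p).
Proof.
move=> n; elim: n p => [//|n IH] p.
apply: nderivableS; [exact: openT|by move=> x _; exact: is_derive_flat|exact: IH].
Qed.

Definition smooth_step x := flat 1 x / (flat 1 x + flat 1 (1 - x)).

Let flat_ge0 x : 0 <= flat 1 x.
Proof. by rewrite /flat; case: ifP => // _; rewrite hornerC mul1r expR_ge0. Qed.

Let flat_gt0 x : 0 < x -> 0 < flat 1 x.
Proof. by rewrite /flat => ->; rewrite hornerC mul1r expR_gt0. Qed.

Let flat_eq0 x : x <= 0 -> flat 1 x = 0.
Proof. by rewrite /flat leNgt => /negbTE ->. Qed.

Let denom_gt0 x : 0 < flat 1 x + flat 1 (1 - x).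
Proof.
have [x0|x0] := ltP 0 x; first by rewrite ltr_pwDl// flat_gt0.
by rewrite ltr_wpDl// flat_gt0// subr_gt0 (le_lt_trans x0).
Qed.

Lemma smooth_step0 x : x <= 0 -> smooth_step x = 0.
Proof. by move=> x0; rewrite /smooth_step flat_eq0// mul0r. Qed.

Lemma smooth_step1 x : 1 <= x -> smooth_step x = 1.
Proof.
move=> x1; rewrite /smooth_step (flat_eq0 (x := 1 - x)) ?subr_le0// addr0 divff//.
by rewrite gt_eqF// flat_gt0// (lt_le_trans ltr01).
Qed.

Lemma smooth_step_ge0 x : 0 <= smooth_step x.
Proof. by rewrite /smooth_step divr_ge0// addr_ge0. Qed.

Lemma smooth_step_le1 x : smooth_step x <= 1.
Proof. by rewrite /smooth_step ler_pdivrMr// mul1r lerDl. Qed.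

Lemma smooth_step_smooth : smooth1 smooth_step.
Proof.
apply: smooth_onM; [exact: openT|exact: flat_smooth|].
apply: smooth_onV; [exact: openT|by move=> x _; rewrite gt_eqF|].
apply: smooth_onD; [exact: openT|exact: flat_smooth|].
apply: smooth_on_comp; [exact: openT|exact: openT|by []|exact: flat_smooth|].
apply: smooth_onB; [exact: openT|exact: (smooth_on_cst openT)|exact: (smooth_on_id openT)].
Qed.

(** Outside [0, 1] the step is locally constant; the endpoints are reached as one-sided limits,
    because the derivative is continuous. *)
Lemma smooth_step_derive0 x : (x <= 0) || (1 <= x) -> (derive1 smooth_step) x = 0.
Proof.
have ct : continuous (derive1 smooth_step).
  by apply: smooth1_continuous; apply: smooth_on_derive; exact: smooth_step_smooth.
have H y : (y < 0) || (1 < y) -> (derive1 smooth_step) y = 0.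
  rewrite derive1E => /orP[y0|y1].
    rewrite (@near_eq_derive _ _ _ _ (fun _ : R => 0 : R)) ?derive_cst//.
    by near=> z; rewrite smooth_step0// ltW//; near: z; exact: near_ltr.
  rewrite (@near_eq_derive _ _ _ _ (fun _ : R => 1 : R)) ?derive_cst//.
  by near=> z; rewrite smooth_step1// ltW//; near: z; exact: near_gtr.
move=> /orP[]; rewrite le_eqVlt => /orP[/eqP x0|x0].
- rewrite x0; have : (derive1 smooth_step) y @[y --> (0:R)^'-] --> (derive1 smooth_step) 0.
    by apply: cvg_at_left_filter; exact: ct.
  move=> /cvg_lim <-//; apply/cvg_lim => //; apply: cvg_near_cst.
  by near=> y; rewrite H//; apply/orP; left; near: y; exact: nbhs_left_lt.
- by rewrite H// x0.
- rewrite -x0; have : (derive1 smooth_step) y @[y --> (1:R)^'+] --> (derive1 smooth_step) 1.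
    by apply: cvg_at_right_filter; exact: ct.
  move=> /cvg_lim <-//; apply/cvg_lim => //; apply: cvg_near_cst.
  by near=> y; rewrite H//; apply/orP; right; near: y; exact: nbhs_right_gt.
- by rewrite H// x0 orbT.
Unshelve. all: by end_near. Qed.

Lemma smooth_step_derive_bounded : exists2 c, 0 <= c & forall x, `|(derive1 smooth_step) x| <= c.
Proof.
have ct : continuous (derive1 smooth_step).
  by apply: smooth1_continuous; apply: smooth_on_derive; exact: smooth_step_smooth.
have [x0 _ x0P] := @EVT_max R (fun x => `|(derive1 smooth_step) x|) 0 1 ler01
  (continuous_subspaceT (fun x => cvg_norm (ct x))).
exists `|(derive1 smooth_step) x0|; first exact: normr_ge0.
move=> x.
have [x01|] := boolP (x \in `[0, 1]); first exact: x0P.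
by rewrite in_itv/= negb_and -!ltNge => /orP[]/ltW h; rewrite smooth_step_derive0 ?h ?orbT// normr0.
Qed.

End smooth_step.

Definition pcoord {R : realType} (j : 'I_2) (p : R * R) : R := if j == 0 then p.1 else p.2.

Definition set_coord {R : realType} (j : 'I_2) (p : R * R) (s : R) : R * R :=
  if j == 0 then (s, p.2) else (p.1, s).

(** * Calculus and square integrable functions in the plane *)

Section plane_calculus.
Context {R : realType}.
Implicit Types (f g : R * R -> R) (p : R * R) (j : 'I_2).

Let shift_coord p j (h : R) :
  h *: basis2 R j + p = set_coord j p (h *: (1 : R) + pcoord j p).
Proof.
case: p => x y; rewrite /set_coord /pcoord /basis2.
have -> : (j == 1) = (j != 0) by case: j => [[|[|]]].
case: (j == 0) => /=; congr pair; rewrite /= ?scaler0 ?add0r//.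
Qed.

Let set_coord_id p j : set_coord j p (pcoord j p) = p.
Proof. by case: p => x y; rewrite /set_coord /pcoord; case: (j == 0). Qed.

(** Both derivatives are limits of the same quotient, since moving along [basis2 R j] changes only
    coordinate [j]. *)
Lemma is_derive_coord f p j d :
  is_derive p (basis2 R j) f d <->
  is_derive (pcoord j p) 1 (fun s => f (set_coord j p s)) d.
Proof.
pose g s := f (set_coord j p s).
pose F (h : R) : R := h^-1 *: ((f \o shift p) (h *: basis2 R j) - f p).
pose G (h : R) : R := h^-1 *: ((g \o shift (pcoord j p)) (h *: (1 : R)) - g (pcoord j p)).
have FG : F = G by apply/funext => h; rewrite /F /G /= shift_coord /g set_coord_id.
have Ed : derivable f p (basis2 R j) = derivable g (pcoord j p) 1.
  by rewrite -[LHS]/(cvg (F @ 0^')) FG.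
have EE : 'D_(basis2 R j) f p = 'D_1 g (pcoord j p).
  by rewrite -[LHS]/(lim (F @ 0^')) FG.
by split=> -[]; [rewrite Ed EE|rewrite -Ed -EE] => ? ?; split.
Qed.

Lemma partialE f p j d : is_derive p (basis2 R j) f d -> partial j f p = d.
Proof. by case. Qed.

Lemma coord_continuous j : continuous (@pcoord R j).
Proof.
move=> p; rewrite /pcoord; case: (j == 0); [exact: cvg_fst|exact: cvg_snd].
Qed.

(** A concrete class containing every approximant used below. Its closure under partial derivatives
    makes the members [smooth], and the equality of mixed partials is inherited from the
    generators. *)
Inductive elem : (R * R -> R) -> Prop :=
| elem_coord j (f : R -> R) : smooth1 f -> elem (fun p => f (pcoord j p))
| elem_rad (f : R -> R) : smooth1 f -> elem (fun p => f (p.1 ^+ 2 + p.2 ^+ 2))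
| elem_add f g : elem f -> elem g -> elem (fun p => f p + g p)
| elem_mul f g : elem f -> elem g -> elem (fun p => f p * g p).

Lemma elem_cst (c : R) : elem (fun=> c).
Proof. exact: (@elem_coord 0 (fun=> c) (smooth_on_cst openT c)). Qed.

Lemma elem_continuous f : elem f -> continuous f.
Proof.
elim=> [j {}f sf|{}f sf|{}f g _ cf _ cg|{}f g _ cf _ cg] p.
- by apply: continuous_comp; [exact: coord_continuous|exact: smooth1_continuous].
- apply: (continuous_comp (f := fun p : R * R => p.1 ^+ 2 + p.2 ^+ 2));
    last exact: smooth1_continuous.
  by apply: cvgD; apply: cvgM; (exact: cvg_fst || exact: cvg_snd).
- exact: cvgD (cf p) (cg p).
- exact: cvgM (cf p) (cg p).
Qed.

(** First and second partials are produced together, because the second partials of a product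
    involve both orders of both factors; the symmetry of [f2] is carried through the induction. *)
Lemma elem_partial f : elem f -> exists f1 : 'I_2 -> R * R -> R,
  exists2 f2 : 'I_2 -> 'I_2 -> R * R -> R,
  (forall i j, elem (f1 i) /\ elem (f2 i j) /\ f2 i j = f2 j i) &
  (forall i j p, is_derive p (basis2 R i) f (f1 i p) /\
                 is_derive p (basis2 R j) (f1 i) (f2 i j p)).
Proof.
elim=> [k {}f sf|{}f sf|{}f g _ [f1 [f2 ef df]] _ [g1 [g2 eg dg]]
       |{}f g ef0 [f1 [f2 ef df]] eg0 [g1 [g2 eg dg]]].
- have sf1 := smooth_on_derive sf; have sf2 := smooth_on_derive sf1.
  exists (fun i p => (i == k)%:R * derive1 f (pcoord k p)).
  exists (fun i j p => (i == k)%:R * (j == k)%:R * derive1 (derive1 f) (pcoord k p)).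
    move=> i j; split; first by apply: elem_mul; [exact: elem_cst|exact: elem_coord].
    split; first by apply: elem_mul; [exact: elem_cst|exact: elem_coord].
    by apply/funext => p; rewrite (mulrC (i == k)%:R).
  have D (h : R -> R) i p : smooth1 h ->
      is_derive p (basis2 R i) (fun p => h (pcoord k p)) ((i == k)%:R * derive1 h (pcoord k p)).
    move=> sh; apply/is_derive_coord; have [->|ik] := eqVneq i k.
      have := smooth_on_is_derive (x := pcoord k p) sh I.
      move=> /is_derive_conv; apply; last by rewrite mul1r.
      by move=> s; rewrite /pcoord /set_coord; case: (k == 0).
    apply: (@is_derive_conv _ _ _ (fun=> h (pcoord k p))); [|by rewrite mul0r].
    move=> s; move: ik; rewrite /pcoord /set_coord.
    by case: i => [[|[|i]]] // ?; case: k => [[|[|k]]].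
  move=> i j p; split; first exact: D.
  have := is_deriveZ (i == k)%:R (D _ j p sf1).
  by move/is_derive_conv; apply => //; rewrite /GRing.scale/= mulrA.
- have sf1 := smooth_on_derive sf; have sf2 := smooth_on_derive sf1.
  pose q (p : R * R) := p.1 ^+ 2 + p.2 ^+ 2.
  have cE i : elem (@pcoord R i) by exact: (@elem_coord i id (smooth_on_id openT)).
  have q2 (h : R -> R) i p : smooth1 h ->
      is_derive p (basis2 R i) (fun p => h (q p)) (2 * pcoord i p * derive1 h (q p)).
    move=> sh; apply/is_derive_coord.
    have dq : is_derive (pcoord i p) 1 (fun s => q (set_coord i p s)) (2 * pcoord i p).
      rewrite /q /set_coord /pcoord; case: (i == 0) => /=.
      + have := is_deriveD (is_deriveX 2 (is_derive_id p.1 (1 : R)))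
          (is_derive_cst (p.2 ^+ 2) p.1 (1 : R)).
        by move/is_derive_conv; apply => //; rewrite /GRing.scale/= addr0 mulr1 expr1 mulr_natl.
      + have := is_deriveD (is_derive_cst (p.1 ^+ 2) p.2 (1 : R)) (is_deriveX 2 (is_derive_id p.2 (1 : R))).
        by move/is_derive_conv; apply => //; rewrite /GRing.scale/= add0r mulr1 expr1 mulr_natl.
    have E : q (set_coord i p (pcoord i p)) = q p by rewrite set_coord_id.
    have := @is_derive1_comp _ h (fun s => q (set_coord i p s)) _ _ _
      (smooth_on_is_derive (x := q (set_coord i p (pcoord i p))) sh I) dq.
    by move/is_derive_conv; apply => //; rewrite E mulrC.
  exists (fun i p => 2 * pcoord i p * derive1 f (q p)).
  exists (fun i j p => 4 * pcoord i p * pcoord j p * derive1 (derive1 f) (q p) + 2 * (i == j)%:R * derive1 f (q p)).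
    move=> i j; split; [|split].
    + by apply: elem_mul; [apply: elem_mul => //; exact: elem_cst|exact: elem_rad].
    + apply: elem_add; apply: elem_mul; [|exact: elem_rad| |exact: elem_rad].
        by apply: elem_mul => //; apply: elem_mul => //; exact: elem_cst.
      exact: (elem_mul (elem_cst 2) (elem_cst _)).
    + by apply/funext => p; rewrite eq_sym; ring.
  move=> i j p; split; first exact: q2.
  have dc : is_derive p (basis2 R j) (fun p => 2 * pcoord i p) (2 * (i == j)%:R).
    apply/is_derive_coord; have [->|ij] := eqVneq i j.
      have := is_deriveZ 2 (is_derive_id (pcoord j p) (1 : R)).
      by move/is_derive_conv; apply => // s; rewrite /pcoord /set_coord; case: (j == 0).
    apply: (@is_derive_conv _ _ _ (fun=> 2 * pcoord i p)); [|by rewrite mulr0].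
    move=> s; move: ij; rewrite /pcoord /set_coord.
    by case: i => [[|[|i]]] // ?; case: j => [[|[|j]]].
  have := is_deriveM dc (q2 _ j p sf1).
  by move/is_derive_conv; apply => //; rewrite /GRing.scale/=; ring.
- exists (fun i p => f1 i p + g1 i p), (fun i j p => f2 i j p + g2 i j p) => i j.
    have [? [? e]] := ef i j; have [? [? e']] := eg i j.
    by split; [exact: elem_add|split; [exact: elem_add|rewrite e e']].
  by move=> p; have [? ?] := df i j p; have [? ?] := dg i j p; split; exact: is_deriveD.
- exists (fun i p => f p * g1 i p + g p * f1 i p).
  exists (fun i j p => (f1 j p * g1 i p + f1 i p * g1 j p) + (f p * g2 i j p + g p * f2 i j p)).
    move=> i j; have [e1 [e2 e3]] := ef i j; have [d1 [d2 d3]] := eg i j.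
    have [e1' _] := ef j j; have [d1' _] := eg j j.
    split; first by apply: elem_add; exact: elem_mul.
    split; first by apply: elem_add; apply: elem_add; exact: elem_mul.
    by apply/funext => p; rewrite e3 d3; ring.
  move=> i j p; have [di dij] := df i j p; have [dgi dgij] := dg i j p.
  have [dj _] := df j j p; have [dgj _] := dg j j p.
  split; first exact: is_deriveM.
  have := is_deriveD (is_deriveM dj dgij) (is_deriveM dgj dij).
  by move/is_derive_conv; apply => //; rewrite /GRing.scale/=; ring.
Qed.

Lemma elem_smooth f : elem f -> smooth f.
Proof.
move=> ef js.
suff ejs : elem (iter_partial js f).
  split=> [|j p]; first exact: elem_continuous.
  by have [f1 [f2 _ d]] := elem_partial ejs; case: (d j j p).1.
elim: js => [//|j js IH] /=.
have [f1 [f2 e d]] := elem_partial IH.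
suff -> : partial j (iter_partial js f) = f1 j by case: (e j j).
by apply/funext => p; apply: partialE; exact: (d j j p).1.
Qed.

Lemma elem_partialC f i j : elem f -> partial i (partial j f) = partial j (partial i f).
Proof.
move=> /elem_partial[f1 [f2 e d]].
have E k : partial k f = f1 k.
  by apply/funext => p; apply: partialE; exact: (d k k p).1.
apply/funext => p; rewrite !E (partialE (d j i p).2) (partialE (d i j p).2).
by have [_ [_ ->]] := e i j.
Qed.

End plane_calculus.

(** * Lebesgue measure on the plane and square integrability *)

Section plane_measure.
Context {R : realType}.
Notation mu := (leb2 R).
Implicit Types (f g : R * R -> R) (p : R * R) (j : 'I_2).

(** The rational rectangles contained in an open set are countably many and cover it; this links the
    product topology to the product sigma-algebra. *)
Lemma open_measurable2 (A : set (R * R)) : open A -> measurable A.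
Proof.
move=> oA.
pose rect (q : rat * rat * (rat * rat)) : set (R * R) :=
  `]ratr q.1.1, ratr q.1.2[%classic `*` `]ratr q.2.1, ratr q.2.2[%classic.
have -> : A = \bigcup_(q in [set q | rect q `<=` A]) rect q.
  apply/seteqP; split=> [[x y] Axy|p [q qA /qA]//].
  have /nbhs_ballP[e /= e0 eA] := open_nbhs_nbhs (conj oA Axy).
  have [|a /itvP ax] := @rat_in_itvoo _ (x - e) x; first by rewrite ltrBlDr ltrDl.
  have [|b /itvP bx] := @rat_in_itvoo _ x (x + e); first by rewrite ltrDl.
  have [|c /itvP cy] := @rat_in_itvoo _ (y - e) y; first by rewrite ltrBlDr ltrDl.
  have [|d /itvP dy] := @rat_in_itvoo _ y (y + e); first by rewrite ltrDl.
  exists (a, b, (c, d)); last by split=> /=; rewrite in_itv/= ?ax ?bx ?cy ?dy.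
  move=> [s t] [/=]; rewrite !in_itv/= => /andP[as_ sb] /andP[ct td]; apply: eA.
  have h1 := ax; have h2 := bx.
  split; rewrite /ball/= ltr_norml; apply/andP; split.
  - by rewrite ltrBrDl ltrBlDr; apply: lt_le_trans sb _; rewrite ?bx.
  - by rewrite ltrBlDr -ltrBlDl; apply: lt_trans as_; rewrite ax.
  - by rewrite ltrBrDl ltrBlDr; apply: lt_le_trans td _; rewrite ?dy.
  - by rewrite ltrBlDr -ltrBlDl; apply: lt_trans ct; rewrite cy.
rewrite bigcup_mkcond; apply: countable_bigcupT_measurable.
  exact: countableP.
move=> q; case: ifPn => // _; apply: measurableX; exact: measurable_itv.
Qed.

Lemma continuous_measurable2 f : continuous f -> measurable_fun setT f.
Proof.
move=> /continuousP cf; apply: (measurability _ (@RGenOpens.measurableE R)).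
move=> _ [_ [a [b ->] <-]]; rewrite setTI; apply: open_measurable2.
exact/cf/interval_open.
Qed.

(** The majorant in all dominated limits. It is a product of integrable functions of one variable,
    hence integrable by Tonelli, and is at most 1, hence also in L^2. *)
Definition weight p : R := (1 + p.1 ^+ 2)^-1 * (1 + p.2 ^+ 2)^-1.

Let onesq_ge1 (x : R) : 1 <= 1 + x ^+ 2.
Proof. by rewrite lerDl sqr_ge0. Qed.

Lemma weight_gt0 p : 0 < weight p.
Proof. by rewrite /weight mulr_gt0// invr_gt0 (lt_le_trans ltr01). Qed.

Lemma weight_le1 p : weight p <= 1.
Proof. by rewrite /weight mulr_ile1// ?invr_ge0 ?invf_le1// (le_trans ler01, lt_le_trans ltr01). Qed.

Lemma weight_continuous : continuous weight.
Proof.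
have c (h : R * R -> R) : continuous h -> continuous (fun p => (1 + h p ^+ 2)^-1).
  move=> ch p; apply: cvgV; first by rewrite gt_eqF// (lt_le_trans ltr01).
  by apply: cvgD; [exact: cvg_cst|apply: cvgM; exact: ch].
move=> p; apply: cvgM; [apply: (c fst)|apply: (c snd)] => {}p;
  [exact: cvg_fst|exact: cvg_snd].
Qed.

Let integrable_onesqV :
  (@lebesgue_measure R).-integrable setT (fun x : R => ((1 + x ^+ 2)^-1)%:E).
Proof.
have cV : continuous (fun x : R => (1 + x ^+ 2)^-1) by exact: continuous_oneDsqrV.
have V0 (x : R) : 0 <= (1 + x ^+ 2)^-1 by rewrite invr_ge0 (le_trans ler01).
apply/integrableP; split.
  by apply/measurable_EFinP; exact: continuous_measurable_fun.
under eq_integral do rewrite gee0_abs ?lee_fin//.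
rewrite ge0_symfun_integralT//; last by move=> x /=; rewrite sqrrN.
by rewrite -set_itvcy integral0y_oneDsqr -EFinM ltry.
Qed.

Lemma integrable_weight : mu.-integrable setT (EFin \o weight).
Proof.
apply/integrable12ltyP.
  by apply/measurable_EFinP; apply: continuous_measurable2; exact: weight_continuous.
pose h (x : R) := (1 + x ^+ 2)^-1.
have h0 x : 0 <= h x by rewrite invr_ge0 (le_trans ler01).
pose r := \int[lebesgue_measure]_x (h x).
have rE : (\int[lebesgue_measure]_x (h x)%:E = r%:E)%E.
  by rewrite /r /Rintegral fineK//; apply: integrable_fin_num.
apply: (@le_lt_trans _ _ (\int[lebesgue_measure]_x ((h x)%:E * r%:E))%E); last first.
  by rewrite integralZr// rE -EFinM ltry.
rewrite le_eqVlt; apply/orP; left; apply/eqP; apply: eq_integral => x _.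
transitivity (\int[lebesgue_measure]_y ((h x)%:E * (h y)%:E))%E.
  apply: eq_integral => y _.
  by rewrite gee0_abs ?lee_fin ?(ltW (weight_gt0 _))// -EFinM.
by rewrite integralZl// rE.
Qed.

Lemma L2P f : L2 f <->
  measurable_fun setT f /\ mu.-integrable setT (EFin \o (fun p => f p ^+ 2)).
Proof.
rewrite /L2/=; split=> [fL|[mf fi]].
  split; first by move: fL; rewrite inE => /andP[/[!inE]].
  exact: Lfun2_integrable_sqr fL.
rewrite inE; apply/andP; split; rewrite inE//=.
rewrite /finite_norm unlock /= poweR_lty//.
move/integrableP : fi => [_]; apply: le_lt_trans.
rewrite le_eqVlt; apply/orP; left; apply/eqP; apply: eq_integral => p _ /=.
by rewrite powR_mulrn// normrX.
Qed.

Lemma L2_measurable f : L2 f -> measurable_fun setT f.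
Proof. by move=> /L2P[]. Qed.

Lemma L2_mul_integrable f g : L2 f -> L2 g ->
  mu.-integrable setT (EFin \o (fun p => f p * g p)).
Proof. by move=> Lf Lg; apply/Lfun1_integrable; exact: Lfun2_mul_Lfun1. Qed.

Lemma L2_le f g : measurable_fun setT f -> (forall p, `|f p| <= `|g p|) ->
  L2 g -> L2 f.
Proof.
move=> mf fg /L2P[mg ig]; apply/L2P; split=> //.
apply: le_integrable ig => //.
  by apply/measurable_EFinP; exact: measurable_funX.
by move=> p _ /=; rewrite lee_fin !normrX ler_sqr ?nnegrE ?normr_ge0.
Qed.

Lemma L2_weight (c : R) : L2 (fun p => c * weight p).
Proof.
apply/L2P; split.
  apply: measurable_funM => //.
  by apply: continuous_measurable2; exact: weight_continuous.
have iw : mu.-integrable setT (fun p => (c ^+ 2)%:E * (EFin \o weight) p)%E.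
  by apply: integrableZl => //; exact: integrable_weight.
apply: le_integrable iw => //.
- apply/measurable_EFinP; apply: measurable_funX; apply: measurable_funM => //.
  by apply: continuous_measurable2; exact: weight_continuous.
- move=> p _ /=; rewrite lee_fin exprMn !normrM ler_wpM2l//.
  rewrite -normrM -/(weight p) ger0_norm ?(ltW (weight_gt0 p))//.
  by rewrite ler_piMl ?weight_le1 ?(ltW (weight_gt0 p)).
Qed.

Lemma L2B f g : L2 f -> L2 g -> L2 (fun p => f p - g p).
Proof.
move=> Lf Lg; have Lfg := L2_mul_integrable Lf Lg.
move: Lf Lg => /L2P[mf fi] /L2P[mg gi]; apply/L2P; split.
  exact: measurable_funB.
pose F2 := EFin \o (fun p => f p ^+ 2); pose G2 := EFin \o (fun p => g p ^+ 2).
pose FG := EFin \o (fun p => f p * g p).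
rewrite (_ : EFin \o _ = (fun p => F2 p + G2 p - 2%:E * FG p)%E).
  apply: integrableB => //; first exact: integrableD.
  exact: integrableZl.
by apply/funext => p; rewrite /F2 /G2 /FG /=; congr EFin; ring.
Qed.

Definition decays f := measurable_fun setT f /\ exists c, forall p, `|f p| <= c * weight p.

Lemma decays_integrable f : decays f -> mu.-integrable setT (EFin \o f).
Proof.
move=> [mf [c fc]].
have iw : mu.-integrable setT (fun p => c%:E * (EFin \o weight) p)%E.
  by apply: integrableZl => //; exact: integrable_weight.
apply: le_integrable iw => //; first exact/measurable_EFinP.
by move=> p _ /=; rewrite lee_fin (le_trans (fc p))// ler_norm.
Qed.

Lemma decays_L2 f : decays f -> L2 f.
Proof.
move=> [mf [c fc]]; apply: L2_le (L2_weight c) => // p.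
by rewrite (le_trans (fc p))// ler_norm.
Qed.

(** The integrable majorant is [c * weight * g], a product of two L^2 functions. *)
Lemma dominated_mul_cvg (f_ : nat -> R * R -> R) f g c :
  (forall n, measurable_fun setT (f_ n)) -> measurable_fun setT f ->
  (forall p, f_ n p @[n --> \oo] --> f p) ->
  (forall n p, `|f_ n p| <= c * weight p) -> L2 g ->
  \int[mu]_p (f_ n p * g p) @[n --> \oo] --> \int[mu]_p (f p * g p).
Proof.
move=> mf_ mf fcv fb Lg; have mg := L2_measurable Lg.
have ig := L2_mul_integrable (L2_weight c) Lg.
pose G := EFin \o (fun p => c * weight p * g p).
have m1 n : measurable_fun setT (fun p => (f_ n p * g p)%:E).
  by apply/measurable_EFinP; exact: measurable_funM.
have m2 : measurable_fun setT (fun p => (f p * g p)%:E).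
  by apply/measurable_EFinP; exact: measurable_funM.
have a1 : {ae mu, forall p, setT p -> (f_ n p * g p)%:E @[n --> \oo] --> (f p * g p)%:E}.
  apply: aeW => p _; apply: cvg_EFin; first exact: nearW.
  by apply: cvgM; [exact: fcv|exact: cvg_cst].
have a2 : {ae mu, forall p n, setT p -> (`|(f_ n p * g p)%:E| <= `|G p|)%E}.
  apply: aeW => p n _ /=; rewrite lee_fin !normrM ler_wpM2r//.
  by rewrite -!normrM -/(weight p) (le_trans (fb n p))// ler_norm.
have [i1 i2 i3] := @dominated_convergence _ _ _ mu _ measurableT _ _ _ m1 m2 a1 (integrable_abse ig) a2.
apply: fine_cvg; rewrite fineK //.
exact: integrable_fin_num.
Qed.

End plane_measure.

(** * Test functions *)

Section test_functions.
Context {R : realType}.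
Notation mu := (leb2 R).
Implicit Types (f g phi psi : R * R -> R) (p : R * R) (j : 'I_2) (B : R).

(** This is the fundamental theorem of calculus on [-(B + 1), B + 1]. The extra 1 puts the endpoints
    strictly outside the support, as nothing is assumed at |x| = B. *)
Lemma integral_derive_compact0 (f g : R -> R) B : 0 < B ->
  (forall x : R, is_derive x 1 f (g x)) -> continuous g ->
  (forall x, B < `|x| -> f x = 0 /\ g x = 0) ->
  (\int[lebesgue_measure]_x (g x)%:E = 0)%E.
Proof.
move=> B0 fg cg fg0; pose b := B + 1.
have bb : - b < b by rewrite gtrN// /b ltr_wpDr.
have cf : continuous f.
  by move=> x; apply: differentiable_continuous; apply/derivable1_diffP; case: (fg x).
pose I : set R := `[(- b), b]%classic.
transitivity (\int[lebesgue_measure]_(x in I) (g x)%:E)%E.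
  rewrite [RHS]integral_mkcond; apply: eq_integral => x _.
  rewrite patchE; case: ifPn => // /negP xb.
  rewrite (fg0 x _).2//; rewrite ltNge; apply/negP => xB; apply: xb.
  by rewrite inE /I /= in_itv/= -ler_norml (le_trans xB)// /b lerDl.
rewrite (@continuous_FTC2 _ g f) //.
- have fb c : c = b \/ c = - b -> f c = 0.
    move=> cb; apply: (fg0 c _).1.
    have -> : `|c| = b by case: cb => ->; rewrite ?normrN ger0_norm// /b addr_ge0// ltW.
    by rewrite /b ltrDl.
  by rewrite !fb ?subee//; [right|left].
- exact: continuous_subspaceT.
- split; first by move=> x _; case: (fg x).
  + by apply: cvg_at_right_filter; exact: cf.
  + by apply: cvg_at_left_filter; exact: cf.
- by move=> x _; rewrite derive1E; case: (fg x).
Qed.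

Definition outside_box B : set (R * R) := [set p | B < `|p.1| \/ B < `|p.2|].

Lemma open_outside_box B : open (outside_box B).
Proof.
have -> : outside_box B = ((fun p => `|p.1|) @^-1` [set x | B < x]) `|`
                          ((fun p => `|p.2|) @^-1` [set x | B < x]).
  by [].
apply: openU; apply: open_comp; try exact: open_gt; move=> p _.
- by apply: cvg_norm; exact: cvg_fst.
- by apply: cvg_norm; exact: cvg_snd.
Qed.

Lemma compact_box B : compact (~` outside_box B).
Proof.
have -> : ~` outside_box B = `[(- B), B]%classic `*` `[(- B), B]%classic.
  apply/seteqP; split=> [p /= h|p /= [h1 h2] h].
    by split; rewrite /= in_itv/= -ler_norml leNgt; apply/negP => ?; apply: h; [left|right].
  move: h h1 h2; rewrite !in_itv/= -!ler_norml => -[] + h1 h2; rewrite ltNge.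
    by rewrite h1.
  by rewrite h2.
by apply: compact_setX; exact: segment_compact.
Qed.

(** The weight is bounded below on a box, so a bounded function supported there decays. *)
Lemma box_weight B p : ~ outside_box B p ->
  1 <= (1 + B ^+ 2) * (1 + B ^+ 2) * weight p.
Proof.
move=> pB; have sq (x : R) : `|x| <= B -> 1 + x ^+ 2 <= 1 + B ^+ 2.
  move=> xB; rewrite lerD2l -real_normK ?num_real// ler_sqr ?nnegrE//.
  by apply: le_trans xB.
have [p1 p2] : `|p.1| <= B /\ `|p.2| <= B.
  by split; rewrite leNgt; apply/negP => ?; apply: pB; [left|right].
have pos (x : R) : 0 < 1 + x ^+ 2 by rewrite ltr_pwDl// sqr_ge0.
by rewrite /weight mulrACA mulr_ege1// ler_pdivlMr ?mul1r ?sq.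
Qed.

Lemma continuous_decays f B : continuous f -> (forall p, outside_box B p -> f p = 0) ->
  decays f.
Proof.
move=> cf f0; split; first exact: continuous_measurable2.
have : compact (f @` (~` outside_box B)).
  by apply: continuous_compact; [exact: continuous_subspaceT|exact: compact_box].
move=> /compact_bounded[M [_ /(_ (M + 1))]]; rewrite ltrDl ltr01 => /(_ isT) MP.
pose b := (1 + B ^+ 2) * (1 + B ^+ 2).
exists ((`|M + 1|) * b) => p.
have [pB|pB] := pselect (outside_box B p).
  have b0 : 0 <= b by rewrite mulr_ge0// addr_ge0// sqr_ge0.
  have w0 := ltW (weight_gt0 p).
  rewrite f0// normr0; apply: mulr_ge0 => //; exact: mulr_ge0.
rewrite -mulrA; have h : `|f p| <= M + 1 by apply: MP; exists p.
by rewrite (le_trans h)// (le_trans (ler_norm _))// ler_peMr// box_weight.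
Qed.

(** Fubini with direction [j] as the inner integral reduces the claim to one variable. *)
Lemma integral_partial_compact0 f g j B : 0 < B ->
  (forall p, is_derive p (basis2 R j) f (g p)) -> continuous g ->
  (forall p, outside_box B p -> f p = 0 /\ g p = 0) ->
  \int[mu]_p g p = 0.
Proof.
move=> B0 fg cg fg0.
have ig : mu.-integrable setT (EFin \o g).
  by apply: decays_integrable; apply: (@continuous_decays _ B) => // p /fg0[].
have c1 (y : R) : continuous (fun x => g (x, y)).
  move=> x; apply: (continuous_comp (f := fun x => (x, y))); last exact: cg.
  exact: (cvg_pair (@cvg_id _ (nbhs x)) (cvg_cst y)).
have c2 (x : R) : continuous (fun y => g (x, y)).
  move=> y; apply: (continuous_comp (f := fun y => (x, y))); last exact: cg.
  exact: (cvg_pair (cvg_cst x) (@cvg_id _ (nbhs y))).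
rewrite /Rintegral; suff -> : (\int[mu]_p (EFin \o g) p = 0)%E by [].
have [j0|j0] := eqVneq j 0.
- rewrite -(integral21_prod_meas1 ig); apply: integral0_eq => y _.
  apply: (@integral_derive_compact0 (fun x => f (x, y)) _ B) => // [x|x xB].
    by have /is_derive_coord := fg (x, y); rewrite j0.
  by apply: fg0; left.
- rewrite -(integral12_prod_meas1 ig); apply: integral0_eq => x _.
  apply: (@integral_derive_compact0 (fun y => f (x, y)) _ B) => // [y|y yB].
    have /is_derive_coord := fg (x, y); rewrite /set_coord /pcoord (negbTE j0).
    by [].
  by apply: fg0; right.
Qed.

Lemma vanish_partial f j (U : set (R * R)) : open U -> (forall p, U p -> f p = 0) ->
  forall p, U p -> partial j f p = 0.
Proof.
move=> oU f0 p Up.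
have : is_derive p (basis2 R j) f 0.
  apply: (@near_eq_is_derive _ _ _ (fun _ : R * R => 0 : R)).
  by have := open_nbhs_nbhs (conj oU Up); apply: filterS => q /f0.
exact: partialE.
Qed.

Lemma test_functionP phi : test_function phi <->
  smooth phi /\ exists2 B, 0 < B & forall p, outside_box B p -> phi p = 0.
Proof.
split=> [[sphi cphi]|[sphi [B B0 phi0]]]; split=> //.
  have [M [_ /(_ (`|M| + 1))]] := compact_bounded cphi.
  rewrite (le_lt_trans (ler_norm _)) ?ltrDl// => /(_ isT) MP.
  exists (`|M| + 1); first by rewrite ltr_wpDl.
  move=> p pB; apply/eqP/negPn/negP => p0.
  have p0' : closure [set p | phi p != 0] p by exact: subset_closure.
  have := MP p p0'; rewrite /= prod_normE ge_max => /andP[h1 h2].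
  by case: pB; rewrite ltNge ?h1 ?h2.
apply: (subclosed_compact _ (@compact_box B)); first exact: closed_closure.
have cB : closed (~` outside_box B) by apply: open_closedC; exact: open_outside_box.
rewrite ((closure_id _).1 cB); apply: closureS.
by move=> p /= p0 /phi0 e; move: p0; rewrite e eqxx.
Qed.

Lemma smooth_partial phi j : smooth phi -> smooth (partial j phi).
Proof. by move=> sphi js; have := sphi (rcons js j); rewrite /iter_partial foldr_rcons. Qed.

Lemma test_function_partial phi j : test_function phi -> test_function (partial j phi).
Proof.
move=> /test_functionP[sphi [B B0 phi0]]; apply/test_functionP; split.
  exact: smooth_partial.
by exists B => //; apply: vanish_partial; [exact: open_outside_box|].
Qed.

Lemma test_function_decays phi : test_function phi -> decays phi.
Proof.
move=> /test_functionP[sphi [B B0 phi0]]; apply: continuous_decays phi0.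
exact: (sphi [::]).1.
Qed.

Lemma test_function_is_derive phi j p : test_function phi ->
  is_derive p (basis2 R j) phi (partial j phi p).
Proof. by move=> [sphi _]; split => //; exact: (sphi [::]).2. Qed.

Lemma test_function_ibp phi psi j : test_function phi -> test_function psi ->
  \int[mu]_p (phi p * partial j psi p) = - \int[mu]_p (partial j phi p * psi p).
Proof.
move=> tphi tpsi; have [sphi [B B0 phi0]] := (test_functionP phi).1 tphi.
have tphi' := test_function_partial j tphi; have tpsi' := test_function_partial j tpsi.
have L := fun f (h : test_function f) => decays_L2 (test_function_decays h).
have C := fun f (h : test_function f) => (h.1 [::]).1.
apply/eqP; rewrite -addr_eq0; apply/eqP.
rewrite -RintegralD//; [|exact: L2_mul_integrable (L _ _) (L _ _)..].
apply: (@integral_partial_compact0 (fun p => phi p * psi p) _ j B) => //.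
- move=> p; have := is_deriveM (test_function_is_derive j p tphi) (test_function_is_derive j p tpsi).
  by move/is_derive_conv; apply => //; rewrite /GRing.scale/= (mulrC (psi p)).
- by move=> p; apply: cvgD; apply: cvgM; exact: C.
- move=> p pB; rewrite phi0// (vanish_partial j (@open_outside_box B) phi0)// !mul0r addr0.
  by [].
Qed.

End test_functions.

(** * Fundamental lemma of the calculus of variations *)

Global Instance leb2_ae_filter {R : realType} : Filter (nbhs (almost_everywhere (leb2 R))).
Proof. exact: (@ae_filter_ringOfSetsType _ _ _ (@lebesgue_measure R \x @lebesgue_measure R)%E). Qed.

Section null_integrals.

(** The sets over whose preimage [f] integrates to 0 form a Dynkin system: complements use that the
    integral over all of [E] vanishes, disjoint unions use integrability. With a projection for [h]
    and a strip for [E], one side of a rectangle is made arbitrary at a time. *)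
Lemma integral0_preimage_dynkin d d' (X : measurableType d) (T : measurableType d')
    (R : realType) (mu : {measure set X -> \bar R}) (h : X -> T) (E : set X)
    (f : X -> \bar R) (G : set (set T)) :
  measurable_fun setT h -> measurable E -> mu.-integrable E f ->
  @measurable _ T = <<s G >> -> setI_closed G ->
  (\int[mu]_(x in E) f x = 0)%E ->
  (forall A, G A -> \int[mu]_(x in E `&` h @^-1` A) f x = 0)%E ->
  forall A, measurable A -> (\int[mu]_(x in E `&` h @^-1` A) f x = 0)%E.
Proof.
move=> mh mE intf GE GI fE fG A mA.
have mhA B : measurable B -> measurable (E `&` h @^-1` B).
  by move=> mB; apply: measurableI => //; rewrite -[h @^-1` B]setTI; exact: mh.
have iB B : measurable B -> mu.-integrable (E `&` h @^-1` B) f.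
  by move=> mB; apply: integrableS intf => //; exact: mhA.
have sA : <<s G >> A by rewrite -GE.
move: A sA {mA}.
apply: (dynkin_induction (P := fun A => (\int[mu]_(x in E `&` h @^-1` A) f x = 0)%E) GE GI).
- by rewrite preimage_setT setIT.
- exact: fG.
- move=> S mS fS; have mSC := measurableC mS.
  have : (\int[mu]_(x in (E `&` h @^-1` S) `|` (E `&` h @^-1` (~` S))) f x = 0)%E.
    by rewrite -setIUr -preimage_setU setUv preimage_setT setIT.
  rewrite integral_setU//.
  + by rewrite fS add0e.
  + exact: mhA.
  + exact: mhA.
  + apply: measurable_int.
    by rewrite -setIUr -preimage_setU setUv preimage_setT setIT; exact: intf.
  + by apply/disj_setPS => x [[_ ?] [_]].
- move=> F mF tF F0.
  have UE : E `&` h @^-1` (\bigcup_k F k) = \bigcup_k (E `&` h @^-1` F k).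
    by rewrite preimage_bigcup setI_bigcupr.
  rewrite UE integral_bigcup//.
  + by apply: eseries0 => i _ _; exact: F0.
  + move=> i j _ _ [x [[_ xi] [_ xj]]]; apply: tF => //; by exists (h x).
  + by move=> k; exact: mhA.
  + by rewrite -UE; apply: iB; exact: bigcup_measurable.
Qed.

End null_integrals.

Section rectangles.
Context {R : realType}.
Notation mu := (leb2 R).
Notation RT := (g_sigma_algebraType R.-ocitv.-measurable).
Implicit Types (v : R * R -> R) (A B : set RT).

Let mfst A : measurable A -> measurable ((@fst RT RT) @^-1` A).
Proof. by move=> mA; rewrite -[_ @^-1` _]setTI; exact: measurable_fst. Qed.

Let msnd A : measurable A -> measurable ((@snd RT RT) @^-1` A).
Proof. by move=> mA; rewrite -[_ @^-1` _]setTI; exact: measurable_snd. Qed.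

Let moc A : ocitv A -> measurable A.
Proof. by move=> oA; exact: sub_sigma_algebra. Qed.

(** The Dynkin argument is applied to the first side, to the second side, and then to all measurable
    sets, for which rectangles form a generating pi-system. As the whole line is not a bounded
    half-open interval, the vanishing total integrals come from the support in the rectangle of
    sides [A0] and [B0]. *)
Lemma integrable_rect_ae0 v A0 B0 : mu.-integrable setT (EFin \o v) ->
  ocitv A0 -> ocitv B0 -> (forall p, ~ (A0 `*` B0) p -> v p = 0) ->
  (forall A B, ocitv A -> ocitv B -> (\int[mu]_(p in A `*` B) (v p)%:E = 0)%E) ->
  {ae mu, forall p, v p = 0}.
Proof.
move=> iv oA0 oB0 v0 vr.
have XE A B : A `*` B = snd @^-1` B `&` fst @^-1` A by rewrite setIC.
have iE E : measurable E -> mu.-integrable E (EFin \o v).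
  by move=> mE; apply: integrableS iv.
have s1 A B : measurable A -> ocitv B -> (\int[mu]_(p in A `*` B) (v p)%:E = 0)%E.
  move=> mA oB; rewrite XE.
  apply: (@integral0_preimage_dynkin _ _ _ _ _ mu fst (snd @^-1` B) (EFin \o v) (@ocitv R)) => //.
  - exact: msnd (moc oB).
  - by apply: iE; exact: msnd (moc oB).
  - exact: ocitvI.
  - transitivity (\int[mu]_(x in A0 `*` B) (v x)%:E)%E; last exact: vr.
    rewrite XE [RHS]integral_mkcondr; apply: eq_integral => p _.
    rewrite patchE; case: ifPn => // /negP pA0; congr EFin; apply: v0 => -[pA _].
    by apply: pA0; rewrite inE.
  - by move=> A' oA'; rewrite -XE vr.
have s2 A B : measurable A -> measurable B -> (\int[mu]_(p in A `*` B) (v p)%:E = 0)%E.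
  move=> mA mB.
  apply: (@integral0_preimage_dynkin _ _ _ _ _ mu snd (fst @^-1` A) (EFin \o v) (@ocitv R)) => //.
  - exact: mfst.
  - by apply: iE; exact: mfst.
  - exact: ocitvI.
  - transitivity (\int[mu]_(x in A `*` B0) (v x)%:E)%E; last exact: s1.
    rewrite XE setIC [RHS]integral_mkcondr; apply: eq_integral => p _.
    rewrite patchE; case: ifPn => // /negP pB0; congr EFin; apply: v0 => -[_ pB].
    by apply: pB0; rewrite inE.
  - by move=> B' oB'; exact: s1.
have s3 E : measurable E -> (\int[mu]_(p in E) (v p)%:E = 0)%E.
  move=> mE; rewrite -[E]setTI.
  apply: (@integral0_preimage_dynkin _ _ _ _ _ mu id setT (EFin \o v)
    [set A `*` B | A in measurable & B in measurable]) => //.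
  - exact: measurable_prod_measurableType.
  - move=> _ _ [A1 mA1 [B1 mB1 <-]] [A2 mA2 [B2 mB2 <-]].
    exists (A1 `&` A2); first exact: measurableI.
    by exists (B1 `&` B2); [exact: measurableI|rewrite setXI].
  - by rewrite -setXTT; apply: s2.
  - by move=> _ [A mA [B mB <-]]; rewrite setTI; exact: s2.
have := @integral_ae_eq _ _ _ mu setT measurableT (cst 0%E) (EFin \o v) iv.
move=> /(_ (measurable_cst _)); rewrite /ae_eq => H.
have {H} : {ae mu, forall x, setT x -> (EFin \o v) x = cst 0%E x}.
  by apply: H => E _ mE; rewrite s3// integral0.
by apply: filterS => p /(_ I) [].
Qed.

Definition rect_indic (a b c d : R) (p : R * R) : R :=
  \1_(`]a, b]%classic : set R) p.1 * \1_(`]c, d]%classic : set R) p.2.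

Lemma L2_rect_ae0 v : L2 v ->
  (forall a b c d, a < b -> c < d -> \int[mu]_p (v p * rect_indic a b c d p) = 0) ->
  {ae mu, forall p, v p = 0}.
Proof.
move=> Lv vr.
pose I (n : nat) : set R := `]- n.+1%:R, n.+1%:R]%classic.
have oI n : ocitv (I n) by exists (- n.+1%:R, n.+1%:R).
(* An L^2 function may fail to be integrable on the plane, but its restrictions to bounded squares
   are integrable, and a countable union of null sets is null. *)
suff H n : {ae mu, forall p, (v \_ (I n `*` I n)) p = 0}.
  have : {ae mu, forall p n, (v \_ (I n `*` I n)) p = 0} by exact/ae_foralln.
  apply: filterS => p hp; have := hp (Num.truncn (`|p.1| + `|p.2|)).
  rewrite patchE ifT// inE /I; split; rewrite /= in_itv/=.
    have := truncnS_gt (`|p.1| + `|p.2|) => h.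
    have /ltr_normlP[h1 h2] : `|p.1| < (Num.truncn (`|p.1| + `|p.2|)).+1%:R.
      by apply: le_lt_trans h; rewrite lerDl.
    by rewrite (ltW h2) ltrNl h1.
  have := truncnS_gt (`|p.1| + `|p.2|) => h.
  have /ltr_normlP[h1 h2] : `|p.2| < (Num.truncn (`|p.1| + `|p.2|)).+1%:R.
    by apply: le_lt_trans h; rewrite lerDr.
  by rewrite (ltW h2) ltrNl h1.
have mS : measurable (I n `*` I n : set (RT * RT)).
  by apply: measurableX; exact: moc.
have iS (S : set (RT * RT)) : measurable S -> S `<=` I n `*` I n ->
    mu.-integrable setT (EFin \o (fun p => v p * \1_S p)).
  move=> mS' SI; apply: L2_mul_integrable => //; apply: decays_L2; split.
    exact: measurable_indic.
  pose b : R := (1 + n.+1%:R ^+ 2) * (1 + n.+1%:R ^+ 2); exists b => p.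
  rewrite ger0_norm// indicE; case: (boolP (p \in S)) => pS; last first.
    rewrite mulr_ge0//; last exact/ltW/weight_gt0.
    by rewrite mulr_ge0// addr_ge0// sqr_ge0.
  apply: box_weight => pb; move: pS; rewrite inE => /SI[/=].
  rewrite /I/= !in_itv/= => /andP[h1 h2] /andP[h3 h4].
  by case: pb; rewrite ltNge ler_norml ?h2 ?h4 ltW.
have restrE (S : set (RT * RT)) p : (v \_ S) p = v p * \1_S p.
  by rewrite patchE indicE; case: ifPn => _; rewrite ?mulr1 ?mulr0.
apply: (@integrable_rect_ae0 _ (I n) (I n)) => //.
- rewrite (_ : v \_ _ = (fun p => v p * \1_(I n `*` I n) p)); first exact: iS.
  by apply/funext => p.
- by move=> p pI; rewrite patchE ifF//; apply/negP; rewrite inE.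
move=> A B oA oB; rewrite integral_mkcond.
have [oAI oBI] := (ocitvI oA (oI n), ocitvI oB (oI n)).
have E p : (((fun p => ((v \_ (I n `*` I n)) p)%:E) \_ (A `*` B)) p =
    (v p * \1_((A `&` I n) `*` (B `&` I n)) p)%:E)%E.
  rewrite patchE restrE !indicE !in_setX !in_setI.
  by do ![case: (_ \in _)]; rewrite /= ?mulr0.
under eq_integral do rewrite E.
have [A0|[[a b] /= ab AE]] := (ocitvP _).1 oAI.
  by rewrite A0 set0X; apply: integral0_eq => p _; rewrite indic0 mulr0.
have [B0|[[c d] /= cd BE]] := (ocitvP _).1 oBI.
  by rewrite B0 setX0; apply: integral0_eq => p _; rewrite indic0 mulr0.
have i1 : mu.-integrable setT (EFin \o (fun p => v p * \1_((A `&` I n) `*` (B `&` I n)) p)).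
  apply: iS; first by apply: measurableX; exact: moc.
  by move=> p [[_ ?] [_ ?]].
rewrite -[LHS]fineK; last exact: (integrable_fin_num measurableT i1).
congr EFin; rewrite -[RHS](vr a b c d ab cd); apply: eq_Rintegral => p _.
by rewrite AE BE /rect_indic !indicE in_setX -natrM mulnb.
Qed.

End rectangles.

(** * Smooth approximations of steps, ramps and cutoffs *)

Section cutoffs.
Context {R : realType}.
Implicit Types (a b x : R) (n : nat).

Lemma smooth1_subr a : smooth1 (fun x => x - a).
Proof. exact: (smooth_onB openT (smooth_on_id openT) (smooth_on_cst openT a)). Qed.

Lemma smooth1_subl a : smooth1 (fun x => a - x).
Proof. exact: (smooth_onB openT (smooth_on_cst openT a) (smooth_on_id openT)). Qed.

Lemma smooth1_addl a : smooth1 (fun x => a + x).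
Proof. exact: (smooth_onD openT (smooth_on_cst openT a) (smooth_on_id openT)). Qed.

(** Smooth version of the indicator of ]a, +oo[ with its transition in [a, a + 1/(n+1)]; as it is 0
    at [a] itself, it converges to this indicator at every point. *)
Definition step_at n a x : R := smooth_step (n.+1%:R * (x - a)).

Lemma step_at_smooth n a : smooth1 (step_at n a).
Proof.
apply: (smooth_on_comp openT openT (f := smooth_step)) => //; first exact: smooth_step_smooth.
apply: smooth_onZ; first exact: openT.
exact: smooth1_subr.
Qed.

Lemma step_at0 n a x : x <= a -> step_at n a x = 0.
Proof. by move=> xa; rewrite /step_at smooth_step0// mulr_ge0_le0// subr_le0. Qed.

Lemma step_at1 n a x : a + n.+1%:R^-1 <= x -> step_at n a x = 1.
Proof.
by move=> xa; rewrite /step_at smooth_step1// -ler_pdivrMl// mulr1 lerBrDl.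
Qed.

Lemma step_at_ge0 n a x : 0 <= step_at n a x.
Proof. exact: smooth_step_ge0. Qed.

Lemma step_at_le1 n a x : step_at n a x <= 1.
Proof. exact: smooth_step_le1. Qed.

Lemma is_derive_step_at n a x :
  is_derive x 1 (step_at n a) (n.+1%:R * derive1 smooth_step (n.+1%:R * (x - a))).
Proof.
have d1 : is_derive x 1 (fun x => n.+1%:R * (x - a)) n.+1%:R.
  have := is_deriveZ n.+1%:R (is_deriveB (is_derive_id x (1 : R)) (is_derive_cst a x (1 : R))).
  by move/is_derive_conv; apply => //; rewrite subr0 /GRing.scale/= mulr1.
have := @is_derive1_comp _ smooth_step _ x _ _
  (smooth_on_is_derive (x := n.+1%:R * (x - a)) smooth_step_smooth I) d1.
by move/is_derive_conv; apply => //; rewrite mulrC.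
Qed.

Lemma near_step_at a x : a < x -> \forall n \near \oo, a + n.+1%:R^-1 < x.
Proof.
move=> ax; have xa0 : 0 < x - a by rewrite subr_gt0.
near=> n; rewrite -ltrBrDl.
near: n; exact: (near_infty_natSinv_lt (PosNum xa0)).
Unshelve. all: by end_near. Qed.

Lemma step_at_cvg a x : step_at n a x @[n --> \oo] --> ((a < x)%R%:R : R).
Proof.
have [xa|ax] := leP x a.
  by apply: cvg_near_cst; near=> n; rewrite step_at0.
by apply: cvg_near_cst; near=> n; rewrite step_at1// ltW//; near: n; exact: near_step_at.
Unshelve. all: by end_near. Qed.

(** Smooth version of max(0, x - a). Unlike that of [step_at], its derivative is bounded uniformly
    in [n], as dominated convergence requires. *)
Definition ramp_at n a x : R := (x - a) * step_at n a x.

Lemma ramp_at_smooth n a : smooth1 (ramp_at n a).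
Proof.
apply: (smooth_onM openT _ (step_at_smooth n a)).
exact: smooth1_subr.
Qed.

Definition dramp_at n a x : R :=
  step_at n a x + (x - a) * (n.+1%:R * derive1 smooth_step (n.+1%:R * (x - a))).

Lemma is_derive_ramp_at n a x : is_derive x 1 (ramp_at n a) (dramp_at n a x).
Proof.
have := is_deriveM (is_deriveB (is_derive_id x (1 : R)) (is_derive_cst a x (1 : R)))
  (is_derive_step_at n a x).
move/is_derive_conv; apply => //; rewrite /GRing.scale/= subr0 mulr1 addrC.
by congr (_ + _).
Qed.

Lemma dramp_atE n a : derive1 (ramp_at n a) = dramp_at n a.
Proof. by apply/funext => x; rewrite derive1E; case: (is_derive_ramp_at n a x). Qed.

Lemma dramp_at_continuous n a : continuous (dramp_at n a).
Proof.
by rewrite -dramp_atE; apply: smooth1_continuous; apply: smooth_on_derive; exact: ramp_at_smooth.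
Qed.

Lemma derive_step_at0 n a x : (x <= a) || (a + n.+1%:R^-1 <= x) ->
  derive1 smooth_step (n.+1%:R * (x - a)) = 0.
Proof.
move=> /orP[xa|xa]; rewrite smooth_step_derive0//; apply/orP; [left|right].
  by rewrite mulr_ge0_le0// subr_le0.
by rewrite -ler_pdivrMl// mulr1 lerBrDl.
Qed.

(** The derivative of the step is of order n, but only on an interval of length 1/(n+1). A factor of
    order 1/(n+1) there, such as a Lipschitz function vanishing at one end, compensates it. *)
Lemma norm_transition : exists2 c, 0 <= c &
  forall n a x (d l : R), 0 <= l -> (a < x -> x < a + n.+1%:R^-1 -> `|d| <= l / n.+1%:R) ->
   `|(n.+1%:R * derive1 smooth_step (n.+1%:R * (x - a))) * d| <= c * l.
Proof.
have [c c0 cP] := @smooth_step_derive_bounded R; exists c => // n a x d l l0 dl.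
have [h|] := boolP ((x <= a) || (a + n.+1%:R^-1 <= x)).
  by rewrite derive_step_at0// mulr0 mul0r normr0 mulr_ge0.
rewrite negb_or -!ltNge => /andP[ax xa].
rewrite (mulrC n.+1%:R) -mulrA normrM ler_pM//.
by rewrite normrM ger0_norm// -ler_pdivlMl// mulrC dl.
Qed.

Lemma dramp_at_cvg a x : dramp_at n a x @[n --> \oo] --> ((a < x)%R%:R : R).
Proof.
rewrite -[X in _ --> X]addr0; apply: cvgD; first exact: step_at_cvg.
apply: cvg_near_cst; have [xa|ax] := leP x a.
  by near=> n; rewrite derive_step_at0 ?xa ?mulr0.
near=> n; rewrite derive_step_at0 ?mulr0//; apply/orP; right; rewrite ltW//.
by near: n; exact: near_step_at.
Unshelve. all: by end_near. Qed.

Lemma dramp_at_bounded : exists2 c : R, 0 <= c & forall n a x, `|dramp_at n a x| <= c.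
Proof.
have [c c0 cP] := norm_transition.
exists (1 + c); first by rewrite addr_ge0.
move=> n a x; rewrite (le_trans (ler_normD _ _))// lerD//.
  by rewrite ger0_norm ?step_at_ge0 ?step_at_le1.
rewrite mulrC -[leRHS]mulr1 cP// => ax xa.
by rewrite mul1r ger0_norm ?subr_ge0 1?ltW// ltrBlDl.
Qed.

Definition cutoff (B x : R) : R := smooth_step (B + 1 - x) * smooth_step (B + 1 + x).

Lemma cutoff_smooth B : smooth1 (cutoff B).
Proof.
apply: smooth_onM; first exact: openT.
  apply: (smooth_on_comp openT openT (f := smooth_step)) => //; first exact: smooth_step_smooth.
  exact: smooth1_subl.
apply: (smooth_on_comp openT openT (f := smooth_step)) => //; first exact: smooth_step_smooth.
exact: smooth1_addl.
Qed.

Lemma cutoff0 B x : B + 1 <= `|x| -> cutoff B x = 0.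
Proof.
rewrite /cutoff ler_normr => /orP[h|h].
  by rewrite smooth_step0 ?mul0r// subr_le0.
by rewrite (smooth_step0 (x := B + 1 + x)) ?mulr0// -lerBrDr sub0r.
Qed.

Lemma cutoff1 B x : `|x| <= B -> cutoff B x = 1.
Proof.
move=> /ler_normlP[h1 h2]; rewrite /cutoff !smooth_step1 ?mulr1//; lra.
Qed.

Lemma derive_cutoff B x : derive1 (cutoff B) x =
  smooth_step (B + 1 - x) * derive1 smooth_step (B + 1 + x) -
  smooth_step (B + 1 + x) * derive1 smooth_step (B + 1 - x).
Proof.
have d1 : is_derive x 1 (fun x => B + 1 - x) (-1).
  have := is_deriveB (is_derive_cst (B + 1) x (1 : R)) (is_derive_id x (1 : R)).
  by move/is_derive_conv; apply => //; rewrite sub0r.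
have d2 : is_derive x 1 (fun x => B + 1 + x) 1.
  have := is_deriveD (is_derive_cst (B + 1) x (1 : R)) (is_derive_id x (1 : R)).
  by move/is_derive_conv; apply => //; rewrite add0r.
have s1 := @is_derive1_comp _ smooth_step _ x _ _
  (smooth_on_is_derive (x := B + 1 - x) smooth_step_smooth I) d1.
have s2 := @is_derive1_comp _ smooth_step _ x _ _
  (smooth_on_is_derive (x := B + 1 + x) smooth_step_smooth I) d2.
rewrite derive1E; have [_ ->] := is_deriveM s1 s2.
by rewrite /GRing.scale/= mulr1 mulrN1 mulrN.
Qed.

Lemma derive_cutoff0 B x : `|x| <= B -> derive1 (cutoff B) x = 0.
Proof.
move=> /ler_normlP[h1 h2].
rewrite derive_cutoff !smooth_step_derive0 ?mulr0 ?subr0//.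
  by apply/orP; right; lra.
by apply/orP; right; lra.
Qed.

Lemma derive_cutoff_bounded : exists2 c : R, 0 <= c & forall B x, `|derive1 (cutoff B) x| <= c.
Proof.
have [c c0 cP] := @smooth_step_derive_bounded R.
exists (c + c); first exact: addr_ge0.
move=> B x; rewrite derive_cutoff (le_trans (ler_normB _ _))//.
have H y z : `|smooth_step y * derive1 smooth_step z| <= c.
  rewrite normrM ger0_norm ?smooth_step_ge0// -[leRHS]mul1r ler_pM ?smooth_step_ge0//.
  exact: smooth_step_le1.
by rewrite lerD.
Qed.

Lemma cutoff_norm B x : `|cutoff B x| <= 1.
Proof.
rewrite /cutoff ger0_norm; last by apply: mulr_ge0; exact: smooth_step_ge0.
by rewrite mulr_ile1 ?smooth_step_ge0 ?smooth_step_le1.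
Qed.

End cutoffs.

(** * Functions determined by their integrals against test functions *)

Section uniqueness.
Context {R : realType}.
Notation mu := (leb2 R).
Implicit Types (v w : R * R -> R) (a b c d B : R).

Lemma Rintegral_ae_eq (f g : R * R -> R) : measurable_fun setT f -> measurable_fun setT g ->
  {ae mu, forall p, f p = g p} -> \int[mu]_p f p = \int[mu]_p g p.
Proof.
move=> mf mg fg; rewrite /Rintegral; congr fine; apply: ae_eq_integral => //.
- exact/measurable_EFinP.
- exact/measurable_EFinP.
- by apply: filterS fg => p -> _.
Qed.

Let oc_indicE a b x : a < b -> \1_(`]a, b]%classic : set R) x = (a < x)%R%:R - (b < x)%R%:R :> R.
Proof.
move=> ab; rewrite indicE; have [xa|ax] := leP x a.
  rewrite memNset; last by rewrite /= in_itv/= ltNge xa.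
  by rewrite ltNge (le_trans xa (ltW ab)) subrr.
have [xb|bx] := leP x b.
  by rewrite mem_set ?subr0//= in_itv/= ax xb.
by rewrite memNset ?subrr//= in_itv/= ax /= leNgt bx.
Qed.

(** The final 1 leaves room for the transitions of [step_at], whose length is at most 1. *)
Definition box_bound a b c d : R := `|a| + `|b| + `|c| + `|d| + 1.

Let nV_le1 n : n.+1%:R^-1 <= 1 :> R.
Proof. by rewrite invf_le1// ler1n. Qed.

Let bump0 n a b x : `|a| + `|b| + 1 < `|x| -> step_at n a x - step_at n b x = 0.
Proof.
rewrite lter_normr => /orP[h|h].
  rewrite !step_at1 ?subrr//.
    have := nV_le1 n; move: (_^-1) => e e1.
    by have := ler_norm b; have := normr_ge0 a; lra.
  have := nV_le1 n; move: (_^-1) => e e1.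
  by have := ler_norm a; have := normr_ge0 b; lra.
rewrite !step_at0 ?subrr//.
  by have := ler_norm (- b); rewrite normrN; have := normr_ge0 a; lra.
by have := ler_norm (- a); rewrite normrN; have := normr_ge0 b; lra.
Qed.

Let bump_norm n a b x : `|step_at n a x - step_at n b x| <= 1.
Proof.
rewrite ler_norml; have := step_at_ge0 n a x; have := step_at_le1 n a x.
by have := step_at_ge0 n b x; have := step_at_le1 n b x; lra.
Qed.

Let bump_smooth n a b : smooth1 (fun x => step_at n a x - step_at n b x).
Proof. exact: (smooth_onB openT (step_at_smooth n a) (step_at_smooth n b)). Qed.

Lemma elem_test_function (phi : R * R -> R) B : 0 < B -> elem phi ->
  (forall p, outside_box B p -> phi p = 0) -> test_function phi.
Proof.
by move=> B0 ephi phi0; apply/test_functionP; split; [exact: elem_smooth|exists B].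
Qed.

Lemma elem_prod (f g : R -> R) : smooth1 f -> smooth1 g -> elem (fun p => f p.1 * g p.2).
Proof. by move=> sf sg; exact: (elem_mul (elem_coord 0 sf) (elem_coord 1 sg)). Qed.

Lemma measurable_rect_indic a b c d : measurable_fun setT (rect_indic a b c d).
Proof.
apply: measurable_funM.
  apply: (@measurableT_comp _ _ _ _ _ _ (\1_(`]a, b]%classic : set R) : R -> R) _ (@fst R R)).
    exact: measurable_indic.
  exact: measurable_fst.
apply: (@measurableT_comp _ _ _ _ _ _ (\1_(`]c, d]%classic : set R) : R -> R) _ (@snd R R)).
  exact: measurable_indic.
exact: measurable_snd.
Qed.

(** Products of differences of steps are test functions supported in a common box, and they converge
    everywhere to the indicator of a half-open rectangle. *)
Lemma L2_test_ae0 v : L2 v ->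
  (forall phi, test_function phi -> \int[mu]_p (v p * phi p) = 0) ->
  {ae mu, forall p, v p = 0}.
Proof.
move=> Lv v0; apply: L2_rect_ae0 => // a b c d ab cd.
pose f n p : R := (step_at n a p.1 - step_at n b p.1) * (step_at n c p.2 - step_at n d p.2).
pose B := box_bound a b c d.
have B0 : 0 < B by rewrite /B /box_bound !ltr_wpDl// ?addr_ge0.
have fB n p : outside_box B p -> f n p = 0.
  rewrite /f => -[h|h]; [rewrite (bump0 n (a := a) (b := b)) ?mul0r//|rewrite (bump0 n (a := c) (b := d)) ?mulr0//];
    apply: le_lt_trans h; rewrite /B /box_bound;
    have := normr_ge0 a; have := normr_ge0 b; have := normr_ge0 c; have := normr_ge0 d; lra.
have ef n : elem (f n) by exact: (elem_prod (bump_smooth n a b) (bump_smooth n c d)).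
have tf n : test_function (f n) by exact: elem_test_function B0 (ef n) (fB n).
pose K := (1 + B ^+ 2) * (1 + B ^+ 2).
have fK n p : `|f n p| <= K * weight p.
  have [pB|pB] := pselect (outside_box B p).
    by rewrite fB// normr0 mulr_ge0 ?(ltW (weight_gt0 p))// mulr_ge0// addr_ge0// sqr_ge0.
  by apply: le_trans (box_weight pB); rewrite normrM mulr_ile1.
have mr := measurable_rect_indic a b c d.
have := @dominated_mul_cvg _ f (rect_indic a b c d) v K
  (fun n => (test_function_decays (tf n)).1) mr _ fK Lv.
have E n : \int[mu]_p (f n p * v p) = 0.
  by rewrite -[RHS](v0 _ (tf n)); apply: eq_Rintegral => p _; rewrite mulrC.
under eq_fun do rewrite E.
move=> H; rewrite -[LHS](_ : \int[mu]_p (rect_indic a b c d p * v p) = _); last first.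
  by apply: eq_Rintegral => p _; rewrite mulrC.
have {}H : 0 @[_ --> \oo] --> \int[mu]_p (rect_indic a b c d p * v p).
  apply: H => p; rewrite /rect_indic !oc_indicE//.
  by apply: cvgM; apply: cvgB; exact: step_at_cvg.
by rewrite -(cvg_lim (@Rhausdorff R) H) lim_cst.
Qed.

(** As far as [w] can see, the smoothed indicator of a rectangle is the x-derivative of a test
    function: its primitive in x is constant to the right of the rectangle, and it is cut off only
    where [w] vanishes. *)
Lemma L2_partial0_ae0 w B : L2 w -> 0 < B ->
  {ae mu, forall p, outside_box B p -> w p = 0} ->
  (forall phi, test_function phi -> \int[mu]_p (w p * partial 0 phi p) = 0) ->
  {ae mu, forall p, w p = 0}.
Proof.
move=> Lw B0 wB w0; apply: L2_rect_ae0 => // a b c d ab cd.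
have [kk kk0 kkP] := @dramp_at_bounded R.
pose th n x : R := (ramp_at n a x - ramp_at n b x) * cutoff B x.
pose dth n x : R := dramp_at n a x - dramp_at n b x.
pose g n y : R := step_at n c y - step_at n d y.
pose phi n (p : R * R) : R := th n p.1 * g n p.2.
pose S : set (R * R) := ~` outside_box B.
(* In the box the cutoff is 1 with zero derivative, so [f n] is the partial derivative of [phi n]
   there; setting it to 0 outside provides a majorant and costs nothing, as [w] vanishes there. *)
pose f n (p : R * R) : R := dth n p.1 * g n p.2 * \1_S p.
have mS : measurable S by apply: measurableC; apply: open_measurable2; exact: open_outside_box.
have sth n : smooth1 (th n).
  apply: (smooth_onM openT _ (cutoff_smooth B)).
  exact: (smooth_onB openT (ramp_at_smooth n a) (ramp_at_smooth n b)).
have ephi n : elem (phi n) by exact: (elem_prod (sth n) (bump_smooth n c d)).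
have tphi n : test_function (phi n).
  pose B' := B + 1 + box_bound a b c d.
  have bb0 : 0 < box_bound a b c d by rewrite /box_bound !ltr_wpDl// ?addr_ge0.
  have B'0 : 0 < B' by rewrite /B' addr_gt0// addr_gt0.
  apply: (elem_test_function B'0 (ephi n)) => p; rewrite /phi /th /g => -[h|h].
    rewrite cutoff0 ?mulr0 ?mul0r// ltW//; apply: le_lt_trans h.
    by rewrite /B' lerDl ltW.
  rewrite (bump0 n (a := c) (b := d)) ?mulr0//; apply: le_lt_trans h; rewrite /B' /box_bound.
  have := normr_ge0 a; have := normr_ge0 b; have := normr_ge0 c; have := normr_ge0 d; lra.
have dphi n p : S p -> partial 0 (phi n) p = dth n p.1 * g n p.2.
  move=> Sp; apply: partialE; apply/is_derive_coord.
  have p1B : `|p.1| <= B by rewrite leNgt; apply/negP => h; apply: Sp; left.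
  have dc := smooth_on_is_derive (x := p.1) (cutoff_smooth B) I.
  have := is_deriveM (is_deriveM (is_deriveB (is_derive_ramp_at n a p.1) (is_derive_ramp_at n b p.1)) dc)
    (is_derive_cst (g n p.2) p.1 (1 : R)).
  move/is_derive_conv; apply => //.
  by rewrite /GRing.scale/= derive_cutoff0// cutoff1// !mulr0 !add0r mul1r mulrC.
pose K := (kk + kk) * ((1 + B ^+ 2) * (1 + B ^+ 2)).
have fK n p : `|f n p| <= K * weight p.
  rewrite /f /K; have [pS|pS] := pselect (S p); last first.
    rewrite indicE memNset// mulr0 normr0 mulr_ge0 ?(ltW (weight_gt0 p))//.
    by rewrite mulr_ge0 ?addr_ge0// mulr_ge0// addr_ge0// sqr_ge0.
  rewrite indicE mem_set// mulr1 normrM -mulrA ler_pM//.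
    by rewrite (le_trans (ler_normB _ _))// lerD.
  by apply: le_trans (box_weight pS); exact: bump_norm.
have cf n : continuous (fun p : R * R => dth n p.1 * g n p.2).
  have cdt : continuous (dth n) by move=> x; apply: cvgB; exact: dramp_at_continuous.
  move=> p; apply: cvgM.
    by apply: (continuous_comp (f := fst)); [exact: cvg_fst|exact: cdt].
  have cg : continuous (g n) by apply: smooth1_continuous; exact: bump_smooth.
  by apply: (continuous_comp (f := snd)); [exact: cvg_snd|exact: cg].
have mf n : measurable_fun setT (f n).
  by apply: measurable_funM; [exact: continuous_measurable2|exact: measurable_indic].
have mr := measurable_rect_indic a b c d.
have mrS : measurable_fun setT (fun p => rect_indic a b c d p * \1_S p).
  by apply: measurable_funM => //; exact: measurable_indic.
have := @dominated_mul_cvg _ f (fun p => rect_indic a b c d p * \1_S p) w K mf mrS _ fK Lw.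
have mw := L2_measurable Lw.
have E n : \int[mu]_p (f n p * w p) = 0.
  rewrite -[RHS](w0 _ (tphi n)); apply: Rintegral_ae_eq.
  - exact: measurable_funM.
  - apply: measurable_funM => //.
    exact: (test_function_decays (test_function_partial 0 (tphi n))).1.
  - apply: filterS wB => p wp; have [pS|pS] := pselect (S p).
      by rewrite dphi// /f indicE mem_set// mulr1 mulrC.
    by rewrite wp ?mulr0 ?mul0r//; apply: contrapT.
under eq_fun do rewrite E.
move=> H; transitivity (\int[mu]_p (rect_indic a b c d p * \1_S p * w p)).
  apply: Rintegral_ae_eq; [exact: measurable_funM|exact: measurable_funM|].
  apply: filterS wB => p wp; have [pS|pS] := pselect (S p).
    by rewrite indicE mem_set// mulr1 mulrC.
  by rewrite wp ?mulr0 ?mul0r//; apply: contrapT.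
have {}H : 0 @[_ --> \oo] --> \int[mu]_p (rect_indic a b c d p * \1_S p * w p).
  apply: H => p; rewrite /rect_indic !oc_indicE//; apply: cvgM; last exact: cvg_cst.
  by apply: cvgM; apply: cvgB; (exact: dramp_at_cvg || exact: step_at_cvg).
by rewrite -(cvg_lim (@Rhausdorff R) H) lim_cst.
Qed.

End uniqueness.

(** * Weak gradients *)

Section weak_gradients.
Context {R : realType}.
Notation mu := (leb2 R).
Implicit Types (f g u : R * R -> R) (j : 'I_2).

Lemma weak_partial_unique j f g g' : is_weak_partial j f g -> is_weak_partial j f g' ->
  {ae mu, forall p, g p = g' p}.
Proof.
move=> [Lg gP] [Lg' gP'].
have : {ae mu, forall p, g p - g' p = 0}.
  apply: L2_test_ae0; first exact: L2B.
  move=> phi tphi; have Lphi := decays_L2 (test_function_decays tphi).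
  under eq_Rintegral do rewrite mulrBl.
  rewrite RintegralB//; [|exact: L2_mul_integrable..].
  by apply/eqP; rewrite subr_eq0 -eqr_opp -gP// -gP'.
by apply: filterS => p /eqP; rewrite subr_eq0 => /eqP.
Qed.

Lemma weak_partialP j f : H1 f -> is_weak_partial j f (weak_partial j f).
Proof. by move=> [_ /(_ j) ex]; apply: (@xgetPex _ (cst 0) _ ex). Qed.

Lemma weak_partial_ae_eq j f g : is_weak_partial j f g ->
  {ae mu, forall p, weak_partial j f p = g p}.
Proof.
move=> fg; apply: weak_partial_unique (fg).
by apply: (@xgetPex _ (cst 0)); exists g.
Qed.

Definition weak_gradient u (g : 'I_2 -> R * R -> R) : Prop :=
  L2 u /\ forall j, is_weak_partial j u (g j).

Lemma weak_gradient_weak_partial u : H1 u -> weak_gradient u (fun j => weak_partial j u).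
Proof. by move=> Hu; split; [case: Hu|move=> j; exact: weak_partialP]. Qed.

Lemma test_weak_gradient phi : test_function phi -> weak_gradient phi (fun j => partial j phi).
Proof.
move=> tphi; split; first exact: decays_L2 (test_function_decays tphi).
move=> j; split; first exact: decays_L2 (test_function_decays (test_function_partial j tphi)).
by move=> psi tpsi; exact: test_function_ibp.
Qed.

(* The two integration by parts formulas for an explicit field against an
   arbitrary element of H^1; they pass to dominated limits, which replaces the
   density of smooth functions in H^1. *)
Definition ibp_field (F : R * R -> R) (F' : 'I_2 -> R * R -> R) : Prop :=
  [/\ decays F, forall j, decays (F' j) &
  forall u (g : 'I_2 -> R * R -> R), weak_gradient u g ->
    (forall j, \int[mu]_p (F' j p * u p) = - \int[mu]_p (F p * g j p)) /\
    (forall i j, \int[mu]_p (F' i p * g j p) = \int[mu]_p (F' j p * g i p))].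

(** The two sides of the second identity are, up to the same sign, the pairing of [u] with one mixed
    second partial of [phi]. *)
Lemma ibp_field_elem phi : elem phi -> test_function phi ->
  ibp_field phi (fun j => partial j phi).
Proof.
move=> ephi tphi; split; first exact: test_function_decays.
  by move=> j; apply: test_function_decays; exact: test_function_partial.
have E g h : \int[mu]_p (g p * h p) = \int[mu]_p (h p * g p).
  by apply: eq_Rintegral => p _; rewrite mulrC.
move=> u g [Lu ug]; split=> [j|i j].
  by rewrite E (E phi) (ug j).2.
rewrite E [RHS]E.
have ti := test_function_partial i tphi; have tj := test_function_partial j tphi.
have e1 := (ug j).2 _ ti; have e2 := (ug i).2 _ tj.
move: e1; rewrite -(elem_partialC i j ephi) e2 => /eqP.
by rewrite eqr_opp => /eqP ->.
Qed.

Lemma ibp_field_is_weak_partial F F' j : ibp_field F F' -> is_weak_partial j F (F' j).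
Proof.
move=> [dF dF' FP]; split; first exact: decays_L2.
move=> phi tphi; have [/(_ j) -> _] := FP _ _ (test_weak_gradient tphi).
by rewrite opprK.
Qed.

Lemma ibp_field_lim (F_ : nat -> R * R -> R) (F_' : nat -> 'I_2 -> R * R -> R) F F' c :
  (forall n, ibp_field (F_ n) (F_' n)) ->
  (forall n p, `|F_ n p| <= c * weight p) ->
  (forall n j p, `|F_' n j p| <= c * weight p) ->
  (forall p, F_ n p @[n --> \oo] --> F p) ->
  (forall j p, F_' n j p @[n --> \oo] --> F' j p) -> ibp_field F F'.
Proof.
move=> gn bF bF' cF cF'.
have mF_ n : measurable_fun setT (F_ n) by case: (gn n) => -[].
have mF_' n j : measurable_fun setT (F_' n j) by case: (gn n) => _ /(_ j)[].
have mF : measurable_fun setT F.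
  by apply: (@measurable_fun_cvg _ _ _ _ F_) => // p _; exact: cF.
have mF' j : measurable_fun setT (F' j).
  by apply: (@measurable_fun_cvg _ _ _ _ (fun n => F_' n j)) => // p _; exact: cF'.
have lim_le (f_ : nat -> R) (l k : R) : (forall n, `|f_ n| <= k) -> f_ n @[n --> \oo] --> l -> `|l| <= k.
  move=> fk fl; have nl : `|f_ n| @[n --> \oo] --> `|l| by exact: cvg_norm.
  rewrite -(cvg_lim (@Rhausdorff R) nl); apply: limr_le.
    by apply/cvg_ex; exists `|l|.
  exact: nearW.
split.
- by split => //; exists c => p; exact: lim_le (fun n => bF n p) (cF p).
- by move=> j; split => //; exists c => p; exact: lim_le (fun n => bF' n j p) (cF' j p).
move=> u g ug; have [Lu ugj] := ug.
have Lg j : L2 (g j) by case: (ugj j).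
have c1 j := dominated_mul_cvg (fun n => mF_' n j) (mF' j) (cF' j) (fun n => bF' n j) Lu.
have c2 j := dominated_mul_cvg mF_ mF cF bF (Lg j).
have c3 i j := dominated_mul_cvg (fun n => mF_' n i) (mF' i) (cF' i) (fun n => bF' n i) (Lg j).
have gnu n : (forall j, \int[mu]_p (F_' n j p * u p) = - \int[mu]_p (F_ n p * g j p)) /\
    (forall i j, \int[mu]_p (F_' n i p * g j p) = \int[mu]_p (F_' n j p * g i p)).
  by have [_ _] := gn n; exact.
split=> [j|i j].
- have h : \int[mu]_p (F_' n j p * u p) @[n --> \oo] --> - \int[mu]_p (F p * g j p).
    rewrite (_ : (fun n => _) = (fun n => - \int[mu]_p (F_ n p * g j p))).
      by apply: cvgN; exact: c2.
    by apply/funext => n; rewrite (gnu n).1.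
  by rewrite -(cvg_lim (@Rhausdorff R) (c1 j)) -(cvg_lim (@Rhausdorff R) h).
- rewrite -(cvg_lim (@Rhausdorff R) (c3 i j)) -(cvg_lim (@Rhausdorff R) (c3 j i)).
  rewrite (_ : (fun n => _) = (fun n => \int[mu]_p (F_' n j p * g i p)))//.
  by apply/funext => n; exact: (gnu n).2.
Qed.

End weak_gradients.

(** * Glued radial fields *)

Section radial_fields.
Context {R : realType}.
Notation mu := (leb2 R).
Implicit Types (h dh : R -> R) (p : R * R) (i j : 'I_2) (t B C : R).

Definition sqn p : R := p.1 ^+ 2 + p.2 ^+ 2.

Lemma sqn_ge0 p : 0 <= sqn p.
Proof. by rewrite addr_ge0 ?sqr_ge0. Qed.

Lemma is_derive_rad h j p : smooth1 h ->
  is_derive p (basis2 R j) (fun p => h (sqn p)) (2 * pcoord j p * derive1 h (sqn p)).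
Proof.
move=> sh; apply/is_derive_coord.
have dq : is_derive (pcoord j p) 1 (fun s => sqn (set_coord j p s)) (2 * pcoord j p).
  rewrite /sqn /set_coord /pcoord; case: (j == 0) => /=.
  + have := is_deriveD (is_deriveX 2 (is_derive_id p.1 (1 : R)))
      (is_derive_cst (p.2 ^+ 2) p.1 (1 : R)).
    by move/is_derive_conv; apply => //; rewrite /GRing.scale/= addr0 mulr1 expr1 mulr_natl.
  + have := is_deriveD (is_derive_cst (p.1 ^+ 2) p.2 (1 : R)) (is_deriveX 2 (is_derive_id p.2 (1 : R))).
    by move/is_derive_conv; apply => //; rewrite /GRing.scale/= add0r mulr1 expr1 mulr_natl.
have E : sqn (set_coord j p (pcoord j p)) = sqn p.
  by case: p {dq} => x y; rewrite /set_coord /pcoord; case: (j == 0).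
have := @is_derive1_comp _ h (fun s => sqn (set_coord j p s)) _ _ _
  (smooth_on_is_derive (x := sqn (set_coord j p (pcoord j p))) sh I) dq.
by move/is_derive_conv; apply => //; rewrite E mulrC.
Qed.

Lemma is_derive_pcoord i j p : is_derive p (basis2 R j) (pcoord i) (i == j)%:R.
Proof.
apply/is_derive_coord; have [->|ij] := eqVneq i j.
  have := is_derive_id (pcoord j p) (1 : R).
  by move/is_derive_conv; apply => // s; rewrite /pcoord /set_coord; case: (j == 0).
apply: (@is_derive_conv _ _ _ (fun=> pcoord i p)) => // s.
by move: ij; rewrite /pcoord /set_coord; case: i => [[|[|i]]] // ?; case: j => [[|[|j]]].
Qed.

Lemma norm_pcoord2 i j p : `|pcoord i p * pcoord j p| <= sqn p.
Proof.
have H k : `|pcoord k p| ^+ 2 <= sqn p.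
  rewrite real_normK ?num_real// /pcoord /sqn.
  by case: (k == 0); rewrite ?lerDl ?lerDr sqr_ge0.
rewrite normrM; have := H i; have := H j.
have := sqr_ge0 (`|pcoord i p| - `|pcoord j p|); rewrite sqrrB => h h1 h2.
nra.
Qed.

Lemma norm_pcoord j p : `|pcoord j p| <= 1 + sqn p.
Proof.
have := norm_pcoord2 j j p; rewrite normrM -expr2 => h.
have := sqr_ge0 (`|pcoord j p| - 1); nra.
Qed.

(** Of the three factors 1 + |p|^2, one is kept to pay for the coordinates multiplying a radial
    function, and the other two dominate (1 + x^2)(1 + y^2), the inverse of the weight. *)
Lemma cube_weight p C t : 0 <= C -> `|t| * (1 + sqn p) ^+ 3 <= C ->
  `|t| * (1 + sqn p) <= C * weight p.
Proof.
move=> C0 tC; have q0 := sqn_ge0 p.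
have q1 : 0 < 1 + sqn p by rewrite ltr_pwDl.
have w0 : 0 < (1 + p.1 ^+ 2) * (1 + p.2 ^+ 2).
  by rewrite mulr_gt0// ltr_pwDl// sqr_ge0.
rewrite /weight -invfM ler_pdivlMr//; apply: le_trans tC.
rewrite -mulrA ler_wpM2l// exprS ler_pM2l// expr2 /sqn.
have := sqr_ge0 p.1; have := sqr_ge0 p.2; nra.
Qed.

Lemma rad_outside h B p : (forall t, B <= t -> h t = 0) ->
  outside_box (1 + `|B|) p -> h (sqn p) = 0.
Proof.
move=> hB pB; apply: hB; apply: le_trans (ler_norm _) _.
have H (x : R) : 1 + `|B| < `|x| -> `|B| <= x ^+ 2.
  move=> Bx; rewrite -real_normK ?num_real//; have := normr_ge0 B; nra.
by case: pB => /H h'; apply: (le_trans h'); rewrite /sqn ?lerDl ?lerDr sqr_ge0.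
Qed.

Lemma ibp_radial_compact h B : smooth1 h -> (forall t, B <= t -> h t = 0) ->
  ibp_field (fun p => h (sqn p)) (fun j p => 2 * pcoord j p * derive1 h (sqn p)) /\
  forall i, ibp_field (fun p => pcoord i p * h (sqn p))
    (fun j p => (i == j)%:R * h (sqn p) + 2 * pcoord i p * pcoord j p * derive1 h (sqn p)).
Proof.
move=> sh hB; have B0 : 0 < 1 + `|B| by rewrite ltr_pwDl.
have er : elem (fun p => h (sqn p)) by exact: elem_rad.
split=> [|i].
  rewrite (_ : (fun j p => _) = fun j => partial j (fun p => h (sqn p))).
    apply: ibp_field_elem => //; apply: (elem_test_function B0 er) => p.
    exact: rad_outside.
  by apply/funext => j; apply/funext => p; apply/esym/partialE; exact: is_derive_rad.
have ei : elem (fun p => pcoord i p * h (sqn p)).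
  by apply: elem_mul => //; exact: (elem_coord i (smooth_on_id openT)).
rewrite (_ : (fun j p => _) = fun j => partial j (fun p => pcoord i p * h (sqn p))).
  apply: ibp_field_elem => //; apply: (elem_test_function B0 ei) => p pB.
  by rewrite (rad_outside hB pB) mulr0.
apply/funext => j; apply/funext => p; apply/esym/partialE.
have := is_deriveM (is_derive_pcoord i j p) (is_derive_rad j p sh).
by move/is_derive_conv; apply => //; rewrite /GRing.scale/=; ring.
Qed.

Lemma ibp_radial (h_ : nat -> R -> R) h dh C :
  (forall n, smooth1 (h_ n)) -> (forall n, exists B, forall t, B <= t -> h_ n t = 0) ->
  (forall n t, 0 <= t -> `|h_ n t| * (1 + t) ^+ 3 <= C) ->
  (forall n t, 0 <= t -> `|derive1 (h_ n) t| * (1 + t) ^+ 3 <= C) ->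
  (forall t, 0 <= t -> h_ n t @[n --> \oo] --> h t) ->
  (forall t, 0 <= t -> derive1 (h_ n) t @[n --> \oo] --> dh t) ->
  ibp_field (fun p => h (sqn p)) (fun j p => 2 * pcoord j p * dh (sqn p)) /\
  forall i, ibp_field (fun p => pcoord i p * h (sqn p))
    (fun j p => (i == j)%:R * h (sqn p) + 2 * pcoord i p * pcoord j p * dh (sqn p)).
Proof.
move=> sh h0 hC dC hcv dcv.
have C0 : 0 <= C by apply: le_trans (hC 0 0 (lexx _)); rewrite mulr_ge0// exprn_ge0// addr0.
have q0 := sqn_ge0.
have w0 p := ltW (weight_gt0 p).
have q1 p : 1 <= 1 + sqn p by rewrite lerDl.
have hW n p : `|h_ n (sqn p)| * (1 + sqn p) <= C * weight p by exact: cube_weight (hC n _ (q0 p)).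
have dW n p : `|derive1 (h_ n) (sqn p)| * (1 + sqn p) <= C * weight p.
  exact: cube_weight (dC n _ (q0 p)).
(* The constant 3 C is C for the term in [h_] plus 2 C for the term with its derivative. *)
have Cw p : C * weight p <= 3 * C * weight p.
  by have := mulr_ge0 C0 (w0 p); nra.
have h1 n p : `|h_ n (sqn p)| <= C * weight p.
  by apply: le_trans (hW n p); rewrite ler_peMr.
split=> [|i].
  apply: (@ibp_field_lim _ (fun n p => h_ n (sqn p))
    (fun n j p => 2 * pcoord j p * derive1 (h_ n) (sqn p)) _ _ (3 * C)).
  - by move=> n; have [B hB] := h0 n; case: (ibp_radial_compact (sh n) hB).
  - by move=> n p; exact: le_trans (h1 n p) (Cw p).
  - move=> n j p; rewrite !normrM ger0_norm//.
    have := dW n p; have := norm_pcoord j p; have := normr_ge0 (derive1 (h_ n) (sqn p)).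
    have := mulr_ge0 C0 (w0 p); nra.
  - by move=> p; exact: hcv.
  - by move=> j p; apply: cvgM; [exact: cvg_cst|exact: dcv].
apply: (@ibp_field_lim _ (fun n p => pcoord i p * h_ n (sqn p))
  (fun n j p => (i == j)%:R * h_ n (sqn p) + 2 * pcoord i p * pcoord j p * derive1 (h_ n) (sqn p)) _ _ (3 * C)).
- by move=> n; have [B hB] := h0 n; case: (ibp_radial_compact (sh n) hB).
- move=> n p; apply: le_trans (Cw p); rewrite normrM mulrC; apply: le_trans (hW n p).
  by rewrite ler_wpM2l// norm_pcoord.
- move=> n j p; apply: (@le_trans _ _ (C * weight p + 2 * (C * weight p))); last by lra.
  apply: le_trans (ler_normD _ _) _; apply: lerD.
    rewrite normrM; apply: le_trans (h1 n p); rewrite ler_piMl//.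
    by case: (i == j); rewrite ?normr1 ?normr0.
  rewrite -!mulrA normrM ger0_norm// ler_pM2l// mulrA normrM mulrC.
  apply: le_trans (dW n p); rewrite ler_wpM2l//.
  by rewrite (le_trans (norm_pcoord2 i j p))// lerDr.
- by move=> p; apply: cvgM; [exact: cvg_cst|exact: hcv].
- move=> j p; apply: cvgD; apply: cvgM; (exact: cvg_cst || exact: hcv || exact: dcv).
Qed.

Lemma smooth1_bounded h a b : smooth1 h -> exists2 k, 0 <= k & forall t, a <= t <= b -> `|h t| <= k.
Proof.
move=> /smooth1_continuous ch.
have [ab|ba] := leP a b; last first.
  by exists 0 => // t /andP[at_ tb]; have := lt_le_trans ba (le_trans at_ tb); rewrite ltxx.
have cn : {within `[a, b], continuous (fun t => `|h t|)}.
  by apply: continuous_subspaceT => t; apply: cvg_norm; exact: ch.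
have [x0 _ x0P] := @EVT_max R (fun t => `|h t|) a b ab cn.
by exists `|h x0| => // t tab; apply: x0P; rewrite in_itv/=.
Qed.

Lemma smooth1_lipschitz h a b s t L : smooth1 h ->
  (forall t, a <= t <= b -> `|derive1 h t| <= L) -> a <= s <= b -> a <= t <= b ->
  `|h t - h s| <= L * `|t - s|.
Proof.
move=> sh hL; wlog st : s t / s <= t.
  move=> W sab tab; have [st|/ltW ts] := leP s t; first exact: W.
  by rewrite distrC (distrC t); exact: W.
move=> /andP[as_ sb] /andP[at_ tb].
have [||x xab ->] := @MVT_segment R h (derive1 h) s t st.
- by move=> x _; exact: smooth_on_is_derive sh I.
- exact: continuous_subspaceT (smooth1_continuous sh).
rewrite normrM ler_wpM2r// hL//; move: xab; rewrite in_itv/= => /andP[h1 h2].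
by rewrite (le_trans as_ h1) (le_trans h2 tb).
Qed.

(** At [l] and [r] the neighbouring pieces take over, so that in the variable r^2 the middle piece
    is used exactly on the open annulus. *)
Definition piecewise3 (l r : R) (f1 f2 f3 : R -> R) (t : R) : R :=
  if t <= l then f1 t else if t < r then f2 t else f3 t.

End radial_fields.

(** * Gluing three radial profiles along two circles *)

Section glued_profiles.
Context {R : realType}.
Variables (l r C : R) (f1 f2 f3 : R -> R).
Hypotheses (l0 : 0 < l) (lr : l < r).
Hypotheses (s1 : smooth1 f1) (s2 : smooth1 f2) (s3 : smooth1 f3).
Hypotheses (f12 : f1 l = f2 l) (f23 : f2 r = f3 r).
Hypotheses (f3C : forall t, r <= t -> `|f3 t| * (1 + t) ^+ 3 <= C)
  (df3C : forall t, r <= t -> `|derive1 f3 t| * (1 + t) ^+ 3 <= C).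

Let smooth_derive f (t : R) (sf : smooth1 f) := smooth_on_is_derive (x := t) sf I.

(** The glued function is continuous but its derivative jumps. It is approximated by smooth
    functions that change from one piece to the next on shrinking intervals; continuity at the
    junctions is what keeps their derivatives bounded. *)
Lemma ibp_glue : let h := piecewise3 l r f1 f2 f3 in
  let dh := piecewise3 l r (derive1 f1) (derive1 f2) (derive1 f3) in
  ibp_field (fun p => h (sqn p)) (fun j p => 2 * pcoord j p * dh (sqn p)) /\
  forall i, ibp_field (fun p => pcoord i p * h (sqn p))
    (fun j p => (i == j)%:R * h (sqn p) + 2 * pcoord i p * pcoord j p * dh (sqn p)).
Proof.
move=> h dh.
(* From rank [N0] on, the transition starting at [l] ends before [r], and the one ending at [r]
   starts after [l], so neither disturbs the formula beyond the other junction. *)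
have [N0 _ N0P] := near_step_at lr.
pose N n := (n + N0)%N; pose e n : R := (N n).+1%:R^-1.
have e0 n : 0 < e n by rewrite invr_gt0.
have le n : l + e n < r by apply: N0P; rewrite /= leq_addl.
pose xl n := step_at (N n) l; pose xr n := step_at (N n) (r - e n).
pose dxl n (t : R) : R := (N n).+1%:R * derive1 smooth_step ((N n).+1%:R * (t - l)).
pose dxr n (t : R) : R := (N n).+1%:R * derive1 smooth_step ((N n).+1%:R * (t - (r - e n))).
(* Both transitions lie inside [l, r], so [P n] equals [f1] up to [l] and [f3] from [r] on; in
   particular the decay at infinity is kept. *)
pose P n t := f2 t + (1 - xl n t) * (f1 t - f2 t) + xr n t * (f3 t - f2 t).
pose dP n t := derive1 f2 t + ((1 - xl n t) * (derive1 f1 t - derive1 f2 t) - dxl n t * (f1 t - f2 t))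
  + (xr n t * (derive1 f3 t - derive1 f2 t) + dxr n t * (f3 t - f2 t)).
have sP n : smooth1 (P n).
  apply: (smooth_onD openT).
    apply: (smooth_onD openT) => //; apply: (smooth_onM openT).
      exact: (smooth_onB openT (smooth_on_cst openT 1) (step_at_smooth _ _)).
    exact: (smooth_onB openT s1 s2).
  apply: (smooth_onM openT (step_at_smooth _ _)).
  exact: (smooth_onB openT s3 s2).
have PE n t : derive1 (P n) t = dP n t.
  have dl := is_deriveB (is_derive_cst (1 : R) t (1 : R)) (is_derive_step_at (N n) l t).
  have dr := is_derive_step_at (N n) (r - e n) t.
  have d12 := is_deriveB (smooth_derive t s1) (smooth_derive t s2).
  have d32 := is_deriveB (smooth_derive t s3) (smooth_derive t s2).
  have D := is_deriveD (is_deriveD (smooth_derive t s2) (is_deriveM dl d12)) (is_deriveM dr d32).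
  rewrite derive1E; have [_ ->] := D.
  by rewrite /GRing.scale/= !fctE /dP /xl /xr /dxl /dxr /=; ring.
have Pa n t : t <= l -> P n t = f1 t /\ dP n t = derive1 f1 t.
  move=> tl; have tr : t <= r - e n by have := le n; lra.
  rewrite /P /dP /dxl /dxr /xl /xr !step_at0// !derive_step_at0 ?tl ?tr//.
  by split; ring.
have Pb n t : r <= t -> P n t = f3 t /\ dP n t = derive1 f3 t.
  move=> rt; have tl : l + e n <= t by have := le n; lra.
  have tr : r - e n + e n <= t by rewrite subrK.
  rewrite /P /dP /dxl /dxr /xl /xr !step_at1// !derive_step_at0 ?tl ?tr ?orbT//.
  by split; ring.
have Pc t : l < t -> t < r -> \forall n \near \oo, P n t = f2 t /\ dP n t = derive1 f2 t.
  move=> lt tr; have tr0 : 0 < r - t by rewrite subr_gt0.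
  have [M _ MP] := near_step_at lt.
  near=> n.
  have h1 : l + e n <= t.
    by apply/ltW/MP => /=; apply: leq_trans (leq_addr _ _); near: n; exact: nbhs_infty_ge.
  have h2 : t <= r - e n.
    rewrite lerBrDl -lerBrDr; apply: (@le_trans _ _ n.+1%:R^-1).
      by rewrite /e lef_pV2 ?posrE// ler_nat ltnS leq_addr.
    rewrite ltW//; near: n; exact: (near_infty_natSinv_lt (PosNum tr0)).
  rewrite /P /dP /dxl /dxr /xl /xr (@step_at1 _ (N n) l)// (@step_at0 _ (N n) (r - e n))//.
  rewrite !derive_step_at0 ?h1 ?h2 ?orbT//.
  by split; ring.
(* A bound uniform in n. The factors [dxl] and [dxr] are of order n, but they multiply differences
   that vanish at the junction by [f12] and [f23], hence are of order 1/n on the transition by the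
   Lipschitz estimate. *)
have [k k0 kP] : exists2 k, 0 <= k & forall n t, 0 <= t <= r -> `|P n t| <= k /\ `|dP n t| <= k.
  have [c c0 cP] := @norm_transition R.
  have [a1 a10 a1P] := smooth1_bounded 0 r s1.
  have [a2 a20 a2P] := smooth1_bounded 0 r s2.
  have [a3 a30 a3P] := smooth1_bounded 0 r s3.
  have [b1 b10 b1P] := smooth1_bounded 0 r (smooth_on_derive s1).
  have [b2 b20 b2P] := smooth1_bounded 0 r (smooth_on_derive s2).
  have [b3 b30 b3P] := smooth1_bounded 0 r (smooth_on_derive s3).
  have lip f s L t : smooth1 f -> f s = 0 -> (forall t, 0 <= t <= r -> `|derive1 f t| <= L) ->
      0 <= s <= r -> 0 <= t <= r -> `|f t| <= L * `|t - s|.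
    by move=> sf fs fL s01 t01; have := smooth1_lipschitz sf fL s01 t01; rewrite fs subr0.
  have s12 := smooth_onB openT s1 s2; have s32 := smooth_onB openT s3 s2.
  have lip12 t : 0 <= t <= r -> `|f1 t - f2 t| <= (b1 + b2) * `|t - l|.
    apply: (lip (fun t => f1 t - f2 t) l (b1 + b2) t s12).
    - by rewrite f12 subrr.
    - move=> u u01; rewrite derive1E.
      have [_ ->] := is_deriveB (smooth_derive u s1) (smooth_derive u s2).
      by rewrite (le_trans (ler_normB _ _))// lerD ?b1P ?b2P.
    - by rewrite !ltW.
  have lip32 t : 0 <= t <= r -> `|f3 t - f2 t| <= (b3 + b2) * `|t - r|.
    apply: (lip (fun t => f3 t - f2 t) r (b3 + b2) t s32).
    - by rewrite f23 subrr.
    - move=> u u01; rewrite derive1E.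
      have [_ ->] := is_deriveB (smooth_derive u s3) (smooth_derive u s2).
      by rewrite (le_trans (ler_normB _ _))// lerD ?b3P ?b2P.
    - by rewrite lexx andbT ltW// (lt_trans l0).
  have xl1 n t : `|1 - xl n t| <= 1.
    by rewrite ler_norml; have := step_at_ge0 (N n) l t; have := step_at_le1 (N n) l t; rewrite /xl; lra.
  have xr1 n t : `|xr n t| <= 1.
    by rewrite ger0_norm ?step_at_ge0 ?step_at_le1.
  have mle (x y z : R) : `|x| <= 1 -> `|y| <= z -> `|x * y| <= z.
    by move=> x1 yz; rewrite normrM -[leRHS]mul1r ler_pM.
  exists (a2 + (a1 + a2) + (a3 + a2) + (b2 + ((b1 + b2) + c * (b1 + b2)) + ((b3 + b2) + c * (b3 + b2)))).
    have c1 := mulr_ge0 c0 (addr_ge0 b10 b20); have c2 := mulr_ge0 c0 (addr_ge0 b30 b20); lra.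
  move=> n t t01.
  have c1 := mulr_ge0 c0 (addr_ge0 b10 b20); have c2 := mulr_ge0 c0 (addr_ge0 b30 b20).
  have h12 : `|f1 t - f2 t| <= a1 + a2 by rewrite (le_trans (ler_normB _ _))// lerD ?a1P ?a2P.
  have h32 : `|f3 t - f2 t| <= a3 + a2 by rewrite (le_trans (ler_normB _ _))// lerD ?a3P ?a2P.
  have d12 : `|derive1 f1 t - derive1 f2 t| <= b1 + b2.
    by rewrite (le_trans (ler_normB _ _))// lerD ?b1P ?b2P.
  have d32 : `|derive1 f3 t - derive1 f2 t| <= b3 + b2.
    by rewrite (le_trans (ler_normB _ _))// lerD ?b3P ?b2P.
  split.
    have p1 := mle _ _ _ (xl1 n t) h12; have p2 := mle _ _ _ (xr1 n t) h32.
    have := a2P t t01.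
    have := ler_normD (f2 t + (1 - xl n t) * (f1 t - f2 t)) (xr n t * (f3 t - f2 t)).
    have := ler_normD (f2 t) ((1 - xl n t) * (f1 t - f2 t)).
    rewrite -/(P n t); lra.
  have p1 := mle _ _ _ (xl1 n t) d12; have p2 := mle _ _ _ (xr1 n t) d32.
  have q1 : `|dxl n t * (f1 t - f2 t)| <= c * (b1 + b2).
    apply: cP; first exact: addr_ge0.
    move=> lt tl; apply: (le_trans (lip12 t t01)); rewrite ler_wpM2l ?addr_ge0//.
    by rewrite ger0_norm ?subr_ge0 1?ltW// ltrBlDl.
  have q2 : `|dxr n t * (f3 t - f2 t)| <= c * (b3 + b2).
    apply: cP; first exact: addr_ge0.
    rewrite -/(e n) subrK => rt tr; apply: (le_trans (lip32 t t01)); rewrite ler_wpM2l ?addr_ge0//.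
    by rewrite distrC ger0_norm ?subr_ge0 1?ltW// ltrBlDl -ltrBlDr.
  have := b2P t t01.
  rewrite /dP; set X := derive1 f2 t; set Y := (1 - xl n t) * _; set Z := dxl n t * _.
  set V := xr n t * _; set W := dxr n t * _.
  have := ler_normD (X + (Y - Z)) (V + W); have := ler_normD X (Y - Z).
  have := ler_normB Y Z; have := ler_normD V W; lra.
(* The cutoff makes the support compact; at each fixed t it is eventually 1 with zero derivative, so
   it leaves no trace in the limit. *)
pose hn n t : R := P n t * cutoff n%:R t.
pose dhn n t : R := P n t * derive1 (cutoff n%:R) t + cutoff n%:R t * dP n t.
have sh n : smooth1 (hn n) by exact: (smooth_onM openT (sP n) (cutoff_smooth _)).
have hE n t : derive1 (hn n) t = dhn n t.
  rewrite derive1E; have [_ ->] := is_deriveM (smooth_derive t (sP n)) (smooth_derive t (cutoff_smooth n%:R)).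
  by rewrite /GRing.scale/= PE.
have [cc cc0 ccP] := @derive_cutoff_bounded R.
have r0 : 0 < r by exact: lt_trans lr.
have C0 : 0 <= C by apply: le_trans (f3C (lexx r)); rewrite mulr_ge0// exprn_ge0// addr_ge0// ltW.
(* The factor 1 + [cc] absorbs the derivative of the cutoff. *)
pose K := (1 + cc) * (k * (1 + r) ^+ 3 + C).
have PK n t : 0 <= t -> `|P n t| * (1 + t) ^+ 3 <= k * (1 + r) ^+ 3 + C /\
     `|dP n t| * (1 + t) ^+ 3 <= k * (1 + r) ^+ 3 + C.
  move=> t0; have [tr|rt] := leP t r.
    have [p1 p2] := kP n t (introT andP (conj t0 tr)).
    have : (1 + t) ^+ 3 <= (1 + r) ^+ 3 by rewrite lerXn2r ?nnegrE ?addr_ge0 ?lerD2l// ltW.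
    have t1 : 0 <= (1 + t) ^+ 3 by rewrite exprn_ge0// addr_ge0.
    by move=> tr3; split; rewrite -[leLHS]addr0 lerD// ler_pM.
  have [-> ->] := Pb n t (ltW rt).
  have kr : 0 <= k * (1 + r) ^+ 3 by rewrite mulr_ge0// exprn_ge0// addr_ge0// ltW.
  by split; rewrite -[leLHS]add0r lerD// ?f3C ?df3C// ltW.
have cut1 (t : R) : 0 <= t -> \forall n \near \oo, cutoff (n%:R : R) t = 1 /\ derive1 (cutoff n%:R) t = 0.
  move=> t0; near=> n.
  have tn : `|t| <= n%:R by near: n; exact: nbhs_infty_ger.
  by rewrite cutoff1// derive_cutoff0.
have ev (t : R) : 0 <= t -> \forall n \near \oo, P n t = h t /\ dP n t = dh t.
  move=> t0; rewrite /h /dh /piecewise3; case: ifPn => [tl|]; first by near=> n; exact: Pa.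
  rewrite -ltNge => lt; case: ifPn => [tr|]; first exact: Pc.
  by rewrite -leNgt => rt; near=> n; exact: Pb.
apply: (@ibp_radial _ hn h dh K) => //.
- move=> n; exists (n%:R + 1) => t nt; rewrite /hn cutoff0 ?mulr0//.
  by rewrite (le_trans nt)// ler_norm.
- move=> n t t0; rewrite /hn normrM mulrAC.
  have [p1 _] := PK n t t0.
  apply: (@le_trans _ _ (k * (1 + r) ^+ 3 + C)).
    by apply: le_trans p1; rewrite ler_piMr ?cutoff_norm// mulr_ge0// exprn_ge0// addr_ge0.
  by rewrite ler_peMl ?lerDl// addr_ge0// mulr_ge0// exprn_ge0// addr_ge0// ltW.
- move=> n t t0; rewrite hE /dhn.
  have [p1 p2] := PK n t t0.
  have t1 : 0 <= (1 + t) ^+ 3 by rewrite exprn_ge0// addr_ge0.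
  apply: (@le_trans _ _ ((`|P n t| * `|derive1 (cutoff n%:R) t| + `|dP n t|) * (1 + t) ^+ 3)).
    rewrite ler_wpM2r// (le_trans (ler_normD _ _))// normrM (normrM (cutoff _ _)) lerD2l.
    by rewrite ler_piMl// cutoff_norm.
  rewrite mulrDl /K mulrDl mul1r addrC lerD// mulrAC mulrC.
  by rewrite ler_pM// mulr_ge0.
- move=> t t0; apply: cvg_near_cst; near=> n.
  have [hP _] : P n t = h t /\ dP n t = dh t by near: n; exact: ev.
  have [c1 _] : cutoff (n%:R : R) t = 1 /\ derive1 (cutoff n%:R) t = 0 by near: n; exact: cut1.
  by rewrite /hn hP c1 mulr1.
- move=> t t0; apply: cvg_near_cst; near=> n.
  have [hP dhP] : P n t = h t /\ dP n t = dh t by near: n; exact: ev.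
  have [c1 c2] : cutoff (n%:R : R) t = 1 /\ derive1 (cutoff n%:R) t = 0 by near: n; exact: cut1.
  by rewrite hE /dhn hP dhP c1 c2 mulr0 add0r mul1r.
Unshelve. all: by end_near. Qed.

End glued_profiles.

(** * Modified Bessel functions *)

Section bessel_first_kind.
Context {R : realType}.
Implicit Types (x z : R) (m n : nat).

Definition bessel_coeff m (k : nat) : R := (k`!%:R * (k + m)`!%:R)^-1.

(* The entire functions [J_m] with [J_m' = J_(m+1)] and
   [I_m(x) = (x/2)^m J_m(x^2/4)] for m = 0, 1. *)
Definition besselJ m z : R := limn (pseries (bessel_coeff m) z).

Let fact_neq0 n : n`!%:R != 0 :> R.
Proof. by rewrite pnatr_eq0 -lt0n fact_gt0. Qed.

Lemma bessel_coeff_diffs m : pseries_diffs (bessel_coeff m) = bessel_coeff m.+1.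
Proof.
apply/funext => k; rewrite /pseries_diffs /bessel_coeff addnS addSn factS natrM.
by rewrite -mulrA invfM mulrA divff ?mul1r// pnatr_eq0.
Qed.

(** The coefficients are at most 1/k!, so the exponential series dominates for every z. *)
Lemma is_cvg_besselJ m z : cvgn (pseries (bessel_coeff m) z).
Proof.
apply: normed_cvg; apply: (@series_le_cvg _ _ (exp_coeff `|z|)).
- by move=> k; exact: normr_ge0.
- by move=> k; rewrite exp_coeffE /= mulr_ge0// invr_ge0.
- move=> k; rewrite exp_coeffE /bessel_coeff /= normrM normrX ler_wpM2r// ?exprn_ge0//.
  rewrite invfM normrM !ger0_norm ?invr_ge0// ler_piMr ?invr_ge0//.
  by rewrite invf_le1 ?ltr0n ?fact_gt0// ler1n fact_gt0.
- exact: is_cvg_series_exp_coeff.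
Qed.

Lemma is_derive_besselJ m z : is_derive z 1 (besselJ m) (besselJ m.+1 z).
Proof.
rewrite /besselJ -bessel_coeff_diffs.
apply: (@pseries_snd_diffs _ _ (`|z| + 1)).
- exact: is_cvg_besselJ.
- by rewrite bessel_coeff_diffs; exact: is_cvg_besselJ.
- by rewrite !bessel_coeff_diffs; exact: is_cvg_besselJ.
- by rewrite [ltRHS]ger0_norm ?addr_ge0// ltrDl.
Qed.

Lemma besselJ_smooth m : smooth1 (besselJ m).
Proof.
move=> n; elim: n m => [//|n IH] m.
by apply: (nderivableS openT) => [x _|]; [exact: is_derive_besselJ|exact: IH].
Qed.

Lemma besselJ_gt0 m z : 0 <= z -> 0 < besselJ m z.
Proof.
move=> z0; have nd : nondecreasing_seq (pseries (bessel_coeff m) z).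
  apply/nondecreasing_seqP => n; rewrite /pseries seriesSr lerDl.
  by rewrite mulr_ge0 ?invr_ge0 ?mulr_ge0 ?exprn_ge0.
apply: lt_le_trans (nondecreasing_cvgn_le nd (@is_cvg_besselJ m z) 1).
rewrite /pseries /series/= big_nat1 expr0 mulr1 /bessel_coeff invr_gt0.
by rewrite mulr_gt0// ltr0n fact_gt0.
Qed.

(** Coefficientwise this is 1/(k!)^2 = 1/(k! (k+1)!) + 1/((k-1)! (k+1)!). Since each [besselJ] is
    the derivative of the previous one, it is the modified Bessel equation of order 0 in the
    variable x^2/4. *)
Lemma besselJ_recurrence z : besselJ 0 z = besselJ 1 z + z * besselJ 2 z.
Proof.
have pS c n : pseries c z n.+1 = pseries c z n + c n * z ^+ n by rewrite /pseries seriesSr.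
have E n : pseries (bessel_coeff 0) z n.+1 =
    pseries (bessel_coeff 1) z n.+1 + z * pseries (bessel_coeff 2) z n.
  elim: n => [|n IH].
    rewrite /pseries /series/= !big_nat1 big_geq// mulr0 addr0 /bessel_coeff.
    by rewrite addn0 addn1.
  rewrite pS IH (pS (bessel_coeff 1) n.+1) (pS (bessel_coeff 2)).
  rewrite mulrDr addrACA; congr (_ + _); rewrite exprS /bessel_coeff addn0 addn1 addn2.
  have h1 := fact_neq0 n; have h2 : n.+1%:R != 0 :> R by rewrite pnatr_eq0.
  have h3 : n.+2%:R != 0 :> R by rewrite pnatr_eq0.
  rewrite !factS !natrM -(natr1 n.+1) in h3 *.
  move: (n`!%:R) (n.+1%:R : R) (z ^+ n) h1 h2 h3 => A B Z h1 h2 h3.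
  by field; rewrite h1 h2 h3.
have c0 := @is_cvg_besselJ 0 z; have c1 := @is_cvg_besselJ 1 z.
have c2 := @is_cvg_besselJ 2 z.
have l0 : pseries (bessel_coeff 0) z n.+1 @[n --> \oo] --> besselJ 0 z.
  by rewrite (cvg_shiftS (pseries (bessel_coeff 0) z)).
have l1 : pseries (bessel_coeff 1) z n.+1 + z * pseries (bessel_coeff 2) z n @[n --> \oo] -->
    besselJ 1 z + z * besselJ 2 z.
  apply: cvgD; first by rewrite (cvg_shiftS (pseries (bessel_coeff 1) z)).
  by apply: cvgM; [exact: cvg_cst|exact: c2].
rewrite -(cvg_lim (@Rhausdorff R) l0) -(cvg_lim (@Rhausdorff R) l1).
rewrite (_ : (fun n => _) = (fun n => pseries (bessel_coeff 1) z n.+1 + z * pseries (bessel_coeff 2) z n))//.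
by apply/funext => n; rewrite E.
Qed.

Lemma besselI0E x : besselI 0 x = besselJ 0 ((x / 2) ^+ 2).
Proof.
rewrite /besselI /besselJ /pseries; congr (limn (series _)); apply/funext => k.
by rewrite /bessel_coeff /= !addn0 mulrC -exprM mul2n.
Qed.

Lemma besselI1E x : besselI 1 x = (x / 2) * besselJ 1 ((x / 2) ^+ 2).
Proof.
rewrite /besselI /besselJ.
have c : (x / 2) * pseries (bessel_coeff 1) ((x / 2) ^+ 2) n @[n --> \oo] -->
    (x / 2) * limn (pseries (bessel_coeff 1) ((x / 2) ^+ 2)).
  by apply: cvgM; [exact: cvg_cst|exact: is_cvg_besselJ].
rewrite -(cvg_lim (@Rhausdorff R) c); congr (limn _); apply/funext => n.
rewrite /pseries /series/= mulr_sumr; apply: eq_bigr => k _.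
by rewrite /bessel_coeff addn1 exprS -exprM mul2n; ring.
Qed.

Lemma besselI0_gt0 x : 0 < besselI 0 x.
Proof. by rewrite besselI0E besselJ_gt0// sqr_ge0. Qed.

Lemma besselI1_ge0 x : 0 <= x -> 0 <= besselI 1 x.
Proof.
by move=> x0; rewrite besselI1E mulr_ge0 ?divr_ge0// ltW// besselJ_gt0// sqr_ge0.
Qed.

Let is_derive_half x : is_derive x 1 (fun x => x / 2) 2^-1.
Proof.
have := is_deriveM (is_derive_id x (1 : R)) (is_derive_cst (2^-1 : R) x (1 : R)).
by move/is_derive_conv; apply => //; rewrite /GRing.scale/= mulr0 add0r mulr1.
Qed.

Let is_derive_halfsq x : is_derive x 1 (fun x => (x / 2) ^+ 2) (x / 2).
Proof.
have := is_deriveM (is_derive_half x) (is_derive_half x).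
by move/is_derive_conv; apply => [y|]; rewrite /GRing.scale/= ?fctE ?expr2//; field.
Qed.

Lemma is_derive_besselI0 x : is_derive x 1 (besselI 0) (besselI 1 x).
Proof.
have := @is_derive1_comp _ (besselJ 0) _ x _ _ (is_derive_besselJ 0 _) (is_derive_halfsq x).
by move/is_derive_conv; apply => [y|]; rewrite /= ?besselI0E// besselI1E mulrC.
Qed.

Lemma is_derive_besselI1 x : is_derive x 1 (besselI 1)
  (besselI 0 x - 2^-1 * besselJ 1 ((x / 2) ^+ 2)).
Proof.
have d1 := @is_derive1_comp _ (besselJ 1) _ x _ _ (is_derive_besselJ 1 _) (is_derive_halfsq x).
have := is_deriveM (is_derive_half x) d1.
move/is_derive_conv; apply => [y|]; rewrite /GRing.scale/= ?fctE.
  by rewrite besselI1E.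
by rewrite besselI0E besselJ_recurrence; field.
Qed.

Let derive_ge0_le (f df : R -> R) a b : (forall x, is_derive x 1 f (df x)) ->
  a <= b -> (forall x, a <= x <= b -> 0 <= df x) -> f a <= f b.
Proof.
move=> fdf ab df0; rewrite -subr_ge0.
have [|x xab ->] := @MVT_segment R f df a b ab (fun x _ => fdf x).
- apply: continuous_subspaceT => x; apply: differentiable_continuous.
  by apply/derivable1_diffP; case: (fdf x).
- by rewrite mulr_ge0 ?subr_ge0// df0//; move: xab; rewrite in_itv.
Qed.

(** The function exp(y) (I_0(y) - I_1(y)) is positive at 0, and its derivative exp(y) I_1(y)/y is
    nonnegative. *)
Lemma besselI1_le_I0 x : 0 <= x -> besselI 1 x <= besselI 0 x.
Proof.
move=> x0.
have D (y : R) : is_derive y 1 (fun y => expR y * (besselI 0 y - besselI 1 y))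
    (expR y * (2^-1 * besselJ 1 ((y / 2) ^+ 2))).
  have := is_deriveM (is_derive_expR y) (is_deriveB (is_derive_besselI0 y) (is_derive_besselI1 y)).
  by move/is_derive_conv; apply => //; rewrite /GRing.scale/= ?fctE; ring.
have := derive_ge0_le D x0 _; rewrite expR0 mul1r besselI1E mul0r mul0r subr0 => H.
have : 0 <= expR x * (besselI 0 x - besselI 1 x).
  apply: le_trans (H _); first exact/ltW/besselI0_gt0.
  by move=> y /andP[y0 _]; rewrite !mulr_ge0 ?expR_ge0 ?invr_ge0// ltW// besselJ_gt0// sqr_ge0.
by rewrite pmulr_rge0 ?expR_gt0// subr_ge0.
Qed.

(** For x <= 1 it suffices that I_1 >= 0. Beyond 1, the function y I_1 - (y - 1) I_0 starts from
    I_1(1) >= 0 and has derivative (y - 1)(I_0 - I_1) >= 0. *)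
Lemma besselI_gap x : 0 <= x -> x * (besselI 0 x - besselI 1 x) <= besselI 0 x.
Proof.
move=> x0; have [x1|/ltW x1] := leP x 1.
  apply: (@le_trans _ _ (x * besselI 0 x)).
    by rewrite ler_wpM2l// gerBl besselI1_ge0.
  by rewrite ler_piMl// ltW// besselI0_gt0.
have D (y : R) : is_derive y 1 (fun y => y * besselI 1 y - (y - 1) * besselI 0 y)
    ((y - 1) * (besselI 0 y - besselI 1 y)).
  have := is_deriveB (is_deriveM (is_derive_id y (1 : R)) (is_derive_besselI1 y))
    (is_deriveM (is_deriveB (is_derive_id y (1 : R)) (is_derive_cst (1 : R) y (1 : R))) (is_derive_besselI0 y)).
  move/is_derive_conv; apply => //; rewrite /GRing.scale/= ?fctE /=.
  by rewrite !besselI1E; field.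
have := derive_ge0_le D x1; rewrite subrr mul0r subr0 mul1r => H.
have : 0 <= x * besselI 1 x - (x - 1) * besselI 0 x.
  apply: le_trans (H _); first exact: besselI1_ge0.
  move=> y /andP[y1 _]; rewrite mulr_ge0 ?subr_ge0// besselI1_le_I0//.
  exact: le_trans y1.
by rewrite mulrBr mulrBl mul1r; lra.
Qed.

End bessel_first_kind.

(** * The functions K_0 and K_1 as integrals *)

Section bessel_second_kind.
Context {R : realType}.
Notation lam := (@lebesgue_measure R).
Implicit Types (x t a b : R) (m n : nat).

Notation half_line := (`[0, +oo[%classic : set R).

Let mhalf : measurable half_line.
Proof. exact: measurable_itv. Qed.

(** The integrals over [0, n] converge by dominated convergence, so a limit of the primitive along
    the integers is enough. *)
Lemma integral_derive_half_line (f F : R -> R) l : (forall t : R, is_derive t 1 F (f t)) ->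
  continuous f -> lam.-integrable half_line (EFin \o f) ->
  F n%:R @[n --> \oo] --> l -> \int[lam]_(t in half_line) f t = l - F 0.
Proof.
move=> Ff cf if_ Fl.
have mf : measurable_fun half_line f.
  by apply: measurable_funTS; exact: continuous_measurable_fun.
pose I n : set R := `[0, n%:R]%classic.
have mI n : measurable (I n) by exact: measurable_itv.
pose fn n t : R := f t * \1_(I n) t.
have mfn n : measurable_fun half_line (EFin \o fn n).
  by apply/measurable_EFinP; apply: measurable_funM => //; exact: measurable_indic.
have m2 : measurable_fun half_line (EFin \o f) by exact/measurable_EFinP.
have a1 : {ae lam, forall t, half_line t -> (EFin \o fn n) t @[n --> \oo] --> (EFin \o f) t}.
  apply: aeW => t /=; rewrite in_itv/= andbT => t0; apply: cvg_EFin; first exact: nearW.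
  apply: cvg_near_cst; near=> n; rewrite /= /fn indicE mem_set ?mulr1// /I /= in_itv/= t0/=.
  by near: n; exact: nbhs_infty_ger.
have a2 : {ae lam, forall t n, half_line t -> (`|(EFin \o fn n) t| <= (abse \o (EFin \o f)) t)%E}.
  apply: aeW => t n _ /=; rewrite lee_fin /fn normrM indicE ler_piMr//.
  by case: (_ \in _); rewrite ?normr1 ?normr0.
have [_ _ i3] := @dominated_convergence _ _ _ lam _ mhalf _ _ _ mfn m2 a1 (integrable_abse if_) a2.
have cF : continuous F.
  by move=> t; apply: differentiable_continuous; apply/derivable1_diffP; case: (Ff t).
have E n : (\int[lam]_(t in half_line) (EFin \o fn n.+1) t = (F n.+1%:R - F 0)%:E)%E.
  transitivity (\int[lam]_(t in I n.+1) (f t)%:E)%E.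
    rewrite integral_mkcond [RHS]integral_mkcond; apply: eq_integral => t _.
    rewrite !patchE /= /fn indicE; case: (boolP (t \in I n.+1)) => tI.
      rewrite ifT ?mulr1// inE /= in_itv/= andbT.
      by move: tI; rewrite inE /I /= in_itv/= => /andP[].
    by rewrite mulr0; case: ifP.
  rewrite (@continuous_FTC2 _ f F) ?EFinB//.
  - exact: continuous_subspaceT.
  - split; first by move=> t _; case: (Ff t).
    + by apply: cvg_at_right_filter; exact: cF.
    + by apply: cvg_at_left_filter; exact: cF.
  - by move=> t _; rewrite derive1E; case: (Ff t).
have i4 : (\int[lam]_(t in half_line) (EFin \o fn n.+1) t)%E @[n --> \oo] -->
    (\int[lam]_(t in half_line) (f t)%:E)%E.
  by rewrite (cvg_shiftS (fun n => \int[lam]_(t in half_line) (EFin \o fn n) t)%E).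
have i5 : ((F n.+1%:R - F 0)%:E : \bar R) @[n --> \oo] --> ((l - F 0)%:E : \bar R).
  apply: cvg_EFin; first exact: nearW.
  by apply: cvgB; [rewrite (cvg_shiftS (fun n => F n%:R))|exact: cvg_cst].
have -> : l - F 0 = fine (l - F 0)%:E by [].
rewrite /Rintegral; congr fine; rewrite -(cvg_lim (@ereal_hausdorff R) i4).
rewrite -(cvg_lim (@ereal_hausdorff R) i5); congr (limn _); apply/funext => n.
exact: E.
Unshelve. all: by end_near. Qed.

Definition sinh t : R := (expR t - expR (- t)) / 2.

Let is_derive_expRN t : is_derive t 1 (fun t => expR (- t)) (- expR (- t)).
Proof.
have := @is_derive1_comp _ expR (fun t => - t) t _ _ (is_derive_expR _) (is_deriveNid t 1).
by move/is_derive_conv; apply => //; rewrite mulrN1.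
Qed.

Let is_deriveMc (f : R -> R) t (df c : R) : is_derive t 1 f df ->
  is_derive t 1 (fun t => f t * c) (df * c).
Proof.
move=> d; have := is_deriveM d (is_derive_cst c t (1 : R)).
by move/is_derive_conv; apply => //; rewrite /GRing.scale/= mulr0 add0r mulrC.
Qed.

Lemma is_derive_cosh t : is_derive t 1 (@cosh R) (sinh t).
Proof. exact: is_deriveMc (is_deriveD (is_derive_expR t) (is_derive_expRN t)). Qed.

Lemma is_derive_sinh t : is_derive t 1 sinh (cosh t).
Proof.
have := is_deriveMc 2^-1 (is_deriveB (is_derive_expR t) (is_derive_expRN t)).
by move/is_derive_conv; apply => //; rewrite opprK.
Qed.

Let derivable_continuous (f df : R -> R) : (forall t : R, is_derive t 1 f (df t)) -> continuous f.
Proof.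
by move=> d t; apply: differentiable_continuous; apply/derivable1_diffP; case: (d t).
Qed.

Lemma cosh_continuous : continuous (@cosh R).
Proof. exact: derivable_continuous is_derive_cosh. Qed.

Let cosh_gt0 t : 0 < cosh t.
Proof. by rewrite /cosh divr_gt0// addr_gt0 ?expR_gt0. Qed.

Lemma cosh_sqr t : cosh t ^+ 2 = 1 + sinh t ^+ 2.
Proof.
have := expRxMexpNx_1 t; rewrite /cosh /sinh.
move: (expR t) (expR (- t)) => A B AB.
have -> : ((A + B) / 2) ^+ 2 = A * B + ((A - B) / 2) ^+ 2 by field.
by rewrite AB.
Qed.

Lemma cosh_ge1 t : 1 <= cosh t.
Proof.
have : 1 ^+ 2 <= cosh t ^+ 2 by rewrite cosh_sqr expr1n lerDl sqr_ge0.
by rewrite ler_sqr// nnegrE ltW.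
Qed.

(** This follows from exp s >= 1 + s^2/2, and allows one factor cosh t to be traded for the
    integrable function 1/(1 + t^2). *)
Lemma cosh_ge_onesq t : 1 + t ^+ 2 <= 4 * cosh t.
Proof.
have H (s : R) : 0 <= s -> 1 + s ^+ 2 <= 4 * cosh s.
  move=> s0; have := expR_ge1Dxn 1 s0; rewrite (_ : 2`! = 2%N)// => h.
  have : 1 + s ^+ 2 / 2 <= 2 * cosh s.
    have -> : 2 * cosh s = expR s + expR (- s) by rewrite /cosh; field.
    by apply: le_trans h _; rewrite lerDl expR_ge0.
  have := cosh_ge1 s; lra.
have [t0|/ltW t0] := leP 0 t; first exact: H.
have := H (- t); rewrite sqrrN oppr_ge0 => /(_ t0).
by rewrite /cosh opprK addrC [X in X / 2]addrC.
Qed.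

(** Powers of cosh t replace the cosh(m t) of K_m, so that differentiating in x just raises [m] by
    one. The two agree for m = 0 and 1, and [coshK 2] is (K_0 + K_2)/2. *)
Definition coshK m x : R :=
  \int[lam]_(t in half_line) (expR (- (x * cosh t)) * cosh t ^+ m).

Lemma besselK0E x : besselK 0 x = coshK 0 x.
Proof.
rewrite /besselK /coshK; apply: eq_Rintegral => t _.
by rewrite mul0r expr0 /cosh oppr0 expR0 divff.
Qed.

Lemma besselK1E x : besselK 1 x = coshK 1 x.
Proof. by rewrite /besselK /coshK; apply: eq_Rintegral => t _; rewrite mul1r expr1. Qed.

Let w m x t : R := expR (- (x * cosh t)) * cosh t ^+ m.

Let w_ge0 m x t : 0 <= w m x t.
Proof. by rewrite mulr_ge0 ?expR_ge0// exprn_ge0// ltW. Qed.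

Let is_derive_expxcosh x t :
  is_derive t 1 (fun t => expR (- (x * cosh t))) (- (x * sinh t) * expR (- (x * cosh t))).
Proof.
have d1 : is_derive t 1 (fun t => - (x * cosh t)) (- (x * sinh t)).
  exact: is_deriveN (is_deriveZ x (is_derive_cosh t)).
have := @is_derive1_comp _ expR (fun t => - (x * cosh t)) t _ _ (is_derive_expR _) d1.
by move/is_derive_conv; apply => //; rewrite mulrC.
Qed.

Let w_continuous m x : continuous (w m x).
Proof.
move=> t; apply: cvgM.
  exact: (derivable_continuous (is_derive_expxcosh x)).
by apply: (continuous_comp (f := @cosh R) (g := fun y => y ^+ m));
  [exact: cosh_continuous|exact: exprn_continuous].
Qed.

Definition coshK_bound m x : R := (m.+1)`!%:R / x ^+ m.+1 * 4.

(** Apply y^(m+1) exp(-y) <= (m+1)! at y = x cosh t: this has one more factor cosh t than [w], which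
    pays for 1 + t^2. *)
Let w_bound m x t : 0 < x -> w m x t <= coshK_bound m x * (1 + t ^+ 2)^-1.
Proof.
move=> x0; have xc : 0 <= x * cosh t by rewrite mulr_ge0// ltW.
have xm : 0 < x ^+ m.+1 by rewrite exprn_gt0.
have h : w m x t * cosh t <= (m.+1)`!%:R / x ^+ m.+1.
  rewrite ler_pdivlMr//; apply: le_trans (powMexpRN_le m.+1 xc).
  rewrite le_eqVlt; apply/orP; left; apply/eqP.
  by rewrite exprMn /w (exprSr (cosh t)); ring.
rewrite ler_pdivlMr; last by rewrite ltr_pwDl// sqr_ge0.
apply: (@le_trans _ _ (w m x t * (4 * cosh t))).
  by rewrite ler_wpM2l// cosh_ge_onesq.
by rewrite /coshK_bound; lra.
Qed.

Let integrable_onesqV (c : R) : lam.-integrable half_line (fun t => (c * (1 + t ^+ 2)^-1)%:E).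
Proof.
apply: (@integrableS _ _ _ _ setT) => //.
have cV : continuous (fun t : R => (1 + t ^+ 2)^-1) by exact: continuous_oneDsqrV.
have V0 (t : R) : 0 <= (1 + t ^+ 2)^-1 by rewrite invr_ge0 addr_ge0// sqr_ge0.
rewrite (_ : (fun t => _) = (fun t => c%:E * ((1 + t ^+ 2)^-1)%:E)%E)//.
apply: integrableZl => //; apply/integrableP; split.
  by apply/measurable_EFinP; exact: continuous_measurable_fun.
under eq_integral do rewrite gee0_abs ?lee_fin//.
rewrite ge0_symfun_integralT//; last by move=> t /=; rewrite sqrrN.
by rewrite -set_itvcy integral0y_oneDsqr -EFinM ltry.
Qed.

Let integrable_le (f g : R -> R) : continuous f -> (forall t, `|f t| <= g t) ->
  lam.-integrable half_line (EFin \o g) -> lam.-integrable half_line (EFin \o f).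
Proof.
move=> cf fg; apply: le_integrable => //.
  by apply/measurable_EFinP; apply: measurable_funTS; exact: continuous_measurable_fun.
by move=> t _ /=; rewrite lee_fin (le_trans (fg t))// ler_norm.
Qed.

Let w_integrable m x : 0 < x -> lam.-integrable half_line (EFin \o w m x).
Proof.
move=> x0; apply: integrable_le (integrable_onesqV (coshK_bound m x)) => //.
by move=> t; rewrite ger0_norm// w_bound.
Qed.

Lemma is_derive_coshK m x : 0 < x -> is_derive x 1 (coshK m) (- coshK m.+1 x).
Proof.
move=> x0.
have D (y t : R) : is_derive y 1 (fun y => w m y t) (- w m.+1 y t).
  have d1 : is_derive y 1 (fun y => - (y * cosh t)) (- cosh t).
    have := is_deriveN (is_deriveMc (cosh t) (is_derive_id y 1)).
    by move/is_derive_conv; apply => //; rewrite mul1r.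
  have := is_deriveMc (cosh t ^+ m)
    (@is_derive1_comp _ expR (fun y => - (y * cosh t)) y _ _ (is_derive_expR _) d1).
  by move/is_derive_conv; apply => //; rewrite /w exprS; ring.
(* For y in ]x/2, x + 1[ the integrand of the derivative is at most its value at y = x/2, which is a
   majorant independent of y. *)
have x2 : x / 2 < x by rewrite ltr_pdivrMr// ltr_pMr// ltr1n.
have xI : `]x / 2, (x + 1)[%classic x by rewrite /= in_itv/= x2 ltrDl ltr01.
have I0 y : `]x / 2, (x + 1)[%classic y -> 0 < y.
  by rewrite /= in_itv/= => /andP[+ _]; apply: lt_trans; rewrite divr_gt0.
pose G t := coshK_bound m.+1 (x / 2) * (1 + t ^+ 2)^-1.
have dE y t : partial1of2 (w m) y t = - w m.+1 y t.
  by rewrite partial1of2E; case: (D y t).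
have H1 y : `]x / 2, (x + 1)[%classic y -> lam.-integrable half_line (EFin \o w m y).
  by move=> /I0; exact: w_integrable.
have H2 y t : `]x / 2, (x + 1)[%classic y -> half_line t -> derivable (w m ^~ t) y 1.
  by move=> _ _; case: (D y t).
have G0 t : 0 <= G t.
  rewrite mulr_ge0 ?invr_ge0 ?addr_ge0 ?sqr_ge0// /coshK_bound.
  by rewrite mulr_ge0// divr_ge0// exprn_ge0// divr_ge0// ltW.
have GI : lam.-integrable half_line (EFin \o G) by exact: integrable_onesqV.
have Gub y t : `]x / 2, (x + 1)[%classic y -> half_line t -> `|partial1of2 (w m) y t| <= G t.
  move=> /= /[dup] /I0 y0; rewrite in_itv/= => /andP[xy _] _.
  rewrite dE normrN ger0_norm//.
  apply: (@le_trans _ _ (w m.+1 (x / 2) t)).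
    rewrite ler_wpM2r ?exprn_ge0 ?(ltW (cosh_gt0 t))// ler_expR lerN2 ler_wpM2r ?(ltW (cosh_gt0 t))//.
    exact: ltW.
  by apply: w_bound; rewrite divr_gt0.
have := @derivable_under_integral R _ _ lam (w m) half_line mhalf _ _ _ xI H1 H2 G G0 GI Gub.
have := @differentiation_under_integral R _ _ lam (w m) half_line mhalf _ _ _ xI H1 H2 G G0 GI Gub.
rewrite derive1E => E dx; split; first exact: dx.
rewrite [LHS]E.
under eq_Rintegral do rewrite dE -mulN1r.
by rewrite RintegralZl ?mulN1r//; exact: w_integrable.
Qed.

Let open_pos : open [set x : R | 0 < x].
Proof. exact: open_gt. Qed.

Lemma coshK_smooth m : smooth_on [set x : R | 0 < x] (coshK m).
Proof.
move=> n; elim: n m => [//|n IH] m.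
apply: (@nderivableS _ _ open_pos n (coshK m) (fun x => - 1 * coshK m.+1 x)) => [x x0|].
  by rewrite mulN1r; exact: is_derive_coshK.
apply: nderivableM => //; exact: nderivable_cst.
Qed.

(** Since cosh t >= 1, exp(-(y - x) cosh t) is at most exp(-(y - x)). This is the source of the
    decay of the solution at infinity. *)
Lemma coshK_le_exp m x y : 0 < x -> x <= y -> coshK m y <= expR (x - y) * coshK m x.
Proof.
move=> x0 xy; rewrite /coshK -RintegralZl//; last exact: w_integrable.
have e0 := expR_ge0 (x - y).
apply: le_Rintegral => //; first exact: w_integrable (lt_le_trans x0 xy).
  rewrite (_ : _ \o _ = (fun t => (expR (x - y))%:E * (EFin \o w m x) t)%E)//.
  by apply: integrableZl => //; exact: w_integrable.
move=> t _; rewrite mulrA -expRD ler_wpM2r ?exprn_ge0 ?(ltW (cosh_gt0 t))// ler_expR.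
by have := cosh_ge1 t; nra.
Qed.

Lemma coshK_le m x : 0 < x -> coshK m x <= coshK m.+1 x.
Proof.
move=> x0; apply: le_Rintegral => //; [exact: w_integrable|exact: w_integrable|].
move=> t _; rewrite exprS ler_wpM2l ?expR_ge0// ler_peMl ?cosh_ge1//.
by rewrite exprn_ge0// ltW.
Qed.

(** By monotonicity in [m] the case m = 0 suffices; there the integrand is at least exp(-x e) on
    [0, 1], where cosh t <= e. *)
Lemma coshK_gt0 m x : 0 < x -> 0 < coshK m x.
Proof.
move=> x0; elim: m => [|m IH]; last exact: lt_le_trans IH (coshK_le m x0).
pose c := expR (- (x * expR 1)).
have m01 : measurable (`[0, 1]%classic : set R) by exact: measurable_itv.
have i01 : lam.-integrable half_line (EFin \o (fun t => c * \1_(`[0, 1]%classic : set R) t)).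
  apply: (@integrableS _ _ _ _ setT) => //.
  rewrite (_ : _ \o _ = (fun t => c%:E * (\1_(`[0, 1]%classic : set R) t)%:E)%E)//.
  apply: integrableZl => //; exact: integrable_indic_itv.
have : \int[lam]_(t in half_line) (c * \1_(`[0, 1]%classic : set R) t) <= coshK 0 x.
  apply: le_Rintegral => //; first exact: w_integrable.
  move=> t _; rewrite indicE expr0 mulr1; have [t01|t01] := boolP (t \in _); last first.
    by rewrite mulr0 expR_ge0.
  rewrite mulr1 ler_expR lerN2 ler_wpM2l ?(ltW x0)//.
  move: t01; rewrite inE/= in_itv/= => /andP[t0 t1].
  have e1 : expR t <= expR 1 by rewrite ler_expR.
  have e2 : expR (- t) <= expR 1 by rewrite ler_expR; lra.
  by rewrite /cosh; lra.
apply: lt_le_trans; rewrite RintegralZl//; last first.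
  by apply: (@integrableS _ _ _ _ setT) => //; exact: integrable_indic_itv.
rewrite mulr_gt0 ?expR_gt0// /Rintegral integral_indic//.
rewrite (_ : _ `&` _ = (`[0, 1]%classic : set R)); last first.
  apply/seteqP; split=> t /=; rewrite !in_itv/= ?andbT; first by case.
  by move=> /andP[t0 t1]; split => //; apply/andP.
have l01 : 0 < fine (lam (`[0, 1]%classic : set R)).
  by rewrite lebesgue_measure_itv/= lte_fin ltr01 oppr0 adde0.
exact: l01.
Qed.

(** This handles the boundary term at infinity in the next two lemmas. *)
Let expxcosh_cvg0 x (f : R -> R) c : 0 < x -> (forall t, 0 <= t -> `|f t| <= c * cosh t) ->
  f n%:R * expR (- (x * cosh n%:R)) @[n --> \oo] --> 0.
Proof.
move=> x0 fc.
have c0 : 0 <= c.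
  by have := le_trans (normr_ge0 _) (fc 0 (lexx 0)); rewrite pmulr_lge0.
pose k := c * coshK_bound 1 x.
apply: norm_cvg0; apply: (@squeeze_cvgr _ _ _ _ (cst 0) (fun n => k * n.+1%:R^-1)).
- near=> n; rewrite normr_ge0/= normrM (ger0_norm (expR_ge0 _)).
  apply: (@le_trans _ _ (c * w 1 x n%:R)).
    have -> : c * w 1 x n%:R = c * cosh n%:R * expR (- (x * cosh n%:R)).
      by rewrite /w expr1; ring.
    by rewrite ler_wpM2r ?expR_ge0//; exact: fc.
  rewrite /k -mulrA ler_wpM2l//; apply: le_trans (w_bound 1 n%:R x0) _.
  rewrite ler_wpM2l//.
    by rewrite /coshK_bound mulr_ge0// divr_ge0// exprn_ge0// ltW.
  rewrite lef_pV2 ?posrE// ?ltr_pwDl ?sqr_ge0// -natr1 addrC lerD2l.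
  have [->|n0] := eqVneq n 0%N; first by rewrite expr0n.
  by rewrite expr2 ler_peMl// ler1n lt0n.
- exact: cvg_cst.
- rewrite -[X in _ --> X](mulr0 k); apply: cvgM; first exact: cvg_cst.
  exact: cvg_harmonic.
Unshelve. all: by end_near. Qed.

(** Integrate the derivative of -sinh t exp(-x cosh t), which vanishes at both ends. As cosh^2 t =
    (1 + cosh 2t)/2, this is the classical x (K_2 - K_0) = 2 K_1. *)
Lemma coshK_recurrence x : 0 < x -> x * coshK 2 x = x * coshK 0 x + coshK 1 x.
Proof.
move=> x0.
have i2 := w_integrable 2 x0; have i1 := w_integrable 1 x0; have i0 := w_integrable 0 x0.
have iZ m : lam.-integrable half_line (EFin \o (fun t => x * w m x t)).
  rewrite (_ : _ \o _ = (fun t => x%:E * (EFin \o w m x) t)%E)//.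
  by apply: integrableZl => //; exact: w_integrable.
have iB : lam.-integrable half_line (EFin \o (fun t => x * w 2 x t - x * w 0 x t)).
  rewrite (_ : _ \o _ = (fun t => (EFin \o (fun t => (x * w 2 x t)%R)) t - (EFin \o (fun t => (x * w 0 x t)%R)) t)%E)//.
  exact: integrableB.
pose F t := - (sinh t * expR (- (x * cosh t))).
pose f t := x * w 2 x t - x * w 0 x t - w 1 x t.
have Ff (t : R) : is_derive t 1 F (f t).
  have := is_deriveN (is_deriveM (is_derive_sinh t) (is_derive_expxcosh x t)).
  move/is_derive_conv; apply => //; rewrite /GRing.scale/= /f /w cosh_sqr; ring.
have fi : lam.-integrable half_line (EFin \o f).
  rewrite (_ : _ \o _ = (fun t => (EFin \o (fun t => (x * w 2 x t - x * w 0 x t)%R)) t - (EFin \o w 1 x) t)%E)//.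
  exact: integrableB.
have cf : continuous f.
  by move=> t; apply: cvgB; [apply: cvgB; apply: cvgM; (exact: cvg_cst || exact: w_continuous)|exact: w_continuous].
have Fl : F n%:R @[n --> \oo] --> 0.
  rewrite -oppr0; apply: cvgN; apply: (@expxcosh_cvg0 x sinh 1) => // t _.
  rewrite mul1r -(@ler_sqr _ _ (cosh t)) ?nnegrE ?(ltW (cosh_gt0 t))//.
  by rewrite real_normK ?num_real// cosh_sqr lerDr.
have := integral_derive_half_line Ff cf fi Fl.
rewrite /F /sinh oppr0 subrr mul0r mul0r oppr0 subr0 /f.
rewrite RintegralB// RintegralB// !RintegralZl//.
by rewrite -/(coshK 2 x) -/(coshK 0 x) -/(coshK 1 x) => h; lra.
Qed.

Lemma coshK1_upper x : 0 < x -> x * coshK 1 x <= (x + 2^-1) * coshK 0 x.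
Proof.
move=> x0.
(* [th t = tanh (t / 2)]: [th * sinh = cosh - 1] and [th' <= 1 / 2], so integrating
   the derivative of [th * exp (- x cosh)] gives the bound. *)
pose th t : R := (expR t - 1) / (expR t + 1).
have e1 t : 0 < expR t + 1 by rewrite addr_gt0 ?expR_gt0.
pose dth t : R := 2 * expR t / (expR t + 1) ^+ 2.
have Dth (t : R) : is_derive t 1 th (dth t).
  have d1 : is_derive t 1 (fun t => expR t - 1) (expR t).
    by have := is_deriveB (is_derive_expR t) (is_derive_cst (1 : R) t (1 : R));
      move/is_derive_conv; apply => //; rewrite subr0.
  have d2 : is_derive t 1 (fun t => expR t + 1) (expR t).
    by have := is_deriveD (is_derive_expR t) (is_derive_cst (1 : R) t (1 : R));
      move/is_derive_conv; apply => //; rewrite addr0.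
  have e1t := lt0r_neq0 (e1 t).
  have := is_deriveM d1 (@is_deriveV _ (fun t => expR t + 1) t _ 1 e1t d2).
  move/is_derive_conv; apply => //; rewrite /GRing.scale/= /dth.
  by field.
have iZ m : lam.-integrable half_line (EFin \o (fun t => x * w m x t)).
  rewrite (_ : _ \o _ = (fun t => x%:E * (EFin \o w m x) t)%E)//.
  by apply: integrableZl => //; exact: w_integrable.
have dth_ge0 t : 0 <= dth t by rewrite divr_ge0 ?exprn_ge0 ?mulr_ge0 ?expR_ge0 ?(ltW (e1 t)).
have dth_le t : dth t <= 2^-1.
  rewrite /dth ler_pdivrMr ?exprn_gt0//.
  by have := sqr_ge0 (expR t - 1); rewrite sqrrB sqrrD; lra.
have cdth : continuous dth.
  move=> t; apply: cvgM; first by apply: cvgM; [exact: cvg_cst|exact: continuous_expR].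
  apply: cvgV; first by rewrite expf_neq0// gt_eqF.
  by apply: cvgM; apply: cvgD; (exact: cvg_cst || exact: continuous_expR).
have id : lam.-integrable half_line (EFin \o (fun t => dth t * w 0 x t)).
  apply: integrable_le (w_integrable 0 x0).
    by move=> t; apply: cvgM; [exact: cdth|exact: w_continuous].
  move=> t; rewrite ger0_norm ?mulr_ge0// ler_piMl//.
  by rewrite (le_trans (dth_le t))//; lra.
pose F t := th t * expR (- (x * cosh t)).
pose f t := dth t * w 0 x t - (x * w 1 x t - x * w 0 x t).
have thE t : th t * sinh t = cosh t - 1.
  rewrite /th /sinh /cosh expRN.
  have := lt0r_neq0 (e1 t); have := lt0r_neq0 (expR_gt0 t) => h1 h2.
  by field; rewrite h1 h2.
have Ff (t : R) : is_derive t 1 F (f t).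
  have := is_deriveM (Dth t) (is_derive_expxcosh x t).
  move/is_derive_conv; apply => //; rewrite /GRing.scale/= /f /w.
  have -> : th t * (- (x * sinh t) * expR (- (x * cosh t))) =
    - (x * (th t * sinh t) * expR (- (x * cosh t))) by ring.
  by rewrite thE; ring.
have iB : lam.-integrable half_line (EFin \o (fun t => x * w 1 x t - x * w 0 x t)).
  rewrite (_ : _ \o _ = (fun t => (EFin \o (fun t => (x * w 1 x t)%R)) t - (EFin \o (fun t => (x * w 0 x t)%R)) t)%E)//.
  exact: integrableB.
have fi : lam.-integrable half_line (EFin \o f).
  rewrite (_ : _ \o _ = (fun t => (EFin \o (fun t => (dth t * w 0 x t)%R)) t - (EFin \o (fun t => (x * w 1 x t - x * w 0 x t)%R)) t)%E)//.
  exact: integrableB.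
have cf : continuous f.
  move=> t; apply: cvgB; first by apply: cvgM; [exact: cdth|exact: w_continuous].
  by apply: cvgB; apply: cvgM; (exact: cvg_cst || exact: w_continuous).
have Fl : F n%:R @[n --> \oo] --> 0.
  apply: (@expxcosh_cvg0 x th 1) => // t t0; rewrite mul1r (le_trans _ (cosh_ge1 t))//.
  have t1 : 1 <= expR t by rewrite -expR0 ler_expR.
  by rewrite /th ger0_norm ?divr_ge0 ?subr_ge0 ?(ltW (e1 t))// ler_pdivrMr//; lra.
have := integral_derive_half_line Ff cf fi Fl.
rewrite /F /th expR0 subrr !mul0r subr0 /f.
rewrite RintegralB// RintegralB// !RintegralZl//; try exact: w_integrable.
rewrite -/(coshK 0 x) -/(coshK 1 x) => h.
have : \int[lam]_(t in half_line) (dth t * w 0 x t) <= 2^-1 * coshK 0 x.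
  have <- : \int[lam]_(t in half_line) (2^-1 * w 0 x t) = 2^-1 * coshK 0 x.
    by rewrite RintegralZl//; exact: w_integrable.
  apply: le_Rintegral => //.
    rewrite (_ : _ \o _ = (fun t => (2^-1)%:E * (EFin \o w 0 x) t)%E)//.
    by apply: integrableZl => //; exact: w_integrable.
  by move=> t _; rewrite ler_wpM2r//; exact: w_ge0.
by move: h; lra.
Qed.

End bessel_second_kind.

Lemma derive1_near_eq {R : realType} (f g : R -> R) (x : R) :
  (\forall y \near x, f y = g y) -> derive1 f x = derive1 g x.
Proof. by move=> fg; rewrite !derive1E; exact: near_eq_derive. Qed.

(** * Extending profiles that are singular at the origin *)

Section smooth_extension.
Context {R : realType}.
Implicit Types (t l : R) (f : R -> R).

Notation pos := [set t : R | 0 < t].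

Lemma sqrt_smooth : smooth_on pos (@Num.sqrt R).
Proof.
have opos : open pos by exact: open_gt.
move=> n; elim: n => [//|n IH].
apply: (@nderivableS _ _ opos n Num.sqrt (fun t => (2 * Num.sqrt t)^-1)).
apply: nderivableV => //; first by move=> t t0; rewrite mulf_neq0// gt_eqF// sqrtr_gt0.
by apply: nderivableM => //; exact: nderivable_cst.
Qed.

(** Multiply by a step that is 0 below l/2 and 1 above l, so that the product is 0 wherever [f] may
    be singular. *)
Lemma smooth_extension f l : 0 < l -> smooth_on pos f ->
  exists2 g, smooth1 g & forall t, l < t -> g t = f t /\ derive1 g t = derive1 f t.
Proof.
move=> l0 sf; have opos : open pos by exact: open_gt.
pose st t := smooth_step (2 / l * t - 1).
have sst : smooth1 st.
  apply: (smooth_on_comp openT openT) => //; first exact: smooth_step_smooth.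
  apply: (smooth_onB openT); last exact: (smooth_on_cst openT).
  by apply: (smooth_onZ openT); exact: (smooth_on_id openT).
pose g t := st t * f t.
have gf t : l <= t -> g t = f t.
  move=> lt; rewrite /g /st smooth_step1 ?mul1r// lerBrDr mulrAC ler_pdivlMr//.
  by rewrite -[1 + 1]/2 ler_wpM2l.
exists g.
  move=> n; have -> : setT = pos `|` [set t | t < l / 2].
    apply/seteqP; split=> t // _; have [t0|t0] := ltP 0 t; first by left.
    by right; rewrite /= (le_lt_trans t0)// divr_gt0.
  apply: nderivable_setU.
    apply: (nderivableM opos); last exact: sf.
    by apply: nderivable_subset (sst n).
  have ol : open [set t | t < l / 2] by exact: open_lt.
  apply: (nderivable_ext ol (f := fun=> 0)); last exact: nderivable_cst.
  move=> t /= tl; rewrite /g /st smooth_step0 ?mul0r// subr_le0 mulrAC ler_pdivrMr//.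
  lra.
move=> t lt; split; first exact/gf/ltW.
by apply: derive1_near_eq; near=> s; apply/gf/ltW; near: s; exact: near_gtr.
Unshelve. all: by end_near. Qed.

End smooth_extension.

(** * K_0 and K_1 as functions of the squared radius *)

Section macdonald.
Context {R : realType} (k : R) (k0 : 0 < k).
Implicit Types (t : R) (m : nat).

Notation pos := [set t : R | 0 < t].

Definition macdonald m t : R := coshK m (Num.sqrt t / k).

Let sqk_gt0 t : 0 < t -> 0 < Num.sqrt t / k.
Proof. by move=> t0; rewrite divr_gt0// sqrtr_gt0. Qed.

Let is_derive_sqk t : 0 < t -> is_derive t 1 (fun t => Num.sqrt t / k) ((2 * k * Num.sqrt t)^-1).
Proof.
move=> t0; have := is_deriveM (is_derive1_sqrt t0) (is_derive_cst k^-1 t (1 : R)).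
move/is_derive_conv; apply => //; rewrite /GRing.scale/= mulr0 add0r.
have := lt0r_neq0 k0; have : Num.sqrt t != 0 by rewrite gt_eqF// sqrtr_gt0.
by move=> h1 h2; field; rewrite h1 h2.
Qed.

Lemma is_derive_macdonald m t : 0 < t ->
  is_derive t 1 (macdonald m) (- (macdonald m.+1 t / (2 * k * Num.sqrt t))).
Proof.
move=> t0; have := @is_derive1_comp _ (coshK m) _ t _ _ (is_derive_coshK m (sqk_gt0 t0)) (is_derive_sqk t0).
by move/is_derive_conv; apply => //; rewrite mulNr.
Qed.

Lemma macdonald_smooth m : smooth_on pos (macdonald m).
Proof.
have opos : open pos by exact: open_gt.
apply: (smooth_on_comp opos opos (f := coshK m)); first exact: sqk_gt0.
  exact: coshK_smooth.
by apply: (smooth_onM opos); [exact: sqrt_smooth|exact: smooth_on_cst].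
Qed.

Lemma macdonald_gt0 m t : 0 < t -> 0 < macdonald m t.
Proof. by move=> t0; rewrite coshK_gt0// sqk_gt0. Qed.

(** This is K_1(r/k)/r in the variable t = r^2, the factor multiplying x_i in the outer field. *)
Definition macdonald_ratio t := macdonald 1 t / Num.sqrt t.

Lemma macdonald_ratio_smooth : smooth_on pos macdonald_ratio.
Proof.
have opos : open pos by exact: open_gt.
apply: (smooth_onM opos); first exact: macdonald_smooth.
apply: (smooth_onV opos); last exact: sqrt_smooth.
by move=> t t0; rewrite gt_eqF// sqrtr_gt0.
Qed.

Lemma is_derive_macdonald0 t : 0 < t ->
  is_derive t 1 (macdonald 0) (- (macdonald_ratio t / (2 * k))).
Proof.
move=> t0; have := is_derive_macdonald 0 t0.
move/is_derive_conv; apply => //; rewrite /macdonald_ratio.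
have := lt0r_neq0 k0; have : Num.sqrt t != 0 by rewrite gt_eqF// sqrtr_gt0.
by move=> h1 h2; field; rewrite h1 h2.
Qed.

Lemma is_derive_macdonald_ratio t : 0 < t ->
  is_derive t 1 macdonald_ratio (- (macdonald 0 t / (2 * k * t)) - macdonald_ratio t / t).
Proof.
move=> t0; have s0 : Num.sqrt t != 0 by rewrite gt_eqF// sqrtr_gt0.
have := is_deriveM (is_derive_macdonald 1 t0) (@is_deriveV _ _ t _ 1 s0 (is_derive1_sqrt t0)).
move/is_derive_conv; apply => //; rewrite /GRing.scale/= /macdonald_ratio.
have kn := lt0r_neq0 k0.
(* The recurrence eliminates index 2, so that [macdonald 0] and [macdonald_ratio] have derivatives
   expressed by each other and themselves. *)
have E : macdonald 2 t = macdonald 0 t + macdonald 1 t * k / Num.sqrt t.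
  have := coshK_recurrence (sqk_gt0 t0); rewrite -/(macdonald 2 t) -/(macdonald 1 t) -/(macdonald 0 t).
  move=> /(congr1 (fun z => z * (k / Num.sqrt t))) h.
  apply: etrans (etrans h _); by field; rewrite kn s0.
have tE : t = Num.sqrt t ^+ 2 by rewrite sqr_sqrtr// ltW.
move: (macdonald 0 t) (macdonald 1 t) (macdonald 2 t) E => M0 M1 M2 ->.
by move: s0 tE; move: (Num.sqrt t) => s s0 ->; field; rewrite kn s0.
Qed.

(** In y = sqrt t / k the factor (1 + t)^3 is the polynomial (1 + k^2 y^2)^3, which exp(-y)
    dominates. *)
Lemma macdonald_tail m r : 0 < r -> exists C, forall t, r <= t -> macdonald m t * (1 + t) ^+ 3 <= C.
Proof.
move=> r0; have kn := lt0r_neq0 k0.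
have [c cP] := polyMexpRN_bounded ((1 + (k ^+ 2)%:P * 'X^2) ^+ 3).
exists (expR (Num.sqrt r / k) * macdonald m r * c) => t rt.
have t0 : 0 < t by exact: lt_le_trans rt.
have y0 : 0 <= Num.sqrt t / k by rewrite ltW// sqk_gt0.
have e : macdonald m t <= expR (Num.sqrt r / k - Num.sqrt t / k) * macdonald m r.
  by apply: coshK_le_exp; [exact: sqk_gt0|rewrite ler_pM2r ?invr_gt0// ler_wsqrtr].
have t1 : 0 <= (1 + t) ^+ 3 by rewrite exprn_ge0// addr_ge0// ltW.
apply: (le_trans (ler_wpM2r t1 e)); rewrite expRD.
have := cP _ y0; rewrite horner_exp hornerD hornerM !hornerC hornerXn.
have -> : k ^+ 2 * (Num.sqrt t / k) ^+ 2 = t.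
  by rewrite exprMn sqr_sqrtr ?ltW// exprVn mulrCA divff ?mulr1// expf_neq0.
rewrite normrM !ger0_norm ?expR_ge0// => h.
have M0 : 0 <= expR (Num.sqrt r / k) * macdonald m r.
  by rewrite mulr_ge0 ?expR_ge0// ltW// macdonald_gt0.
apply: le_trans (ler_wpM2l M0 h); rewrite le_eqVlt; apply/orP; left; apply/eqP.
ring.
Qed.

End macdonald.

(** * The radial profile *)

Section annulus_solution.
Context {R : realType} (fl fr a : R).
Hypotheses (fl0 : 0 < fl) (flr : fl < fr) (a0 : 0 < a).
Implicit Types (t : R).

Let k : R := Num.sqrt a.
Let qI : R := besselI 1 (fl / k) / besselI 0 (fl / k).
Let qK : R := besselK 1 (fr / k) / besselK 0 (fr / k).
Let W : R := fr ^+ 2 - fl ^+ 2.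

(** Continuity of S at fl and fr eliminates B and gives A W = fr c_K K_1(fr/k) - fl c_I I_1(fl/k).
    By the flux conditions the right-hand side is (1 - 2 k^2 A) q / k, whence A (W + 2 k q) = q / k,
    that is A = q / delta. *)
Definition profile_q : R := fr * qK + fl * qI.

Definition profile_delta : R := k * (W + 2 * k * profile_q).

Notation q := profile_q.
Notation delta := profile_delta.

Let k_gt0 : 0 < k. Proof. by rewrite sqrtr_gt0. Qed.

Let fr0 : 0 < fr. Proof. exact: lt_trans fl0 flr. Qed.

Let k2 : k ^+ 2 = a. Proof. by rewrite sqr_sqrtr// ltW. Qed.

Let W_gt0 : 0 < W.
Proof. by rewrite subr_gt0 ltr_pXn2r// nnegrE ltW. Qed.

Let K0_gt0 : 0 < besselK 0 (fr / k).
Proof. by rewrite besselK0E coshK_gt0// divr_gt0. Qed.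

Let I0_gt0 : 0 < besselI 0 (fl / k).
Proof. exact: besselI0_gt0. Qed.

Let qI_ge0 : 0 <= qI.
Proof. by rewrite /qI divr_ge0 ?(ltW I0_gt0)// besselI1_ge0// divr_ge0// ltW. Qed.

Let qI_le1 : qI <= 1.
Proof. by rewrite /qI ler_pdivrMr// mul1r besselI1_le_I0// divr_ge0// ltW. Qed.

Let qI_gap : fl * (1 - qI) <= k.
Proof.
have fk : 0 <= fl / k by rewrite divr_ge0// ltW.
have : fl / k * (1 - qI) <= 1.
  have -> : fl / k * (1 - qI) =
      fl / k * (besselI 0 (fl / k) - besselI 1 (fl / k)) / besselI 0 (fl / k).
    have y0 := lt0r_neq0 I0_gt0.
    by rewrite /qI; move: (fl / k) y0 => z y0; field.
  by rewrite ler_pdivrMr// mul1r besselI_gap.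
by rewrite mulrAC ler_pdivrMr// mul1r.
Qed.

Let qK_ge1 : 1 <= qK.
Proof.
rewrite /qK (ler_pdivlMr _ _ K0_gt0) mul1r besselK0E besselK1E.
exact: coshK_le (divr_gt0 fr0 k_gt0).
Qed.

Let qK_upper : fr * (qK - 1) <= k / 2.
Proof.
have := coshK1_upper (divr_gt0 fr0 k_gt0); rewrite -besselK0E -besselK1E.
rewrite -ler_pdivrMr// -mulrA -/qK => h.
have -> : fr * (qK - 1) = k * (fr / k * qK - fr / k) by field; exact: lt0r_neq0.
by rewrite ler_pM2l//; lra.
Qed.

Lemma profile_q_ge : fr <= q.
Proof.
have h1 : fr <= fr * qK by rewrite ler_peMr// ltW.
have h2 : 0 <= fl * qI by rewrite mulr_ge0// ltW.
by rewrite /q; lra.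
Qed.

Let q_gt0 : 0 < q.
Proof. exact: lt_le_trans fr0 profile_q_ge. Qed.

Lemma profile_delta_gt0 : 0 < delta.
Proof. by rewrite mulr_gt0// addr_gt0// !mulr_gt0. Qed.

Notation A := (q / delta).

(* [2 / (sqrt a * div s)] with [div s = 2 A] *)
Lemma profile_thickness : 2 / (k * (2 * A)) = 2 * k + W / q.
Proof.
have h1 := lt0r_neq0 k_gt0; have h2 := lt0r_neq0 q_gt0; have h3 := lt0r_neq0 profile_delta_gt0.
have -> : 2 / (k * (2 * A)) = delta / (k * q) by field; rewrite h1 h2 h3.
by rewrite /delta; field; rewrite h1 h2.
Qed.

Let thickness_excess :
  2 / (k * (2 * A)) - (fr - fl) = 2 * k + (fr - fl) * (fr + fl - q) / q.
Proof.
have h2 := lt0r_neq0 q_gt0.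
rewrite profile_thickness /W; by field; rewrite h2.
Qed.

(** From qI <= 1 and [qK_upper], q - (fr + fl) <= k/2; with q >= fr the excess is at least 2 k - (fr
    - fl) k / (2 fr), which is the stated constant. *)
Lemma profile_thickness_lower :
  (3 * fr + fl) / (2 * fr) * k <= 2 / (k * (2 * A)) - (fr - fl).
Proof.
rewrite thickness_excess.
have -> : (3 * fr + fl) / (2 * fr) * k = 2 * k - (fr - fl) * (k / 2) / fr.
  by field; exact: lt0r_neq0.
rewrite lerD2l -lerN2 opprK -mulNr -mulrN opprB.
have d0 : 0 <= fr - fl by rewrite subr_ge0 ltW.
have qu : q - (fr + fl) <= k / 2.
  have h : fl * qI <= fl by rewrite ler_piMr// ltW.
  move: h qK_upper; rewrite /profile_q mulrBr mulr1.
  by move: (fl * qI) (fr * qK) => x y; lra.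
apply: (@le_trans _ _ ((fr - fl) * (k / 2) / q)).
  by rewrite ler_pM2r ?invr_gt0// ler_wpM2l.
rewrite ler_wpM2l ?lef_pV2 ?posrE ?profile_q_ge//.
by rewrite mulr_ge0// divr_ge0// ltW.
Qed.

(** From qK >= 1 and [qI_gap], fr + fl - q <= k; with q >= fl the excess is at most 2 k + X for X =
    (fr - fl) k / fl, while the stated bound equals 2 k + 2 X. *)
Lemma profile_thickness_upper :
  2 / (k * (2 * A)) - (fr - fl) <= 2 * (fr / fl) * k.
Proof.
rewrite thickness_excess.
have d0 : 0 <= fr - fl by rewrite subr_ge0 ltW.
have qu : fr + fl - q <= k.
  have h : fr <= fr * qK by rewrite ler_peMr// ltW.
  move: h qI_gap; rewrite /profile_q mulrBr mulr1.
  by move: (fl * qI) (fr * qK) => x y; lra.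
have : (fr - fl) * (fr + fl - q) / q <= (fr - fl) * k / fl.
  apply: (@le_trans _ _ ((fr - fl) * k / q)).
    by rewrite ler_pM2r ?invr_gt0// ler_wpM2l.
  rewrite ler_wpM2l ?lef_pV2 ?posrE//; first by rewrite mulr_ge0// ltW.
  exact: le_trans (ltW flr) profile_q_ge.
have -> : 2 * (fr / fl) * k = 2 * k + 2 * ((fr - fl) * k / fl) by field; exact: lt0r_neq0.
have : 0 <= (fr - fl) * k / fl by rewrite divr_ge0 ?mulr_ge0// ltW.
lra.
Qed.

(** In each region the [profile_] function is the h with S(r) = r h(r^2), and the [flux_] function
    is G, both in the variable t = r^2. *)
Definition profile_inner t : R :=
  - (W / delta / besselI 0 (fl / k) / (2 * k)) * besselJ 1 ((4 * a)^-1 * t).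

Definition flux_inner t : R :=
  - (W * k / delta / besselI 0 (fl / k)) * besselJ 0 ((4 * a)^-1 * t).

Definition profile_B : R := - (fl * fr * (fl * qK + fr * qI) / delta).

Definition profile_middle t : R := A + profile_B * t^-1.

Definition flux_middle : R := - (W * k / delta).

Definition profile_outer t : R := W / delta / besselK 0 (fr / k) * macdonald_ratio k t.

Definition flux_outer t : R := - (W * k / delta / besselK 0 (fr / k)) * macdonald k 0 t.

Let is_derive_besselJ_scaled m t :
  is_derive t 1 (fun t => besselJ m ((4 * a)^-1 * t)) (besselJ m.+1 ((4 * a)^-1 * t) / (4 * a)).
Proof.
have d : is_derive t 1 (fun t : R => (4 * a)^-1 * t) (4 * a)^-1.
  have := is_deriveZ (4 * a)^-1 (is_derive_id t (1 : R)).
  by move/is_derive_conv; apply => //; rewrite /GRing.scale/= mulr1.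
exact: (@is_derive1_comp _ (besselJ m) _ t _ _ (is_derive_besselJ m _) d).
Qed.

(** As the gradient of G(r^2) is 2 x_j G'(r^2), the relation G' = h/2 makes it the field x_j
    h(r^2). *)
Lemma flux_inner_derive t : is_derive t 1 flux_inner (profile_inner t / 2).
Proof.
have := is_deriveZ (- (W * k / delta / besselI 0 (fl / k))) (is_derive_besselJ_scaled 0 t).
move/is_derive_conv; apply => //; rewrite /GRing.scale/= /profile_inner -k2.
have h1 := lt0r_neq0 k_gt0; have h2 := lt0r_neq0 I0_gt0; have h3 := lt0r_neq0 profile_delta_gt0.
by field; rewrite h1 h2 h3.
Qed.

Let is_derive_profile_inner t : is_derive t 1 profile_inner
  (- (W / delta / besselI 0 (fl / k) / (2 * k)) * (besselJ 2 ((4 * a)^-1 * t) / (4 * a))).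
Proof. exact: is_deriveZ (is_derive_besselJ_scaled 1 t). Qed.

(** The divergence of x h(r^2) is 2 (h + t h') at t = r^2. *)
Lemma profile_inner_ode t :
  2 * a * (profile_inner t + t * derive1 profile_inner t) = flux_inner t.
Proof.
rewrite derive1E (@derive_val _ _ _ _ _ _ _ (is_derive_profile_inner t)).
rewrite /profile_inner /flux_inner besselJ_recurrence -k2.
have h1 := lt0r_neq0 k_gt0; have h2 := lt0r_neq0 I0_gt0; have h3 := lt0r_neq0 profile_delta_gt0.
by field; rewrite h1 h2 h3.
Qed.

Lemma profile_inner_smooth : smooth1 profile_inner.
Proof.
apply: (smooth_onZ openT); apply: (smooth_on_comp openT openT) => //; first exact: besselJ_smooth.
by apply: (smooth_onZ openT); exact: (smooth_on_id openT).
Qed.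

Lemma flux_inner_smooth : smooth1 flux_inner.
Proof.
apply: (smooth_onZ openT); apply: (smooth_on_comp openT openT) => //; first exact: besselJ_smooth.
by apply: (smooth_onZ openT); exact: (smooth_on_id openT).
Qed.

Notation pos := [set t : R | 0 < t].

Let opos : open pos. Proof. exact: open_gt. Qed.

Lemma profile_middle_smooth : smooth_on pos profile_middle.
Proof.
apply: (smooth_onD opos); first exact: smooth_on_cst.
apply: (smooth_onZ opos); apply: (smooth_onV opos); last exact: smooth_on_id.
by move=> t t0; rewrite gt_eqF.
Qed.

Lemma flux_middleE : flux_middle + 1 = a * (2 * A).
Proof.
have h1 := lt0r_neq0 k_gt0; have := lt0r_neq0 profile_delta_gt0.
rewrite /flux_middle -k2 /delta mulf_eq0 negb_or => /andP[_ h3].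
by field; rewrite h1 h3.
Qed.

Lemma profile_middle_ode t : 0 < t ->
  2 * a * (profile_middle t + t * derive1 profile_middle t) = flux_middle + 1.
Proof.
move=> t0; have t1 := lt0r_neq0 t0.
have d : is_derive t 1 profile_middle (- profile_B * t^-2).
  have := is_deriveD (is_derive_cst A t (1 : R))
    (is_deriveZ profile_B (@is_deriveV _ id t _ 1 t1 (is_derive_id t 1))).
  move/is_derive_conv; apply => //.
  by rewrite add0r /GRing.scale/=; ring.
rewrite derive1E (@derive_val _ _ _ _ _ _ _ d) /profile_middle flux_middleE.
have e (x y : R) : x + y / t + t * (- y / t ^+ 2) = x by field.
by rewrite e; ring.
Qed.

Lemma profile_outer_smooth : smooth_on pos profile_outer.
Proof. by apply: (smooth_onZ opos); exact: macdonald_ratio_smooth. Qed.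

Lemma flux_outer_smooth : smooth_on pos flux_outer.
Proof. by apply: (smooth_onZ opos); exact: macdonald_smooth. Qed.

Lemma flux_outer_derive t : 0 < t -> is_derive t 1 flux_outer (profile_outer t / 2).
Proof.
move=> t0; have := is_deriveZ (- (W * k / delta / besselK 0 (fr / k))) (is_derive_macdonald0 k_gt0 t0).
move/is_derive_conv; apply => //; rewrite /GRing.scale/= /profile_outer.
have h1 := lt0r_neq0 k_gt0; have h2 := lt0r_neq0 K0_gt0; have h3 := lt0r_neq0 profile_delta_gt0.
by field; rewrite h1 h2 h3.
Qed.

Let is_derive_profile_outer t : 0 < t -> is_derive t 1 profile_outer
  (W / delta / besselK 0 (fr / k) * (- (macdonald k 0 t / (2 * k * t)) - macdonald_ratio k t / t)).
Proof. by move=> t0; exact: is_deriveZ (is_derive_macdonald_ratio k_gt0 t0). Qed.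

Lemma profile_outer_ode t : 0 < t ->
  2 * a * (profile_outer t + t * derive1 profile_outer t) = flux_outer t.
Proof.
move=> t0; rewrite derive1E (@derive_val _ _ _ _ _ _ _ (is_derive_profile_outer t0)).
rewrite /profile_outer /flux_outer -k2.
have h1 := lt0r_neq0 k_gt0; have h2 := lt0r_neq0 K0_gt0; have h3 := lt0r_neq0 profile_delta_gt0.
by field; rewrite h1 h2 h3 gt_eqF.
Qed.

Let sqrt_sqr (x : R) : 0 < x -> Num.sqrt (x ^+ 2) = x.
Proof. by move=> x0; rewrite sqrtr_sqr gtr0_norm. Qed.

Let macdonald_besselK0 r : 0 < r -> macdonald k 0 (r ^+ 2) = besselK 0 (r / k).
Proof. by move=> r0; rewrite besselK0E /macdonald sqrt_sqr. Qed.

Let macdonald_ratio_besselK1 r : 0 < r -> r * macdonald_ratio k (r ^+ 2) = besselK 1 (r / k).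
Proof.
move=> r0; rewrite besselK1E /macdonald_ratio /macdonald sqrt_sqr// mulrC divfK//.
exact: lt0r_neq0.
Qed.

Let besselJ1_sqr r : r / (2 * k) * besselJ 1 ((4 * a)^-1 * r ^+ 2) = besselI 1 (r / k).
Proof.
have h1 := lt0r_neq0 k_gt0.
rewrite besselI1E -k2; congr (_ * besselJ 1 _); by field.
Qed.

Let besselJ0_sqr r : besselJ 0 ((4 * a)^-1 * r ^+ 2) = besselI 0 (r / k).
Proof.
have h1 := lt0r_neq0 k_gt0.
by rewrite besselI0E -k2; congr (besselJ 0 _); field.
Qed.

Lemma profile_innerE r : r * profile_inner (r ^+ 2) =
  - (W / delta * (besselI 1 (r / k) / besselI 0 (fl / k))).
Proof.
rewrite -besselJ1_sqr /profile_inner.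
have h1 := lt0r_neq0 k_gt0; have h2 := lt0r_neq0 I0_gt0; have h3 := lt0r_neq0 profile_delta_gt0.
by field; rewrite h1 h2 h3.
Qed.

Lemma profile_outerE r : 0 < r -> r * profile_outer (r ^+ 2) =
  W / delta * (besselK 1 (r / k) / besselK 0 (fr / k)).
Proof.
move=> r0; rewrite -(macdonald_ratio_besselK1 r0) /profile_outer.
have h1 := lt0r_neq0 k_gt0; have h2 := lt0r_neq0 K0_gt0; have h3 := lt0r_neq0 profile_delta_gt0.
by field; rewrite h2 h3.
Qed.

Lemma profile_middleE r : 0 < r -> r * profile_middle (r ^+ 2) =
  A * r - fl * fr * (fl * qK + fr * qI) / delta / r.
Proof.
move=> r0; rewrite /profile_middle /profile_B.
have h3 := lt0r_neq0 profile_delta_gt0; have h4 := lt0r_neq0 r0.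
by field; rewrite h3 h4.
Qed.

Lemma annulus_profileE r : 0 < r ->
  annulus_profile fl fr a r =
  r * piecewise3 (fl ^+ 2) (fr ^+ 2) profile_inner profile_middle profile_outer (r ^+ 2).
Proof.
move=> r0; rewrite /annulus_profile /piecewise3.
have -> : (r ^+ 2 <= fl ^+ 2) = (r <= fl) by rewrite ler_pXn2r// nnegrE ltW.
have -> : (r ^+ 2 < fr ^+ 2) = (r < fr) by rewrite ltr_pXn2r// nnegrE ltW.
case: ifP => _; first by rewrite profile_innerE.
by case: ifP => _; [rewrite profile_middleE|rewrite profile_outerE].
Qed.

Lemma profile_junction_inner : profile_inner (fl ^+ 2) = profile_middle (fl ^+ 2).
Proof.
have h1 := lt0r_neq0 fl0; have h3 := lt0r_neq0 profile_delta_gt0.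
apply: (mulfI h1); rewrite profile_innerE profile_middleE// -/qI /q /W.
by field; rewrite h1 h3.
Qed.

Lemma profile_junction_outer : profile_middle (fr ^+ 2) = profile_outer (fr ^+ 2).
Proof.
have h1 := lt0r_neq0 fr0; have h3 := lt0r_neq0 profile_delta_gt0.
apply: (mulfI h1); rewrite profile_middleE// profile_outerE// -/qK /q /W.
by field; rewrite h1 h3.
Qed.

Lemma flux_junction_inner : flux_inner (fl ^+ 2) = flux_middle.
Proof. by rewrite /flux_inner besselJ0_sqr mulNr divfK// gt_eqF. Qed.

Lemma flux_junction_outer : flux_middle = flux_outer (fr ^+ 2).
Proof. by rewrite /flux_outer macdonald_besselK0// mulNr divfK// gt_eqF. Qed.

Lemma profile_outer_tail : exists C, forall t, fr ^+ 2 <= t ->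
  [/\ `|profile_outer t| * (1 + t) ^+ 3 <= C, `|derive1 profile_outer t| * (1 + t) ^+ 3 <= C,
      `|flux_outer t| * (1 + t) ^+ 3 <= C & `|derive1 flux_outer t| * (1 + t) ^+ 3 <= C].
Proof.
have r2 : 0 < fr ^+ 2 by rewrite exprn_gt0.
have w1 t : 0 < t -> 0 <= (1 + t) ^+ 3 by move=> t0; apply/ltW/exprn_gt0/addr_gt0.
have [C0 C0P] := macdonald_tail k_gt0 0 r2.
have [C1 C1P] := macdonald_tail k_gt0 1 r2.
pose D1 := C1 / fr.
have R1P t : fr ^+ 2 <= t -> macdonald_ratio k t * (1 + t) ^+ 3 <= D1.
  move=> rt; have t0 := lt_le_trans r2 rt.
  have st : fr <= Num.sqrt t by rewrite -[fr]sqrt_sqr// ler_wsqrtr.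
  have m0 : 0 <= macdonald k 1 t * (1 + t) ^+ 3.
    exact: mulr_ge0 (ltW (macdonald_gt0 k_gt0 1 t0)) (w1 _ t0).
  rewrite /macdonald_ratio /D1 mulrAC; apply: (@le_trans _ _ (macdonald k 1 t * (1 + t) ^+ 3 / fr)).
    by rewrite ler_wpM2l// lef_pV2// posrE ?sqrtr_gt0.
  by rewrite ler_pM2r ?invr_gt0// C1P.
pose cK := besselK 0 (fr / k); pose c := W / delta / cK.
have c0 : 0 < c by rewrite !divr_gt0// profile_delta_gt0.
have D0 : 0 <= C0.
  apply: le_trans (C0P _ (lexx _)); exact: mulr_ge0 (ltW (macdonald_gt0 k_gt0 0 r2)) (w1 _ r2).
have D10 : 0 <= D1.
  apply: le_trans (R1P _ (lexx _)); apply: mulr_ge0 (w1 _ r2).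
  exact: divr_ge0 (ltW (macdonald_gt0 k_gt0 1 r2)) (sqrtr_ge0 _).
(* These bound the profile, its derivative and the flux; the derivative of the flux is half the
   profile. In [E2] the factor 1/fr^2 comes from 1/t. *)
pose E1 := c * D1; pose E2 := c * ((C0 / (2 * k) + D1) / fr ^+ 2); pose E3 := c * k * C0.
have E10 : 0 <= E1 by rewrite mulr_ge0// ltW.
have C0k : 0 <= C0 / (2 * k) + D1 by apply: addr_ge0 => //; rewrite divr_ge0// mulr_ge0// ltW.
have E20 : 0 <= E2 by apply: mulr_ge0; [exact: ltW|rewrite divr_ge0// ltW].
have E30 : 0 <= E3 by exact: mulr_ge0 (mulr_ge0 (ltW c0) (ltW k_gt0)) D0.
exists (E1 + E2 + E3) => t rt; have t0 := lt_le_trans r2 rt.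
have w0 : 0 < (1 + t) ^+ 3 by rewrite exprn_gt0// addr_gt0.
have s0 : 0 < macdonald_ratio k t by rewrite divr_gt0 ?sqrtr_gt0 ?macdonald_gt0.
have m0 : 0 < macdonald k 0 t by exact: macdonald_gt0.
have P1 : `|profile_outer t| * (1 + t) ^+ 3 <= E1.
  have -> : profile_outer t = c * macdonald_ratio k t by [].
  by rewrite (gtr0_norm (mulr_gt0 c0 s0)) -mulrA (ler_pM2l c0) R1P.
split.
- by apply: (le_trans P1); lra.
- rewrite derive1E (@derive_val _ _ _ _ _ _ _ (is_derive_profile_outer t0)) -/cK -/c.
  have -> : - (macdonald k 0 t / (2 * k * t)) - macdonald_ratio k t / t =
     - ((macdonald k 0 t / (2 * k) + macdonald_ratio k t) / t).
    have h1 := lt0r_neq0 k_gt0; have h2 := lt0r_neq0 t0.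
    by field; rewrite h1 h2.
  have k20 : 0 < 2 * k by rewrite mulr_gt0.
  have u0 : 0 < macdonald k 0 t / (2 * k) + macdonald_ratio k t.
    exact: addr_gt0 (divr_gt0 m0 k20) s0.
  rewrite mulrN normrN (gtr0_norm (mulr_gt0 c0 (divr_gt0 u0 t0))).
  suff : c * ((macdonald k 0 t / (2 * k) + macdonald_ratio k t) / t) * (1 + t) ^+ 3 <= E2 by lra.
  rewrite -mulrA (ler_pM2l c0) mulrAC; apply: (@le_trans _ _ ((C0 / (2 * k) + D1) / t)).
    rewrite ler_pM2r ?invr_gt0// mulrDl lerD ?R1P//.
    by rewrite mulrAC ler_pM2r ?invr_gt0 ?mulr_gt0// C0P.
  by rewrite ler_wpM2l ?lef_pV2.
- have -> : flux_outer t = - (c * k * macdonald k 0 t).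
    rewrite /flux_outer /c -/cK.
    have h1 := lt0r_neq0 K0_gt0; have h2 := lt0r_neq0 profile_delta_gt0.
    by field; rewrite h1 h2.
  have ck0 := mulr_gt0 c0 k_gt0.
  rewrite normrN (gtr0_norm (mulr_gt0 ck0 m0)) -mulrA.
  have : c * k * (macdonald k 0 t * (1 + t) ^+ 3) <= E3 by rewrite (ler_pM2l ck0) C0P.
  by move: E10 E20; lra.
- rewrite derive1E (@derive_val _ _ _ _ _ _ _ (flux_outer_derive t0)).
  rewrite normrM (@ger0_norm _ 2^-1)//.
  have : 0 <= `|profile_outer t| * (1 + t) ^+ 3 by rewrite mulr_ge0// ltW.
  by move: P1; rewrite mulrAC; lra.
Qed.

End annulus_solution.

(** * The weak equation *)

Section L2_products.
Context {R : realType}.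
Notation mu := (leb2 R).
Implicit Types (f g h : R * R -> R) (E : set (R * R)).

Definition L2prod f g : R := \int[mu]_p (f p * g p).

Lemma L2prodC f g : L2prod f g = L2prod g f.
Proof. by apply: eq_Rintegral => p _; rewrite mulrC. Qed.

Lemma L2D f g : L2 f -> L2 g -> L2 (fun p => f p + g p).
Proof.
move=> Lf Lg; have L0 := L2_weight (0 : R).
have := L2B Lf (L2B L0 Lg); congr (L2 _); apply/funext => p.
by rewrite mul0r sub0r opprK.
Qed.

Lemma L2prodDl f g h : L2 f -> L2 g -> L2 h ->
  L2prod (fun p => f p + g p) h = L2prod f h + L2prod g h.
Proof.
move=> Lf Lg Lh; rewrite -RintegralD//; [|exact: L2_mul_integrable..].
by apply: eq_Rintegral => p _; rewrite mulrDl.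
Qed.

Lemma L2prodBl f g h : L2 f -> L2 g -> L2 h ->
  L2prod (fun p => f p - g p) h = L2prod f h - L2prod g h.
Proof.
move=> Lf Lg Lh; rewrite -RintegralB//; [|exact: L2_mul_integrable..].
by apply: eq_Rintegral => p _; rewrite mulrBl.
Qed.

Lemma L2prodZl c f g : L2 f -> L2 g -> L2prod (fun p => c * f p) g = c * L2prod f g.
Proof.
move=> Lf Lg; rewrite -RintegralZl//; last exact: L2_mul_integrable.
by apply: eq_Rintegral => p _; rewrite mulrA.
Qed.

Lemma L2prod_ae_eq f f' g : L2 f -> L2 f' -> L2 g -> {ae mu, forall p, f p = f' p} ->
  L2prod f g = L2prod f' g.
Proof.
move=> Lf Lf' Lg ff'; apply: Rintegral_ae_eq.
- by apply: measurable_funM; exact: L2_measurable.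
- by apply: measurable_funM; exact: L2_measurable.
- by apply: filterS ff' => p ->.
Qed.

Lemma L2prod_ge0 f : 0 <= L2prod f f.
Proof. by apply: Rintegral_ge0 => p _; rewrite -expr2 sqr_ge0. Qed.

Lemma L2prod_eq0 f : L2 f -> L2prod f f = 0 -> {ae mu, forall p, f p = 0}.
Proof.
move=> Lf /eqP; have /L2P[mf if2] := Lf.
rewrite /L2prod /Rintegral -(inj_eq (@EFin_inj _)) fineK; last first.
  by apply: integrable_fin_num => //; exact: L2_mul_integrable.
move=> /eqP E; have : {ae mu, forall p, setT p -> (f p ^+ 2)%:E = 0%E}.
  apply/ae_eq_integral_abs => //; first by apply/measurable_EFinP; exact: measurable_funX.
  rewrite -[RHS]E; apply: eq_integral => p _.
  by rewrite /= ger0_norm ?sqr_ge0// expr2.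
apply: filterS => p /(_ I) [] /eqP; rewrite sqrf_eq0 => /eqP //.
Qed.

Lemma L2_indicM E f : measurable E -> L2 f -> L2 (fun p => \1_E p * f p).
Proof.
move=> mE Lf; apply: L2_le (Lf).
  by apply: measurable_funM; [exact: measurable_indic|exact: L2_measurable].
by move=> p; rewrite normrM indicE ler_piMl//; case: (_ \in _); rewrite ?normr1 ?normr0.
Qed.

Lemma Rintegral_indicM E f : \int[mu]_(p in E) f p = \int[mu]_p (\1_E p * f p).
Proof.
rewrite Rintegral_mkcond; apply: eq_Rintegral => p _.
by rewrite patchE indicE; case: ifP => _; rewrite ?mul1r ?mul0r.
Qed.

End L2_products.

Lemma sum_ord2 {V : nmodType} (f : 'I_2 -> V) : \sum_(i < 2) f i = f 0 + f 1.
Proof. by rewrite big_ord_recl big_ord1; congr (f _ + f _); exact/val_inj. Qed.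

Lemma Rintegral_sum_ord2 {R : realType} (F : 'I_2 -> R * R -> R) :
  (forall i, (leb2 R).-integrable setT (EFin \o F i)) ->
  (leb2 R).-integrable setT (EFin \o (fun p => \sum_i F i p)) /\
  \int[leb2 R]_p (\sum_i F i p) = \sum_i \int[leb2 R]_p F i p.
Proof.
move=> iF; have i0 := iF 0; have i1 := iF 1.
have E : (fun p => \sum_i F i p) = (fun p => F 0 p + F 1 p).
  by apply/funext => p; rewrite sum_ord2.
rewrite E sum_ord2; split; last by rewrite RintegralD.
rewrite (_ : _ \o _ = (fun p => (EFin \o F 0%R) p + (EFin \o F 1%R) p)%E)//.
exact: integrableD.
Qed.

Section weak_form.
Context {R : realType} (Omega : set (R * R)).
Hypothesis mOmega : measurable Omega.
Hypothesis LOmega : L2 (\1_Omega : R * R -> R).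
Notation mu := (leb2 R).
Implicit Types (s t u : vfield R) (T g : 'I_2 -> 'I_2 -> R * R -> R) (a : R).

Let mOmegaC : measurable (~` Omega). Proof. exact: measurableC. Qed.

Definition weak_jacobian u g : Prop := forall i, weak_gradient (u i) (g i).

Lemma weak_jacobian_H1v u g : weak_jacobian u g -> H1v u.
Proof. by move=> ug i; split=> [|j]; [case: (ug i)|exists (g i j); case: (ug i)]. Qed.

Lemma H1v_weak_jacobian u : H1v u -> weak_jacobian u (fun i j => weak_partial j (u i)).
Proof. by move=> Hu i; exact: weak_gradient_weak_partial. Qed.

Lemma weak_jacobianB u g s T : weak_jacobian u g -> weak_jacobian s T ->
  weak_jacobian (fun i p => u i p - s i p) (fun i j p => g i j p - T i j p).
Proof.
move=> ug sT i; have [Lu ugi] := ug i; have [Ls sTi] := sT i.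
split; first exact: L2B.
move=> j; have [Lg gP] := ugi j; have [LT TP] := sTi j.
split=> [|phi tphi]; first exact: L2B.
have Lphi := decays_L2 (test_function_decays tphi).
have Ldphi := decays_L2 (test_function_decays (test_function_partial j tphi)).
rewrite -![\int[mu]_p _]/(L2prod _ _).
have := L2prodBl Lu Ls Ldphi; have := L2prodBl Lg LT Lphi.
rewrite /L2prod => -> ->; rewrite gP// TP//; ring.
Qed.

(* The weak formulation with the Jacobians [T] of [t] and [g] of [u] made
   explicit, written with global L^2 products. *)
Definition weak_identity a t T u g : Prop :=
  a * (\sum_i \sum_j L2prod (T i j) (g i j)) + \sum_i L2prod (t i) (fun p => \1_(~` Omega) p * u i p)
  = \sum_i L2prod \1_Omega (g i i).

Let L2_weak_jacobian u g i j : weak_jacobian u g -> L2 (u i) /\ L2 (g i j).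
Proof. by move=> /(_ i)[Lu /(_ j)[]]. Qed.

(** Replacing the chosen representatives [weak_partial] by given Jacobians changes the integrands
    only on null sets. *)
Lemma weak_solutionP a t T : weak_jacobian t T ->
  weak_solution setT Omega a t <-> forall u g, weak_jacobian u g -> weak_identity a t T u g.
Proof.
move=> tT.
have E u g : weak_jacobian u g ->
    (a * \int[mu]_(p in setT) frob_grad t u p + \int[mu]_(p in setT `\` Omega) dotv t u p
      = \int[mu]_(p in Omega) wdiv u p) <-> weak_identity a t T u g.
  move=> ug.
  have Lt i : L2 (t i) by case: (L2_weak_jacobian i 0 tT).
  have Lu i : L2 (u i) by case: (L2_weak_jacobian i 0 ug).
  have LT i j : L2 (T i j) by case: (L2_weak_jacobian i j tT).
  have Lg i j : L2 (g i j) by case: (L2_weak_jacobian i j ug).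
  have Ht := weak_jacobian_H1v tT; have Hu := weak_jacobian_H1v ug.
  pose T' i j := weak_partial j (t i); pose g' i j := weak_partial j (u i).
  have LT' i j : L2 (T' i j) by case: (weak_partialP j (Ht i)).
  have Lg' i j : L2 (g' i j) by case: (weak_partialP j (Hu i)).
  have TT' i j : {ae mu, forall p, T' i j p = T i j p}.
    by apply: weak_partial_ae_eq; case: (tT i).
  have gg' i j : {ae mu, forall p, g' i j p = g i j p}.
    by apply: weak_partial_ae_eq; case: (ug i).
  have P i j : L2prod (T' i j) (g' i j) = L2prod (T i j) (g i j).
    rewrite (L2prod_ae_eq (LT' i j) (LT i j) (Lg' i j) (TT' i j)).
    by rewrite L2prodC (L2prod_ae_eq (Lg' i j) (Lg i j) (LT i j) (gg' i j)) L2prodC.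
  have Q i : L2prod \1_Omega (g' i i) = L2prod \1_Omega (g i i).
    by rewrite L2prodC (L2prod_ae_eq (Lg' i i) (Lg i i) LOmega (gg' i i)) L2prodC.
  rewrite /weak_identity; under eq_bigr do under eq_bigr do rewrite -P.
  under [in X in _ <-> _ = X]eq_bigr do rewrite -Q.
  have -> : \int[mu]_(p in setT) frob_grad t u p = \sum_i \sum_j L2prod (T' i j) (g' i j).
    have H i := Rintegral_sum_ord2 (fun j => L2_mul_integrable (LT' i j) (Lg' i j)).
    have [_ ->] := Rintegral_sum_ord2 (fun i => (H i).1).
    by apply: eq_bigr => i _; exact: (H i).2.
  have -> : \int[mu]_(p in setT `\` Omega) dotv t u p =
      \sum_i L2prod (t i) (fun p => \1_(~` Omega) p * u i p).
    rewrite setTD Rintegral_indicM.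
    have [_ <-] := Rintegral_sum_ord2 (fun i => L2_mul_integrable (Lt i) (L2_indicM mOmegaC (Lu i))).
    apply: eq_Rintegral => p _; rewrite /dotv mulr_sumr; apply: eq_bigr => i _; ring.
  have -> : \int[mu]_(p in Omega) wdiv u p = \sum_i L2prod \1_Omega (g' i i).
    rewrite Rintegral_indicM.
    have [_ <-] := Rintegral_sum_ord2 (fun i => L2_mul_integrable LOmega (Lg' i i)).
    by apply: eq_Rintegral => p _; rewrite /wdiv mulr_sumr.
  by [].
split=> [[_ tP] u g ug|tP].
  by apply/E => //; apply: tP; exact: weak_jacobian_H1v ug.
split; first exact: weak_jacobian_H1v tT.
by move=> u Hu; apply/(E _ _ (H1v_weak_jacobian Hu)); apply: tP; exact: H1v_weak_jacobian.
Qed.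

Lemma weak_identity_unique a B t T s S : 0 < a -> 0 < B ->
  (forall p, Omega p -> ~ outside_box B p) -> weak_jacobian t T -> weak_jacobian s S ->
  (forall u g, weak_jacobian u g -> weak_identity a t T u g) ->
  (forall u g, weak_jacobian u g -> weak_identity a s S u g) -> ae_eq_vfield t s.
Proof.
move=> a0 B0 OB tT sS tP sP.
pose u i p := t i p - s i p; pose g i j p := T i j p - S i j p.
have ug : weak_jacobian u g by exact: weak_jacobianB.
have Lt i : L2 (t i) by case: (L2_weak_jacobian i 0 tT).
have Ls i : L2 (s i) by case: (L2_weak_jacobian i 0 sS).
have LT i j : L2 (T i j) by case: (L2_weak_jacobian i j tT).
have LS i j : L2 (S i j) by case: (L2_weak_jacobian i j sS).
have Lu i : L2 (u i) by case: (L2_weak_jacobian i 0 ug).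
have Lg i j : L2 (g i j) by case: (L2_weak_jacobian i j ug).
pose v i p := \1_(~` Omega) p * u i p.
have Lv i : L2 (v i) by exact: L2_indicM.
have E1 i j : L2prod (g i j) (g i j) = L2prod (T i j) (g i j) - L2prod (S i j) (g i j).
  exact: L2prodBl.
(* The indicator is its own square, so the zeroth-order term tested with the difference is a genuine
   squared norm. *)
have E2 i : L2prod (v i) (v i) = L2prod (t i) (v i) - L2prod (s i) (v i).
  rewrite -L2prodBl//; apply: eq_Rintegral => p _; rewrite /v /u indicE.
  by case: (_ \in _); rewrite ?mul1r// !mul0r mulr0.
have := tP u g ug; have := sP u g ug; rewrite /weak_identity.
have := L2prod_ge0 (v 0); have := L2prod_ge0 (v 1).
have := L2prod_ge0 (g 0 0); have := L2prod_ge0 (g 0 1).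
have := L2prod_ge0 (g 1 0); have := L2prod_ge0 (g 1 1).
rewrite !sum_ord2 -![fun p => \1_(~` Omega) p * u _ p]/(v _).
rewrite !E2 !E1 => p1 p2 p3 p4 p5 p6 e1 e2.
(* Subtracting the equations leaves a vanishing sum of nonnegative terms. From it the x-derivatives
   and the parts off Omega are extracted, which is the input of [L2_partial0_ae0]. *)
have [z0 [z1 [z2 z3]]] : [/\ L2prod (g 0 0) (g 0 0) = 0 & [/\ L2prod (g 1 0) (g 1 0) = 0 &
    [/\ L2prod (v 0) (v 0) = 0 & L2prod (v 1) (v 1) = 0]]].
  rewrite !E2 !E1; move: e1 e2 p1 p2 p3 p4 p5 p6.
  move: (L2prod (T 0 0) _) (L2prod (T 0 1) _) (L2prod (T 1 0) _) (L2prod (T 1 1) _).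
  move: (L2prod (S 0 0) _) (L2prod (S 0 1) _) (L2prod (S 1 0) _) (L2prod (S 1 1) _).
  move: (L2prod (t 0) _) (L2prod (t 1) _) (L2prod (s 0) _) (L2prod (s 1) _).
  move=> t0 t1 s0 s1 S00 S01 S10 S11 T00 T01 T10 T11 e1 e2 p1 p2 p3 p4 p5 p6.
  have e : a * ((T00 - S00) + (T01 - S01) + (T10 - S10) + (T11 - S11)) + (t0 - s0) + (t1 - s1) = 0.
    by move: e1 e2; lra.
  have q (x : R) : 0 <= x -> 0 <= a * x by move=> x0; rewrite mulr_ge0// ltW.
  have z (x : R) : 0 <= x -> a * x <= 0 -> x = 0.
    by move=> x0; rewrite pmulr_rle0// => xn; apply/eqP; rewrite eq_le xn x0.
  have := q _ p1; have := q _ p2; have := q _ p3; have := q _ p4 => q4 q3 q2 q1.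
  split; first by apply: z => //; lra.
  split; first by apply: z => //; lra.
  split; lra.
have L0 : L2 (fun=> 0 : R).
  have := L2_weight (0 : R); congr (L2 _); apply/funext => p; exact: mul0r.
have fin i : L2prod (g i 0) (g i 0) = 0 -> L2prod (v i) (v i) = 0 ->
    {ae mu, forall p, t i p = s i p}.
  move=> /(L2prod_eq0 (Lg i 0)) g0 /(L2prod_eq0 (Lv i)) v0.
  have : {ae mu, forall p, u i p = 0}.
    apply: (L2_partial0_ae0 (Lu i) B0).
      apply: filterS v0 => p; rewrite /v indicE; case: (boolP (p \in _)).
        by rewrite mul1r.
      by move=> /negP pO _ pB; exfalso; apply: pO; rewrite inE => /OB.
    move=> phi tphi; have [_ /(_ 0)[_ gP]] := ug i; rewrite gP//.
    have Lphi := decays_L2 (test_function_decays tphi).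
    rewrite -[\int[mu]_p _]/(L2prod _ _) (L2prod_ae_eq (Lg i 0) L0 Lphi g0).
    by rewrite -[RHS]oppr0; congr (- _); rewrite /L2prod; under eq_Rintegral do rewrite mul0r;
      rewrite Rintegral_cst// mul0r.
  by apply: filterS => p /eqP; rewrite /u subr_eq0 => /eqP.
have f0 := fin 0 z0 z2; have f1 := fin 1 z1 z3.
apply: filterS2 f0 f1 => p e0' e1' i.
by have [->|->] : i = 0 \/ i = 1 by case: i => -[|[|//]] ?; [left|right]; exact/val_inj.
Qed.

End weak_form.

(** * The explicit solution on the plane *)

Section annulus_field.
Context {R : realType} (fl fr a : R).
Hypotheses (fl0 : 0 < fl) (flr : fl < fr) (a0 : 0 < a).
Notation mu := (leb2 R).
Implicit Types (p : R * R) (i j : 'I_2).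

Notation Omega := (annulus fl fr).
Notation l := (fl ^+ 2).
Notation r := (fr ^+ 2).

Let fr0 : 0 < fr. Proof. exact: lt_trans flr. Qed.

Let l0 : 0 < l. Proof. by rewrite exprn_gt0. Qed.

Let lr : l < r. Proof. by rewrite ltr_pXn2r// nnegrE ltW. Qed.

Lemma annulusE p : Omega p = (l < sqn p < r) :> Prop.
Proof. by []. Qed.

Lemma open_annulus : open Omega.
Proof.
have cs : continuous (@sqn R).
  by move=> p; apply: cvgD; apply: cvgM; (exact: cvg_fst || exact: cvg_snd).
have -> : Omega = (@sqn R) @^-1` [set t | l < t] `&` (@sqn R) @^-1` [set t | t < r].
  by apply/seteqP; split=> p; rewrite annulusE => /andP.
by apply: openI; apply: open_comp; try (exact: open_gt || exact: open_lt); move=> p _; exact: cs.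
Qed.

Lemma measurable_annulus : measurable Omega.
Proof. exact: open_measurable2 open_annulus. Qed.

Lemma annulus_box p : Omega p -> ~ outside_box fr p.
Proof.
rewrite annulusE => /andP[_ pr] pB.
have sq (x : R) : fr < `|x| -> r < x ^+ 2.
  by move=> h; rewrite -[x ^+ 2]real_normK ?num_real// ltr_pXn2r// nnegrE ltW.
have s1 := sqr_ge0 p.1; have s2 := sqr_ge0 p.2; move: pr; rewrite /sqn.
by case: pB => /sq h pr; lra.
Qed.

Lemma L2_indic_annulus : L2 (\1_Omega : R * R -> R).
Proof.
apply: decays_L2; split; first exact: measurable_indic measurable_annulus.
exists ((1 + fr ^+ 2) * (1 + fr ^+ 2)) => p; rewrite indicE.
case: (boolP (p \in _)) => [|_].
  by rewrite inE normr1 => /annulus_box; exact: box_weight.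
rewrite normr0; apply: mulr_ge0; last exact/ltW/weight_gt0.
by apply: mulr_ge0; apply: addr_ge0 => //; exact: sqr_ge0.
Qed.

Definition radial_profile : R -> R :=
  piecewise3 l r (profile_inner fl fr a) (profile_middle fl fr a) (profile_outer fl fr a).

Definition radial_profile' : R -> R :=
  piecewise3 l r (derive1 (profile_inner fl fr a)) (derive1 (profile_middle fl fr a))
    (derive1 (profile_outer fl fr a)).

(** S(r) x_i / r written without dividing by r, so that it makes sense at the origin. *)
Definition annulus_field : vfield R := fun i p => pcoord i p * radial_profile (sqn p).

Definition annulus_jacobian i j p : R :=
  (i == j)%:R * radial_profile (sqn p) + 2 * pcoord i p * pcoord j p * radial_profile' (sqn p).

(* The function [a * div s - 1_Omega]; its gradient is the restriction of [s] to the
   complement of [Omega]. *)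
Definition annulus_flux p : R :=
  piecewise3 l r (flux_inner fl fr a) (fun=> flux_middle fl fr a) (flux_outer fl fr a) (sqn p).

Let half_l : 0 < l / 2 /\ l / 2 < l.
Proof. by split; [rewrite divr_gt0|rewrite ltr_pdivrMr// ltr_pMr// ltr1n]. Qed.

Let piecewise3_eq (f1 f2 f3 g1 g2 g3 : R -> R) t : (t <= l -> f1 t = g1 t) ->
  (l < t -> t < r -> f2 t = g2 t) -> (r <= t -> f3 t = g3 t) ->
  piecewise3 l r f1 f2 f3 t = piecewise3 l r g1 g2 g3 t.
Proof. by rewrite /piecewise3; case: (leP t l) => [tl -> //|tl]; case: (ltP t r) => tr h2 h3 h4; auto. Qed.

Lemma annulus_field_ibp i : ibp_field (annulus_field i) (annulus_jacobian i).
Proof.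
(* [ibp_glue] takes pieces smooth on the whole line, but the middle and outer profiles are singular
   at 0. They are replaced by extensions that agree with them beyond l/2; as l/2 < l, values and
   derivatives are correct up to and including the junctions. *)
have [hl0 hl] := half_l.
have [f2 s2 f2E] := smooth_extension hl0 (profile_middle_smooth fl fr a).
have [f3 s3 f3E] := smooth_extension hl0 (profile_outer_smooth fl fr a0).
have f2l t : l <= t -> f2 t = profile_middle fl fr a t /\ derive1 f2 t = derive1 (profile_middle fl fr a) t.
  by move=> lt; apply: f2E; exact: lt_le_trans lt.
have f3r t : r <= t -> f3 t = profile_outer fl fr a t /\ derive1 f3 t = derive1 (profile_outer fl fr a) t.
  by move=> rt; apply: f3E; apply: lt_le_trans rt; exact: lt_trans lr.
have [C CP] := profile_outer_tail fl0 flr a0.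
have g1 t : r <= t -> `|f3 t| * (1 + t) ^+ 3 <= C.
  by move=> rt; rewrite (f3r _ rt).1; case: (CP _ rt).
have g2 t : r <= t -> `|derive1 f3 t| * (1 + t) ^+ 3 <= C.
  by move=> rt; rewrite (f3r _ rt).2; case: (CP _ rt).
have j1 : profile_inner fl fr a l = f2 l.
  by rewrite (f2l _ (lexx _)).1 profile_junction_inner.
have j2 : f2 r = f3 r.
  by rewrite (f2l _ (ltW lr)).1 (f3r _ (lexx _)).1 profile_junction_outer.
have [_ /(_ i)] := ibp_glue l0 lr (profile_inner_smooth fl fr a) s2 s3 j1 j2 g1 g2.
congr (ibp_field _ _).
- apply/funext => p; congr (_ * _); apply: piecewise3_eq => // [/ltW/f2l[]|/f3r[]] //.
- apply/funext => j; apply/funext => p; congr (_ * _ + _ * _).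
  + by apply: piecewise3_eq => // [/ltW/f2l[]|/f3r[]].
  + by apply: piecewise3_eq => // [/ltW/f2l[]|/f3r[]].
Qed.

(** G is constant on Omega and satisfies 2 G' = h elsewhere, so its gradient is the field cut off by
    the indicator of the complement. *)
Lemma annulus_flux_ibp :
  ibp_field annulus_flux (fun j p => \1_(~` Omega) p * annulus_field j p).
Proof.
have [hl0 hl] := half_l.
have [f3 s3 f3E] := smooth_extension hl0 (flux_outer_smooth fl fr a0).
have f3r t : r <= t -> f3 t = flux_outer fl fr a t /\ derive1 f3 t = derive1 (flux_outer fl fr a) t.
  by move=> rt; apply: f3E; apply: lt_le_trans rt; exact: lt_trans lr.
have [C CP] := profile_outer_tail fl0 flr a0.
have g1 t : r <= t -> `|f3 t| * (1 + t) ^+ 3 <= C.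
  by move=> rt; rewrite (f3r _ rt).1; case: (CP _ rt).
have g2 t : r <= t -> `|derive1 f3 t| * (1 + t) ^+ 3 <= C.
  by move=> rt; rewrite (f3r _ rt).2; case: (CP _ rt).
have j1 : flux_inner fl fr a l = flux_middle fl fr a by exact: flux_junction_inner.
have j2 : flux_middle fl fr a = f3 r by rewrite (f3r _ (lexx _)).1 flux_junction_outer.
have [+ _] := ibp_glue l0 lr (flux_inner_smooth fl fr a)
  (smooth_on_cst openT (flux_middle fl fr a)) s3 j1 j2 g1 g2.
congr (ibp_field _ _).
- by apply/funext => p; apply: piecewise3_eq => // /f3r[].
- apply/funext => j; apply/funext => p.
  rewrite /annulus_field /radial_profile /piecewise3 indicE.
  have [pl|pl] := leP (sqn p) l.
    rewrite mem_set ?mul1r/=; last by rewrite /= annulusE => /andP[]; rewrite ltNge pl.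
    rewrite derive1E (@derive_val _ _ _ _ _ _ _ (flux_inner_derive fl0 flr a0 _)).
    by field.
  have [pr|pr] := ltP (sqn p) r.
    rewrite memNset; last by apply; rewrite annulusE pl pr.
    by rewrite derive1_cst mulr0 mul0r.
  rewrite mem_set ?mul1r/=; last by rewrite /= annulusE => /andP[_]; rewrite ltNge pr.
  rewrite (f3r _ pr).2 derive1E (@derive_val _ _ _ _ _ _ _ (flux_outer_derive fl0 flr a0 (lt_trans l0 pl))).
  by field.
Qed.

Lemma annulus_field_div p :
  a * (annulus_jacobian 0 0 p + annulus_jacobian 1 1 p) = annulus_flux p + \1_Omega p.
Proof.
have -> : a * (annulus_jacobian 0 0 p + annulus_jacobian 1 1 p) =
    2 * a * (radial_profile (sqn p) + sqn p * radial_profile' (sqn p)).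
  by rewrite /annulus_jacobian !eqxx /sqn /pcoord /=; ring.
rewrite /annulus_flux /radial_profile /radial_profile' /piecewise3 indicE.
have [pl|pl] := leP (sqn p) l.
  rewrite memNset ?addr0; last by rewrite annulusE => /andP[]; rewrite ltNge pl.
  exact: profile_inner_ode.
have [pr|pr] := ltP (sqn p) r.
  rewrite mem_set; last by rewrite /= annulusE pl pr.
  by apply: profile_middle_ode => //; exact: lt_trans pl.
rewrite memNset ?addr0; last by rewrite annulusE => /andP[_]; rewrite ltNge pr.
by apply: profile_outer_ode => //; exact: lt_trans pl.
Qed.

Lemma annulus_jacobian_div p : Omega p ->
  annulus_jacobian 0 0 p + annulus_jacobian 1 1 p =
  2 * (profile_q fl fr a / profile_delta fl fr a).
Proof.
move=> Op; apply: (mulfI (lt0r_neq0 a0)); rewrite annulus_field_div indicE mem_set//.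
move: Op; rewrite annulusE => /andP[pl pr].
rewrite /annulus_flux /piecewise3 leNgt pl/= pr.
exact: flux_middleE.
Qed.

Lemma annulus_weak_jacobian : weak_jacobian annulus_field annulus_jacobian.
Proof.
move=> i; split; first by case: (annulus_field_ibp i) => /decays_L2.
by move=> j; exact: ibp_field_is_weak_partial (annulus_field_ibp i).
Qed.

Lemma annulus_weak_identity u g : weak_jacobian u g ->
  weak_identity Omega a annulus_field annulus_jacobian u g.
Proof.
move=> ug; rewrite /weak_identity !sum_ord2.
have Lg i j : L2 (g i j) by case: (ug i) => _ /(_ j)[].
have LJ i j : L2 (annulus_jacobian i j) by case: (annulus_weak_jacobian i) => _ /(_ j)[].
have JC : annulus_jacobian 0 1 = annulus_jacobian 1 0.
  by apply/funext => p; rewrite /annulus_jacobian /=; ring.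
(* Row 1 of the Jacobian is paired with the gradient of u_0, and row 0 with that of u_1; after J_01
   = J_10 this turns each off-diagonal term of the Frobenius product into a diagonal derivative of
   u. *)
have [_ _ /(_ _ _ (ug 0))[_ /(_ 0 1) e0]] := annulus_field_ibp 1.
have [_ _ /(_ _ _ (ug 1))[_ /(_ 1 0) e1]] := annulus_field_ibp 0.
have [dF _ FP] := annulus_flux_ibp.
have LF : L2 annulus_flux by exact: decays_L2.
(* The trace of the Jacobian against d_i u_i: a tr J is G + 1_Omega, and integrating G by parts
   yields minus the field off Omega against u_i. *)
have f i : a * (L2prod (annulus_jacobian 0 0) (g i i) + L2prod (annulus_jacobian 1 1) (g i i)) =
    - L2prod (annulus_field i) (fun p => \1_(~` Omega) p * u i p) + L2prod \1_Omega (g i i).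
  have LD : L2 (fun p => annulus_jacobian 0 0 p + annulus_jacobian 1 1 p).
    exact: L2D.
  rewrite -L2prodDl// -L2prodZl//.
  have [/(_ i) h _] := FP _ _ (ug i).
  have -> : L2prod (annulus_field i) (fun p => \1_(~` Omega) p * u i p) =
      - L2prod annulus_flux (g i i).
    by rewrite -h; apply: eq_Rintegral => p _; ring.
  rewrite opprK -L2prodDl//; last exact: L2_indic_annulus.
  by apply: eq_Rintegral => p _; rewrite annulus_field_div.
have := f 0; have := f 1.
move: e0 e1; rewrite -![\int[mu]_p (_ * _)]/(L2prod _ _) JC => -> -> f1 f0.
by move: f0 f1; lra.
Qed.

End annulus_field.

(** * Thickness of the annulus *)

Section annulus_thickness.
Context {R : realType} (fl fr : R).
Hypotheses (fl0 : 0 < fl) (flr : fl < fr).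
Implicit Types (p c : R * R) (rho : R).

Notation Omega := (annulus fl fr).

Let fr0 : 0 < fr. Proof. exact: lt_trans flr. Qed.

Let ltr_sqr (x y : R) : 0 <= x -> 0 <= y -> (x ^+ 2 < y ^+ 2) = (x < y).
Proof. by move=> x0 y0; rewrite ltr_pXn2r. Qed.

(** The origin is outside the annulus, so rho < |c|. The two points of the ball on the line through
    the origin and c have norms |c| + rho and |c| - rho, which must lie between fl and fr. *)
Lemma ball_in_annulus_radius c rho : 0 < rho -> euclid_closed_ball c rho `<=` Omega ->
  2 * rho <= fr - fl.
Proof.
move=> rho0 cO; set n := Num.sqrt (sqn c).
have n2 : n ^+ 2 = sqn c by rewrite sqr_sqrtr// sqn_ge0.
have n0 : 0 <= n by exact: sqrtr_ge0.
have rn : rho < n.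
  rewrite ltNge; apply/negP => nrho.
  have : Omega (0, 0).
    apply: cO; rewrite /euclid_closed_ball/= !sub0r !sqrrN -/(sqn c) -n2.
    by rewrite ler_pXn2r// nnegrE ltW.
  by rewrite annulusE /sqn/= !expr0n/= addr0 => /andP[+ _]; rewrite ltNge sqr_ge0.
have np : n != 0 by rewrite gt_eqF// (lt_trans rho0).
have pt (e : R) : e ^+ 2 = 1 -> fl ^+ 2 < (n + e * rho) ^+ 2 < fr ^+ 2.
  move=> e1; have : Omega (c.1 + e * rho / n * c.1, c.2 + e * rho / n * c.2).
    apply: cO; rewrite /euclid_closed_ball/=.
    have -> : (c.1 + e * rho / n * c.1 - c.1) ^+ 2 + (c.2 + e * rho / n * c.2 - c.2) ^+ 2 =
        e ^+ 2 * rho ^+ 2 * (sqn c / n ^+ 2) by rewrite /sqn; field.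
    by rewrite -n2 divff ?expf_neq0// e1 mul1r mulr1.
  have E : sqn (c.1 + e * rho / n * c.1, c.2 + e * rho / n * c.2) = (n + e * rho) ^+ 2.
    transitivity ((1 + e * rho / n) ^+ 2 * sqn c); first by rewrite /sqn/=; ring.
    by rewrite -n2 -exprMn; congr (_ ^+ 2); field.
  by rewrite annulusE E.
have /andP[_ h1] := pt 1 (expr1n _ _).
have /andP[h2 _] : fl ^+ 2 < (n + -1 * rho) ^+ 2 < fr ^+ 2 by apply: pt; rewrite sqrrN expr1n.
have n1 : 0 <= n - rho by rewrite subr_ge0 ltW.
have n3 : 0 <= n + rho by rewrite addr_ge0// ltW.
move: h1 h2; rewrite mul1r mulN1r (ltr_sqr n3 (ltW fr0)) (ltr_sqr (ltW fl0) n1).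
lra.
Qed.

(** The supremum is not attained, since the annulus is open. It is approached by balls centred on
    the middle circle in the direction of [p], of radius slightly below (fr - fl)/2. *)
Lemma thickness_annulus p : Omega p -> thickness Omega p = fr - fl.
Proof.
rewrite annulusE => /andP[]; set n := Num.sqrt (sqn p).
have n2 : n ^+ 2 = sqn p by rewrite sqr_sqrtr// sqn_ge0.
have n0 : 0 <= n by exact: sqrtr_ge0.
rewrite -n2 !ltr_sqr ?(ltW fl0) ?(ltW fr0)// => ln nr.
have np : 0 < n by exact: lt_trans ln.
pose m := (fl + fr) / 2.
pose S := [set d | exists c rho, [/\ 0 < rho, euclid_closed_ball c rho p,
    euclid_closed_ball c rho `<=` Omega & d = 2 * rho]].
have SP rho : `|n - m| <= rho -> 0 < rho -> 2 * rho < fr - fl -> S (2 * rho).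
  move=> nm rho0 rhof; exists (m / n * p.1, m / n * p.2), rho; split=> //.
    rewrite /euclid_closed_ball/=.
    have -> : (p.1 - m / n * p.1) ^+ 2 + (p.2 - m / n * p.2) ^+ 2 = (n - m) ^+ 2.
      transitivity ((1 - m / n) ^+ 2 * sqn p); first by rewrite /sqn; ring.
      by rewrite -n2; field; exact: lt0r_neq0.
    by rewrite -[(n - m) ^+ 2]real_normK ?num_real// ler_pXn2r// nnegrE ltW.
  move=> x; rewrite /euclid_closed_ball annulusE/=.
  pose e1 := p.1 / n; pose e2 := p.2 / n.
  have e12 : e1 ^+ 2 + e2 ^+ 2 = 1.
    transitivity (sqn p / n ^+ 2); first by rewrite /sqn /e1 /e2; field; exact: lt0r_neq0.
    by rewrite -n2 divff// expf_neq0// gt_eqF.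
  have -> : m / n * p.1 = m * e1 by rewrite /e1 mulrA mulrAC.
  have -> : m / n * p.2 = m * e2 by rewrite /e2 mulrA mulrAC.
  set q1 := x.1 - _; set q2 := x.2 - _ => qrho.
  pose y := e1 * q1 + e2 * q2; pose z := Num.sqrt (q1 ^+ 2 + q2 ^+ 2).
  have z2 : z ^+ 2 = q1 ^+ 2 + q2 ^+ 2 by rewrite sqr_sqrtr// addr_ge0 ?sqr_ge0.
  have z0 : 0 <= z by exact: sqrtr_ge0.
  have zrho : z <= rho by rewrite -(@ler_pXn2r _ 2)// ?nnegrE ?(ltW rho0)// z2.
  have yz : `|y| <= z.
    rewrite -(@ler_pXn2r _ 2)// ?nnegrE// real_normK ?num_real// z2.
    (* Lagrange's identity for the unit vector (e1, e2), giving Cauchy-Schwarz for [y]. *)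
    have -> : q1 ^+ 2 + q2 ^+ 2 = y ^+ 2 + (e1 * q2 - e2 * q1) ^+ 2.
      by rewrite -[LHS]mul1r -e12 /y; ring.
    by rewrite lerDl sqr_ge0.
  have xE : sqn x = m ^+ 2 + 2 * m * y + z ^+ 2.
    have -> : m ^+ 2 = m ^+ 2 * (e1 ^+ 2 + e2 ^+ 2) by rewrite e12 mulr1.
    rewrite z2 /sqn /y /q1 /q2.
    transitivity ((m * e1 + (x.1 - m * e1)) ^+ 2 + (m * e2 + (x.2 - m * e2)) ^+ 2).
      by congr (_ ^+ 2 + _ ^+ 2); ring.
    ring.
  move: yz; rewrite ler_norml => /andP[y1 y2].
  have m0 : 0 < m by rewrite divr_gt0// addr_gt0.
  have mz : fl < m - z by rewrite /m; lra.
  have mz2 : m + z < fr by rewrite /m; lra.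
  have my1 : m * (- z) <= m * y by rewrite ler_wpM2l// ltW.
  have my2 : m * y <= m * z by rewrite ler_wpM2l// ltW.
  rewrite xE; apply/andP; split.
    apply: (@lt_le_trans _ _ ((m - z) ^+ 2)).
      by rewrite ltr_sqr// ?(ltW fl0)// (le_trans (ltW fl0))// ltW.
    by rewrite sqrrB; lra.
  apply: (@le_lt_trans _ _ ((m + z) ^+ 2)); first by rewrite sqrrD; lra.
  by rewrite ltr_sqr// ?addr_ge0// ltW.
have ubS : ubound S (fr - fl).
  by move=> _ [c [rho [rho0 _ cO ->]]]; exact: ball_in_annulus_radius cO.
have nm : 2 * `|n - m| < fr - fl.
  rewrite -[2]ger0_norm// -normrM ltr_norml /m; apply/andP; split; lra.
rewrite -[thickness _ _]/(sup S); apply/eqP; rewrite eq_le; apply/andP; split.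
  (* Nonemptiness: the radius is the mean of |n - m|, the least that reaches [p], and (fr -
     fl)/2. *)
  apply: ge_sup => //; exists (2 * ((2 * `|n - m| + (fr - fl)) / 4)); apply: SP.
  - have := normr_ge0 (n - m); lra.
  - have := normr_ge0 (n - m); lra.
  - have := normr_ge0 (n - m); lra.
rewrite leNgt; apply/negP => supS.
(* If the supremum were smaller, the diameter halfway between [M] and fr - fl would be admissible
   and exceed it; the second argument of the maximum ensures that this ball reaches [p]. *)
pose M := Num.max (sup S) (2 * `|n - m|).
have M1 : sup S <= M by rewrite le_max lexx.
have M2 : 2 * `|n - m| <= M by rewrite le_max lexx orbT.
have M3 : M < fr - fl by rewrite gt_max supS.
have := normr_ge0 (n - m) => nm0.
have : S (2 * ((M + (fr - fl)) / 4)) by apply: SP; lra.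
by move=> /(ub_le_sup (ex_intro _ _ ubS)); lra.
Qed.

End annulus_thickness.

(** * Properties of arbitrary weak solutions *)

Section annulus_solutions.
Context {R : realType} (fl fr a : R).
Hypotheses (fl0 : 0 < fl) (flr : fl < fr) (a0 : 0 < a).
Notation mu := (leb2 R).
Notation Omega := (annulus fl fr).
Implicit Types (s t : vfield R).

Lemma annulus_field_weak_solution : weak_solution setT Omega a (annulus_field fl fr a).
Proof.
apply/(weak_solutionP (measurable_annulus fl fr) (L2_indic_annulus fl0 flr) _
  (annulus_weak_jacobian fl0 flr a0)) => u g.
exact: annulus_weak_identity.
Qed.

Lemma weak_solution_annulus_field s : weak_solution setT Omega a s ->
  ae_eq_vfield s (annulus_field fl fr a).
Proof.
move=> ws; have Hs : H1v s by case: ws.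
apply: (weak_identity_unique (measurable_annulus fl fr) a0
  (lt_trans fl0 flr) (annulus_box fl0 flr) (H1v_weak_jacobian Hs) (annulus_weak_jacobian fl0 flr a0)).
  exact/(weak_solutionP (measurable_annulus fl fr) (L2_indic_annulus fl0 flr) _ (H1v_weak_jacobian Hs)).
by move=> u g; exact: annulus_weak_identity.
Qed.

Lemma is_weak_partial_ae (j : 'I_2) (f f' g : R * R -> R) : L2 f -> L2 f' ->
  {ae mu, forall p, f p = f' p} -> is_weak_partial j f g -> is_weak_partial j f' g.
Proof.
move=> Lf Lf' ff' [Lg gP]; split=> // phi tphi; rewrite -gP//.
have Ld := decays_L2 (test_function_decays (test_function_partial j tphi)).
by apply/esym; exact: L2prod_ae_eq.
Qed.

(** A solution agrees almost everywhere with the explicit field, hence so do its weak derivatives,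
    whichever representatives were chosen. *)
Lemma weak_solution_wdiv s : weak_solution setT Omega a s ->
  {ae mu, forall p, Omega p ->
    wdiv s p = 2 * (profile_q fl fr a / profile_delta fl fr a)}.
Proof.
move=> ws; have [Hs _] := ws; have sE := weak_solution_annulus_field ws.
have J i : {ae mu, forall p, weak_partial i (s i) p = annulus_jacobian fl fr a i i p}.
  apply: weak_partial_ae_eq; have [Li Ji] := annulus_weak_jacobian fl0 flr a0 i.
  apply: is_weak_partial_ae (Ji i) => //; first by case: (Hs i).
  by apply: filterS sE => p ->.
have J0 := J 0; have J1 := J 1.
apply: filterS2 J0 J1 => p e0 e1 Op.
by rewrite /wdiv sum_ord2 e0 e1 annulus_jacobian_div.
Qed.

Lemma weak_solution_polar s : weak_solution setT Omega a s ->
  {ae mu, forall p r theta, 0 < r -> p = (r * cos theta, r * sin theta) ->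
    s 0 p = annulus_profile fl fr a r * cos theta /\
    s 1 p = annulus_profile fl fr a r * sin theta}.
Proof.
move=> /weak_solution_annulus_field; apply: filterS => p sE r theta r0 pE.
have sq : sqn p = r ^+ 2.
  by rewrite pE /sqn/= !exprMn -mulrDr cos2Dsin2 mulr1.
rewrite !sE (annulus_profileE fl0 flr a0 r0) /annulus_field sq pE /pcoord/=.
by split; rewrite mulrAC.
Qed.

Lemma weak_solution_thickness s : weak_solution setT Omega a s ->
  {ae mu, forall p, Omega p ->
    (3 * fr + fl) / (2 * fr) * Num.sqrt a <= pde_thickness a s p - thickness Omega p
    <= 2 * (fr / fl) * Num.sqrt a}.
Proof.
move=> /weak_solution_wdiv; apply: filterS => p divE Op.
rewrite /pde_thickness divE// thickness_annulus//.
by rewrite profile_thickness_lower// profile_thickness_upper.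
Qed.

End annulus_solutions.

Theorem theorem5p1 (R : realType) (fl fr : R) (fl_gt0 : 0 < fl) (fl_lt_fr : fl < fr) :
  let Omega := annulus fl fr in
  let D := [set: R * R] in
  [/\
      forall a : R, 0 < a ->
        exists s : vfield R, weak_solution D Omega a s /\
          (forall t : vfield R, weak_solution D Omega a t -> ae_eq_vfield t s),
      forall (a : R) (s : vfield R), 0 < a -> weak_solution D Omega a s ->
        {ae leb2 R, forall p : R * R, forall r theta : R,
          0 < r -> p = (r * cos theta, r * sin theta) ->
          s 0 p = annulus_profile fl fr a r * cos theta /\
          s 1 p = annulus_profile fl fr a r * sin theta},
      forall (a : R) (s : vfield R), 0 < a -> weak_solution D Omega a s ->
        exists d : R, {ae leb2 R, forall p : R * R, Omega p -> wdiv s p = d},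
      (forall p : R * R, Omega p -> thickness Omega p = fr - fl) /\
      (forall e : R, 0 < e -> \forall a \near 0^'+,
        forall s : vfield R, weak_solution D Omega a s ->
          {ae leb2 R, forall p : R * R, Omega p ->
            `|pde_thickness a s p - thickness Omega p| < e})
    &
      forall (a : R) (s : vfield R), 0 < a -> weak_solution D Omega a s ->
        {ae leb2 R, forall p : R * R, Omega p ->
          [/\ 0 < (3 * fr + fl) / (2 * fr) * Num.sqrt a,
              (3 * fr + fl) / (2 * fr) * Num.sqrt a
                <= pde_thickness a s p - thickness Omega p
            & pde_thickness a s p - thickness Omega p
                <= 2 * (fr / fl) * Num.sqrt a]}].

Proof.
move=> Omega D.
have err_gt0 (a : R) : 0 < a -> 0 < (3 * fr + fl) / (2 * fr) * Num.sqrt a.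
  move=> a0; have fr0 := lt_trans fl_gt0 fl_lt_fr.
  by rewrite mulr_gt0 ?sqrtr_gt0// divr_gt0 ?mulr_gt0// addr_gt0// mulr_gt0.
split.
- move=> a a0; exists (annulus_field fl fr a); split.
    exact: annulus_field_weak_solution.
  by move=> t; exact: weak_solution_annulus_field.
- by move=> a s a0; exact: weak_solution_polar.
- move=> a s a0 ws; eexists; exact: (weak_solution_wdiv fl_gt0 fl_lt_fr a0 ws).
- split=> [p|e e0]; first exact: thickness_annulus.
  pose C := 2 * (fr / fl).
  have C0 : 0 < C by rewrite mulr_gt0// divr_gt0// (lt_trans fl_gt0).
  near=> a => s ws; have a0 : 0 < a by near: a; exact: nbhs_right_gt.
  apply: filterS (weak_solution_thickness fl_gt0 fl_lt_fr a0 ws) => p + Op.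
  move=> /(_ Op)/andP[h1 h2].
  have h0 := err_gt0 _ a0.
  rewrite ger0_norm; last exact: ltW (lt_le_trans h0 h1).
  apply: (le_lt_trans h2); rewrite -/C mulrC -ltr_pdivlMr//.
  (* The bound C sqrt a < e amounts to a < (e / C)^2, which holds for a near 0. *)
  have -> : e / C = Num.sqrt ((e / C) ^+ 2) by rewrite sqrtr_sqr gtr0_norm// divr_gt0.
  rewrite ltr_sqrt ?exprn_gt0 ?divr_gt0//.
  by near: a; apply: nbhs_right_lt; rewrite exprn_gt0// divr_gt0.
- move=> a s a0 ws.
  apply: filterS (weak_solution_thickness fl_gt0 fl_lt_fr a0 ws) => p + Op.
  by move=> /(_ Op)/andP[h1 h2]; split=> //; exact: err_gt0.
Unshelve. all: by end_near. Qed.
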